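(* Let $R=\mathbb C[[u,v]]$ and let $\mathbb O_{11}\subseteq \mathrm{GL}(2,\mathbb C)$ be the group generated by the matrices $$\phi=\begin{pmatrix}\lambda&0\\0&\lambda\end{pmatrix},\quad \psi=\begin{pmatrix}\zeta&0\\0&\zeta^{-1}\end{pmatrix},\quad \tau=\begin{pmatrix}0&i\\ i&0\end{pmatrix},\quad \eta=\frac{1}{\sqrt2}\begin{pmatrix}\zeta&\zeta^3\\ \zeta&\zeta^7\end{pmatrix},$$ where $\lambda$ and $\zeta$ are primitive roots of unity in $\mathbb C$ of orders $22$ and $8$ respectively and $i$ is the imaginary unit. Then the quotient singularity $R^{\mathbb O_{11}}$ is nearly Gorenstein.
   Context: The group $\mathbb O_{11}$ is a finite small subgroup of $\mathrm{GL}(2,\mathbb C)$ (it contains no pseudo-reflections). It acts linearly on $R$ by $\mathbb C$-algebra automorphisms, the action on the variables $u,v$ being given by matrix multiplication (on the column vector with entries $u,v$), and $R^{\mathbb O_{11}}$ denotes the ring of invariants, a Cohen-Macaulay complete local normal domain of dimension 2. For a Cohen-Macaulay local ring $(A,\mathfrak m)$ with canonical module $\omega_A$, the trace of $\omega_A$ is the ideal $\mathrm{tr}(\omega_A)=\sum_{\varphi\in\mathrm{Hom}_A(\omega_A,A)}\varphi(\omega_A)$. The ring $A$ is called nearly Gorenstein if $\mathfrak m\subseteq\mathrm{tr}(\omega_A)$. *)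

(* Defs.v *)
From HB Require Import structures.
From mathcomp Require Import all_boot all_order all_algebra.
From mathcomp Require Import complex.
From mathcomp Require Import all_classical reals.
From mathcomp Require Import zify.

Set Implicit Arguments.
Unset Strict Implicit.
Unset Printing Implicit Defensive.

Import GRing.Theory.

Local Open Scope classical_set_scope.
Local Open Scope ring_scope.

(* [coef2 f a b] is the coefficient of [u^a v^b]. *)
Record pseries2 (K : Type) := PSeries2 { coef2 :> nat -> nat -> K }.

HB.instance Definition _ (K : Type) := gen_eqMixin (pseries2 K).
HB.instance Definition _ (K : Type) := gen_choiceMixin (pseries2 K).

Section PowerSeries.
Variable K : comNzRingType.
Local Notation R := (pseries2 K).
Implicit Types (f g h x y : R) (p q : {poly {poly K}}).

Lemma ps_ext f g : (forall a b, f a b = g a b) -> f = g.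
Proof.
case: f g => [f] [g] /= fg; congr PSeries2.
by apply/funext => a; apply/funext => b.
Qed.

Definition ps_zero : R := PSeries2 (fun _ _ => 0).
Definition ps_opp f : R := PSeries2 (fun a b => - f a b).
Definition ps_add f g : R := PSeries2 (fun a b => f a b + g a b).
Definition ps_one : R := PSeries2 (fun a b => ((a == 0%N) && (b == 0%N))%:R).
Definition ps_mul f g : R := PSeries2 (fun a b =>
  \sum_(i < a.+1) \sum_(j < b.+1) f i j * g (a - i)%N (b - j)%N).

Fact ps_addA : associative ps_add.
Proof. by move=> f g h; apply: ps_ext => a b /=; rewrite addrA. Qed.
Fact ps_addC : commutative ps_add.
Proof. by move=> f g; apply: ps_ext => a b /=; rewrite addrC. Qed.
Fact ps_add0 : left_id ps_zero ps_add.
Proof. by move=> f; apply: ps_ext => a b /=; rewrite add0r. Qed.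
Fact ps_addN : left_inverse ps_zero ps_opp ps_add.
Proof. by move=> f; apply: ps_ext => a b /=; rewrite addNr. Qed.

HB.instance Definition _ :=
  GRing.isZmodule.Build R ps_addA ps_addC ps_add0 ps_addN.

Definition ps_trunc n f : {poly {poly K}} :=
  \poly_(j < n) \poly_(i < n) f i j.

Lemma coef_trunc n f a b : (a < n)%N -> (b < n)%N -> (ps_trunc n f)`_b`_a = f a b.
Proof. by move=> an bn; rewrite coef_poly bn coef_poly an. Qed.

Lemma coefM2 p q a b : (p * q)`_b`_a =
  \sum_(i < a.+1) \sum_(j < b.+1) p`_j`_i * q`_(b - j)`_(a - i).
Proof.
rewrite coefM coef_sum exchange_big /=.
by apply: eq_bigr => j _; rewrite coefM.
Qed.

Lemma eq_coefM2 p p' q q' a b :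
    (forall i j, (i <= a)%N -> (j <= b)%N -> p`_j`_i = p'`_j`_i) ->
    (forall i j, (i <= a)%N -> (j <= b)%N -> q`_j`_i = q'`_j`_i) ->
  (p * q)`_b`_a = (p' * q')`_b`_a.
Proof.
move=> Hp Hq; rewrite !coefM2; apply: eq_bigr => i _; apply: eq_bigr => j _.
by rewrite Hp ?Hq ?leq_subr // -ltnS.
Qed.

Lemma ps_mulE n f g a b : (a < n)%N -> (b < n)%N ->
  ps_mul f g a b = (ps_trunc n f * ps_trunc n g)`_b`_a.
Proof.
move=> an bn; rewrite coefM2 /=; apply: eq_bigr => i _; apply: eq_bigr => j _.
rewrite !coef_trunc //.
- by apply: leq_ltn_trans an; rewrite leq_subr.
- by apply: leq_ltn_trans bn; rewrite leq_subr.
- by apply: leq_trans (ltn_ord i) an.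
- by apply: leq_trans (ltn_ord j) bn.
Qed.

Lemma trunc_mul n f g i j : (i < n)%N -> (j < n)%N ->
  (ps_trunc n (ps_mul f g))`_j`_i = (ps_trunc n f * ps_trunc n g)`_j`_i.
Proof. by move=> ? ?; rewrite coef_trunc // (@ps_mulE n). Qed.

Fact ps_mulC : commutative ps_mul.
Proof.
move=> f g; apply: ps_ext => a b; pose n := (a + b).+1.
by rewrite !(@ps_mulE n) ?ltnS ?leq_addr ?leq_addl // mulrC.
Qed.

Fact ps_mulA : associative ps_mul.
Proof.
move=> f g h; apply: ps_ext => a b; pose n := (a + b).+1.
have an : (a < n)%N by rewrite ltnS leq_addr.
have bn : (b < n)%N by rewrite ltnS leq_addl.
rewrite !(@ps_mulE n f) // !(@ps_mulE n _ h) //.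
transitivity ((ps_trunc n f * (ps_trunc n g * ps_trunc n h))`_b`_a).
  apply: eq_coefM2 => // i j ia jb.
  by rewrite trunc_mul // ?(leq_ltn_trans ia) ?(leq_ltn_trans jb).
rewrite mulrA; apply/esym; apply: eq_coefM2 => // i j ia jb.
by rewrite trunc_mul // ?(leq_ltn_trans ia) ?(leq_ltn_trans jb).
Qed.

Fact ps_mul1 : left_id ps_one ps_mul.
Proof.
move=> f; apply: ps_ext => a b /=.
rewrite big_ord_recl big_ord_recl /= !subn0 mul1r.
rewrite big1 ?addr0 => [|j _]; last by rewrite mul0r.
by rewrite big1 ?addr0 // => i _; rewrite big1 // => j _; rewrite mul0r.
Qed.

Fact ps_mulDl : left_distributive ps_mul ps_add.
Proof.
move=> f g h; apply: ps_ext => a b /=; rewrite -big_split /=.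
apply: eq_bigr => i _; rewrite -big_split /=.
by apply: eq_bigr => j _; rewrite mulrDl.
Qed.

Fact ps_one_neq0 : ps_one != 0.
Proof.
apply/eqP => /(congr1 (fun f : R => f 0%N 0%N)) /= /eqP.
by rewrite oner_eq0.
Qed.

HB.instance Definition _ := GRing.Zmodule_isComNzRing.Build R
  ps_mulA ps_mulC ps_mul1 ps_mulDl ps_one_neq0.

Definition ps_const (c : K) : R :=
  PSeries2 (fun a b => if (a == 0%N) && (b == 0%N) then c else 0).

(* The linear form [c u + d v]. *)
Definition ps_lin (c d : K) : R := PSeries2 (fun a b =>
  if (a == 1%N) && (b == 0%N) then c
  else if (a == 0%N) && (b == 1%N) then d else 0).

(* The substitution [f(x,y)], for [x] and [y] without constant term: then
   [x^i y^j] has order at least [i+j], so that only the terms with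
   [i, j <= a+b] contribute to the coefficient of [u^a v^b]. *)
Definition ps_subst f x y : R := PSeries2 (fun a b =>
  \sum_(i < (a + b).+1) \sum_(j < (a + b).+1) f i j * (x ^+ i * y ^+ j) a b).

Lemma coef_subst f x y a b : ps_subst f x y a b =
  \sum_(i < (a + b).+1) \sum_(j < (a + b).+1) f i j * (x ^+ i * y ^+ j) a b.
Proof. by []. Qed.

Lemma ps_constM c f a b : (ps_const c * f) a b = c * f a b.
Proof.
rewrite /= big_ord_recl big_ord_recl /= !subn0.
rewrite big1 ?addr0 => [|j _]; last by rewrite mul0r.
by rewrite big1 ?addr0 // => i _; rewrite big1 // => j _; rewrite mul0r.
Qed.

Fact ps_const_additive : zmod_morphism ps_const.
Proof.
move=> c d; apply: ps_ext => a b /=.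
by case: ifP => // _; rewrite subr0.
Qed.

Fact ps_const_multiplicative : monoid_morphism ps_const.
Proof.
split=> [|c d]; apply: ps_ext => a b; first by rewrite /=; case: ifP.
by rewrite ps_constM /=; case: ifP => // _; rewrite mulr0.
Qed.

HB.instance Definition _ :=
  GRing.isZmodMorphism.Build K R ps_const ps_const_additive.
HB.instance Definition _ :=
  GRing.isMonoidMorphism.Build K R ps_const ps_const_multiplicative.

Lemma ps_coefD f g a b : (f + g) a b = f a b + g a b. Proof. by []. Qed.
Lemma ps_coefB f g a b : (f - g) a b = f a b - g a b. Proof. by []. Qed.

Lemma ps_coef_sum (I : Type) (r : seq I) (P : pred I) (F : I -> R) a b :
  (\sum_(i <- r | P i) F i) a b = \sum_(i <- r | P i) F i a b.
Proof. by elim/big_rec2: _ => //= i c f _ <-. Qed.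

Definition ps_order_ge n f := forall a b, (a + b < n)%N -> f a b = 0.

Lemma ps_order_geM m n f g :
  ps_order_ge m f -> ps_order_ge n g -> ps_order_ge (m + n) (f * g).
Proof.
move=> fm gn a b abmn /=; apply: big1 => i _; apply: big1 => j _.
have [ijm|mij] := ltnP (i + j) m; first by rewrite fm ?mul0r.
rewrite gn ?mulr0 //; case: i j mij => [i ia] [j jb] /= mij; lia.
Qed.

Lemma ps_order_geX n f : ps_order_ge 1 f -> ps_order_ge n (f ^+ n).
Proof.
move=> f1; elim: n => [|n IHn]; first by move=> a b.
by rewrite exprS -add1n; apply: ps_order_geM.
Qed.

Section Subst.
Variables x y : R.
Hypotheses (x1 : ps_order_ge 1 x) (y1 : ps_order_ge 1 y).

Lemma ps_monom_eq0 i j a b : (a + b < i + j)%N -> (x ^+ i * y ^+ j) a b = 0.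
Proof. by apply: ps_order_geM; apply: ps_order_geX. Qed.

Let cx : commr_rmorph ps_const x. Proof. by move=> c; apply: mulrC. Qed.
Let ev1 : {rmorphism {poly K} -> R} := horner_morph cx.
Let cy : commr_rmorph ev1 y. Proof. by move=> c; apply: mulrC. Qed.
Let ev : {rmorphism {poly {poly K}} -> R} := horner_morph cy.
Let ev1E (q : {poly K}) : ev1 q = (map_poly ps_const q).[x]. Proof. by []. Qed.
Let evE p : ev p = (map_poly ev1 p).[y]. Proof. by []. Qed.

Lemma ev_coef n p a b : (size p <= n)%N -> (forall j, (size (p`_j)%R <= n)%N) ->
  ev p a b = \sum_(i < n) \sum_(j < n) p`_j`_i * (x ^+ i * y ^+ j) a b.
Proof.
move=> sp spj; rewrite evE (@horner_coef_wide _ n); last first.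
  by apply: leq_trans sp; apply: size_poly.
rewrite ps_coef_sum [RHS]exchange_big; apply: eq_bigr => j _.
have -> : (map_poly ev1 p)`_j = (map_poly ps_const p`_j).[x].
  by rewrite coef_map.
rewrite (@horner_coef_wide _ n); last first.
  by apply: leq_trans (spj j); apply: size_poly.
rewrite mulr_suml ps_coef_sum; apply: eq_bigr => i _.
by rewrite coef_map -mulrA ps_constM.
Qed.

Lemma size_trunc n f : (size (ps_trunc n f) <= n)%N.
Proof. exact: size_poly. Qed.

Lemma size_trunc_coef n f j : (size ((ps_trunc n f)`_j)%R <= n)%N.
Proof.
by rewrite coef_poly; case: ifP => _; [apply: size_poly | rewrite size_poly0].
Qed.

Lemma ps_substE n f a b : (a + b < n)%N ->
  ps_subst f x y a b = ev (ps_trunc n f) a b.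
Proof.
move=> abn; rewrite (@ev_coef n) ?size_trunc //; last exact: size_trunc_coef.
rewrite coef_subst (big_ord_widen n (fun i => \sum_(j < (a + b).+1)
  f i j * (x ^+ i * y ^+ j) a b)) // big_mkcond.
apply: eq_bigr => i _; case: ifP => [iab|/negbT]; last first.
  rewrite -leqNgt => abi; apply/esym/big1 => j _.
  by rewrite ps_monom_eq0 ?mulr0 // (leq_trans abi) ?leq_addr.
rewrite (big_ord_widen n (fun j => f i j * (x ^+ i * y ^+ j) a b)) //.
rewrite big_mkcond; apply: eq_bigr => j _; case: ifP => [jab|/negbT].
  by rewrite coef_trunc.
rewrite -leqNgt => abj; apply/esym.
by rewrite ps_monom_eq0 ?mulr0 // (leq_trans abj) ?leq_addl.
Qed.

Lemma ev_order n p : (forall i j, (i < n)%N -> (j < n)%N -> p`_j`_i = 0) ->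
  ps_order_ge n (ev p).
Proof.
move=> pn a b abn.
pose m := maxn (size p) (\max_(j < size p) size (p`_j)%R).
rewrite (@ev_coef m) ?leq_maxl // => [|j]; last first.
  have [jp|pj] := ltnP j (size p); last by rewrite nth_default ?size_poly0.
  apply: leq_trans (leq_maxr _ _).
  exact: (leq_bigmax (Ordinal jp)).
apply: big1 => i _; apply: big1 => j _.
have [ni|ni] := leqP n i.
  by rewrite ps_monom_eq0 ?mulr0 // (leq_trans abn) // (leq_trans ni) ?leq_addr.
have [nj|nj] := leqP n j.
  by rewrite ps_monom_eq0 ?mulr0 // (leq_trans abn) // (leq_trans nj) ?leq_addl.
by rewrite pn // mul0r.
Qed.

Lemma ps_substM f g :
  ps_subst (f * g) x y = ps_subst f x y * ps_subst g x y.
Proof.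
apply: ps_ext => a b; pose n := (a + b).+1.
have abn : (a + b < n)%N by [].
rewrite (ps_substE _ abn).
transitivity (ev (ps_trunc n f * ps_trunc n g) a b).
  apply/eqP; rewrite -subr_eq0 -ps_coefB -rmorphB; apply/eqP.
  apply: (@ev_order n) => // i j iN jN.
  by rewrite !coefB trunc_mul // subrr.
rewrite rmorphM /=; apply: eq_bigr => i _; apply: eq_bigr => j _.
have ia : (i <= a)%N by rewrite -ltnS.
have jb : (j <= b)%N by rewrite -ltnS.
by rewrite -!ps_substE // ltnS leq_add ?leq_subr.
Qed.

Lemma ps_subst1 : ps_subst 1 x y = 1.
Proof.
apply: ps_ext => a b; rewrite (ps_substE _ (leqnn (a + b).+1)).
suff -> : ps_trunc (a + b).+1 1 = 1 by rewrite rmorph1.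
apply/polyP => j; apply/polyP => i; rewrite coef_poly coef1.
case: j => [|j] /=; rewrite ?coef_poly ?coef1 ?coef0.
  by case: i => [|i] /=; rewrite ?if_same.
by case: ifP; rewrite ?coef0 // coef_poly /= andbF; case: ifP.
Qed.

Lemma ps_substB f g :
  ps_subst (f - g) x y = ps_subst f x y - ps_subst g x y.
Proof.
apply: ps_ext => a b; rewrite ps_coefB !coef_subst -sumrB; apply: eq_bigr => i _.
by rewrite -sumrB; apply: eq_bigr => j _; rewrite mulrBl.
Qed.

End Subst.

Lemma ps_order_lin c d : ps_order_ge 1 (ps_lin c d).
Proof. by move=> [|a] [|b]. Qed.

(* [u] and [v] are sent to the entries of [s *m (u, v)^T]. *)
Definition ps_act (s : 'M[K]_2) f : R :=
  ps_subst f (ps_lin (s 0 0) (s 0 1)) (ps_lin (s 1 0) (s 1 1)).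

Variable G : set 'M[K]_2.

Definition invariant : {pred R} :=
  fun f => `[< forall s, G s -> ps_act s f = f >].

Fact invariant_subring : subring_closed invariant.
Proof.
have H1 c d := ps_order_lin c d.
split=> [|f g /asboolP Hf /asboolP Hg|f g /asboolP Hf /asboolP Hg];
  apply/asboolP => s Gs; rewrite /ps_act.
- exact: ps_subst1.
- by rewrite ps_substB // -![ps_subst _ _ _]/(ps_act s _) Hf // Hg.
- by rewrite ps_substM // -![ps_subst _ _ _]/(ps_act s _) Hf // Hg.
Qed.

HB.instance Definition _ :=
  GRing.isSubringClosed.Build R invariant invariant_subring.

Record invariant_ring := Invariant {
  invariant_val :> R;
  invariant_valP : invariant_val \in invariant }.

HB.instance Definition _ := [isSub for invariant_val].
HB.instance Definition _ := [Choice of invariant_ring by <:].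
HB.instance Definition _ := [SubChoice_isSubComNzRing of invariant_ring by <:].

End PowerSeries.

Inductive generated_group (F : fieldType) (n : nat) (S : set 'M[F]_n) :
    set 'M[F]_n :=
| gen_incl g : S g -> generated_group S g
| gen_one : generated_group S 1%:M
| gen_mul g h :
    generated_group S g -> generated_group S h -> generated_group S (g *m h)
| gen_inv g : generated_group S g -> generated_group S (invmx g).

Section LocalAlgebra.
Variable A : comNzRingType.
Implicit Types (I J m : set A).

Definition ideal I := [/\ I 0, (forall a b, I a -> I b -> I (a + b))
  & (forall a b, I b -> I (a * b))].

Definition prime_ideal I :=
  [/\ ideal I, ~ I 1 & forall a b, I (a * b) -> I a \/ I b].

Definition maximal_ideal I :=
  [/\ ideal I, ~ I 1 & forall J, ideal J -> ~ J 1 -> I `<=` J -> J = I].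

Definition noetherian := forall I, ideal I ->
  exists (n : nat) (g : 'I_n -> A), forall a,
    I a <-> exists c : 'I_n -> A, a = \sum_i c i * g i.

Definition local_ring m :=
  [/\ noetherian, maximal_ideal m & forall J, maximal_ideal J -> J = m].

Definition prime_chain (n : nat) (p : nat -> set A) :=
  (forall i, (i <= n)%N -> prime_ideal (p i)) /\
  (forall i, (i < n)%N -> p i `<` p i.+1).

Definition krull_dim (d : nat) :=
  (exists p, prime_chain d p) /\ (forall n p, prime_chain n p -> (n <= d)%N).

(* The ideal generated by the elements of [s]. *)
Definition span (s : seq A) : set A := fun a =>
  exists c : nat -> A, a = \sum_(i < size s) c i * s`_i.

Definition regular_seq m (s : seq A) :=
  [/\ (forall a, a \in s -> m a), ~ span s 1
    & forall i, (i < size s)%N ->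
        forall a, span (take i s) (s`_i * a) -> span (take i s) a].

Definition depth m (d : nat) :=
  (exists s, regular_seq m s /\ size s = d) /\
  (forall s, regular_seq m s -> (size s <= d)%N).

Definition cohen_macaulay m := exists d, krull_dim d /\ depth m d.

Definition finitely_generated (M : lmodType A) :=
  exists (n : nat) (g : 'I_n -> M),
    forall x, exists c : 'I_n -> A, x = \sum_i c i *: g i.

Definition surj (T U : Type) (f : T -> U) := forall y, exists x, f x = y.

Definition projective (P : lmodType A) :=
  forall (M N : lmodType A) (p : {linear M -> N}) (f : {linear P -> N}),
    surj p -> exists g : {linear P -> M}, forall x, p (g x) = f x.

Record projective_resolution (M : lmodType A) := ProjectiveResolution {
  res_obj :> nat -> lmodType A;
  res_d : forall i, {linear res_obj i.+1 -> res_obj i};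
  res_aug : {linear res_obj 0 -> M};
  res_projective : forall i, projective (res_obj i);
  res_aug_surj : surj res_aug;
  res_exact0 : forall x, res_aug x = 0 <-> exists y, res_d 0 y = x;
  res_exact : forall i x, res_d i x = 0 <-> exists y, res_d i.+1 y = x }.

Section Ext.
Variables (M N : lmodType A) (P : projective_resolution M).

Definition cocycle i (f : {linear P i -> N}) := forall x, f (res_d P i x) = 0.

Definition coboundary i : {linear P i -> N} -> Prop :=
  match i with
  | 0 => fun f => forall x, f x = 0
  | j.+1 => fun f =>
      exists h : {linear P j -> N}, forall x, f x = h (res_d P j x)
  end.
End Ext.

(* [E] is isomorphic to [Ext^i_A(M, N) = H^i(Hom_A(P, N))]: there is an
   A-linear map from the cocycles onto [E] whose kernel consists of the
   coboundaries. Its values on functions that are not cocycles are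
   irrelevant. *)
Definition is_Ext (i : nat) (M N E : lmodType A) :=
  exists (P : projective_resolution M) (e : {linear P i -> N} -> E),
    [/\ (forall (a : A) (f g h : {linear P i -> N}),
           cocycle f -> cocycle g -> (forall x, h x = a *: f x + g x) ->
           e h = a *: e f + e g),
        (forall y, exists2 f, cocycle f & e f = y)
      & (forall f, cocycle f -> (e f = 0 <-> coboundary f))].

Definition residue_field m (k : lmodType A) :=
  exists p : {linear A^o -> k}, surj p /\ (forall a, p a = 0 <-> m a).

(* A finitely generated module [w] such that [Ext^i_A(k, w)] is [k] for
   [i = dim A] and vanishes otherwise, [k] being the residue field; that is,
   a maximal Cohen-Macaulay module of type 1 and finite injective dimension. *)
Definition canonical_module m (w : lmodType A) :=
  finitely_generated w /\
  exists (d : nat) (k : lmodType A),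
    [/\ krull_dim d, residue_field m k, is_Ext d k w k
      & forall i, i <> d -> is_Ext i k w 'rV[A]_0].

Definition trace_ideal (w : lmodType A) : set A := fun a =>
  exists (n : nat) (phi : 'I_n -> {linear w -> A^o}) (x : 'I_n -> w),
    a = \sum_i (phi i (x i) : A).

(* A canonical module is unique up to isomorphism, and the trace is invariant
   under isomorphism, so the choice of [w] is immaterial. *)
Definition nearly_gorenstein := exists m,
  [/\ local_ring m, cohen_macaulay m
    & exists w : lmodType A, canonical_module m w /\ m `<=` trace_ideal w].

End LocalAlgebra.

Definition mx2 (F : nzRingType) (a b c d : F) : 'M[F]_2 :=
  \matrix_(i, j) if i == 0 then (if j == 0 then a else b)
                 else (if j == 0 then c else d).

Section OctahedralGroup.
Variables (RR : realType) (lam zeta : RR[i]).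

Definition phi : 'M[RR[i]]_2 := mx2 lam 0 0 lam.
Definition psi : 'M[RR[i]]_2 := mx2 zeta 0 0 zeta^-1.
Definition tau : 'M[RR[i]]_2 := mx2 0 'i%C 'i%C 0.
Definition eta : 'M[RR[i]]_2 :=
  ((Num.sqrt (2 : RR))%:C)%C^-1 *: mx2 zeta (zeta ^+ 3) zeta (zeta ^+ 7).

Definition O11 : set 'M[RR[i]]_2 :=
  generated_group [set phi; psi; tau; eta].

End OctahedralGroup.

(* Main.v *)
From HB Require Import structures.
From mathcomp Require Import all_boot all_order all_algebra.
From mathcomp Require Import complex.
From mathcomp Require Import all_classical reals.
From mathcomp Require Import zify ring.
Require Import Defs.

(** The group is the product of the scalars of order 11 with the binary octahedral group,
    because -1 already lies in the latter. The invariants of the binary octahedral group are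
    classical: with
      [T = u v (u^4 - v^4)], [W = u^8 + 14 u^4 v^4 + v^8],
      [chi = u^12 - 33 u^8 v^4 - 33 u^4 v^8 + v^12],
    they are the series [P(x, y) + z Q(x, y)], uniquely, where [x = W], [y = T^2],
    [z = T chi] have degrees 8, 12, 18 ([ev2_onto], [ev2_inj]). Indeed an invariant is
    determined modulo [T] by its restriction to the line [v = 0], one of the six lines where
    [T] vanishes and which the group permutes; that restriction is a series in [u^8] for an
    invariant, and [u^12] times such a series for a form that changes sign under [psi].
    Subtracting a series in [W], respectively [chi] times one, leaves a multiple of [T], and
    the quotient has the opposite type; the process converges.

    Consequently the ring [A] of the theorem is spanned topologically by the monomials
    [x^a y^b z^c], [c < 2], with [4a + 6b + 9c = 0] modulo 11, and the canonical module
    [omega], the semi-invariants for the inverse of the determinant, by those with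
    [4a + 6b + 9c = -1]. Since [4a + 6b + 9c] is 1 modulo 11 for [x^3] and for [y^2],
    multiplication by these two elements maps [omega] into [A], and every nonconstant
    monomial of [A] is divisible by one of them: no exponents with [a < 3], [b < 2], [c < 2],
    not all zero, satisfy the congruence. So the trace contains the maximal ideal
    ([invariant_split]).

    It remains to see that [A] is a Cohen-Macaulay local ring of dimension 2 with canonical
    module [omega]. Let [B] be the ring of power series in [X = x^11] and [Y = y^11]. Both [A]
    and [omega] are free over [B], on monomials with [a, b < 11], and complementary monomials
    multiply to [x^10 y^10 z]; so [omega] is the [B]-dual of [A]
    ([ell_pairing]). The rest holds for any such pair. Submodules of free [B]-modules are
    finitely generated ([noetherian_rows]). A prime strictly above a nonzero prime contains
    [X] and [Y], by Weierstrass division and Cayley-Hamilton ([prime_XY]), so the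
    dimension is 2. A regular sequence of length three would contradict the existence of a
    socle element modulo [(X, Y)] ([regular_seq_size]), so the depth is 2.

    For [Ext(k, omega)] take a resolution of [k] by finite free [A]-modules. In degrees at most
    2 everything is computed from the Koszul relation [Y e1 - X e2], where [e1] and [e2]
    lift [X] and [Y]: [f |-> f (Y e1 - X e2)] identifies [Ext^2] with the socle of
    [omega / (X, Y)], which is dual to [A / m] ([ext2_onto], [ext2_coboundary]).
    In degree at least 3 the resolution stays exact modulo [(X, Y)], where cocycles
    become functionals on finite-dimensional spaces; these extend, and two successive
    approximations lift the extension ([high_ext]). *)

Set Implicit Arguments.
Unset Strict Implicit.
Unset Printing Implicit Defensive.

Import GRing.Theory Num.Theory.

Local Open Scope classical_set_scope.
Local Open Scope ring_scope.

(** * Power series in two variables *)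

Section Series.
Variable K : comNzRingType.
Local Notation B := (pseries2 K).
Implicit Types f g s : B.

Definition psX : B := ps_lin 1 0.
Definition psY : B := ps_lin 0 1.

Lemma ps_linE c d : ps_lin c d = ps_const c * psX + ps_const d * psY.
Proof.
apply: ps_ext => a b; rewrite ps_coefD !ps_constM /=.
by case: a => [|[|a]]; case: b => [|[|b]] /=;
  rewrite ?mulr1 ?mulr0 ?addr0 ?add0r.
Qed.

Lemma coef_psXM f a b : (psX * f) a b = if a is a'.+1 then f a' b else 0.
Proof.
rewrite /=; case: a => [|a].
  by rewrite big1 // => i _; rewrite big1 // => j _; rewrite (ord1 i) /= if_same mul0r.
rewrite big_ord_recl big1 ?add0r => [|j _]; last by rewrite /= if_same mul0r.
rewrite big_ord_recl big_ord_recl /bump /= subn0 subSS subn0 mul1r.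
rewrite big1 ?addr0 => [|j _]; last by rewrite mul0r.
rewrite big1 ?addr0 // => i _.
by rewrite big1 // => j _; rewrite mul0r.
Qed.

Lemma coef_psYM f a b : (psY * f) a b = if b is b'.+1 then f a b' else 0.
Proof.
rewrite /=; rewrite big_ord_recl /= [X in _ + X]big1 ?addr0; last first.
  by move=> i _; rewrite big1 // => j _; rewrite /= if_same mul0r.
rewrite subn0; case: b => [|b]; first by rewrite big_ord1 mul0r.
rewrite !big_ord_recl /= mul0r add0r subSS subn0 mul1r.
by rewrite big1 ?addr0 // => j _; rewrite mul0r.
Qed.

Lemma coef_psXnM n f a b : (psX ^+ n * f) a b = if (n <= a)%N then f (a - n)%N b else 0.
Proof.
elim: n a => [|n IHn] a; first by rewrite expr0 mul1r subn0.
by rewrite exprS -mulrA coef_psXM; case: a => [|a] //; rewrite IHn.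
Qed.

Lemma coef_psYnM n f a b : (psY ^+ n * f) a b = if (n <= b)%N then f a (b - n)%N else 0.
Proof.
elim: n b => [|n IHn] b; first by rewrite expr0 mul1r subn0.
by rewrite exprS -mulrA coef_psYM; case: b => [|b] //; rewrite IHn.
Qed.

Lemma coef_monomM i j f a b : (psX ^+ i * psY ^+ j * f) a b =
  if (i <= a)%N && (j <= b)%N then f (a - i)%N (b - j)%N else 0.
Proof. by rewrite -mulrA coef_psXnM coef_psYnM; case: leqP. Qed.

Lemma coef_monom i j a b :
  (psX ^+ i * psY ^+ j) a b = ((a == i) && (b == j))%:R.
Proof.
rewrite -[X in coef2 X]mulr1 coef_monomM /= !subn_eq0 !eqn_leq.
by case: (leqP i a); case: (leqP j b); rewrite ?andbT ?andbF.
Qed.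

Lemma ps_coef00M f g : (f * g) 0 0 = f 0 0 * g 0 0.
Proof. by rewrite /= !big_ord1. Qed.

Lemma ps_coefN f a b : (- f) a b = - f a b. Proof. by []. Qed.
Lemma ps_coef0 a b : (0 : B) a b = 0. Proof. by []. Qed.

Lemma psX_inj : injective (fun f => psX * f).
Proof.
move=> f g fg; apply: ps_ext => a b.
by move/(congr1 (fun h : B => h a.+1 b)): fg; rewrite !coef_psXM.
Qed.

Lemma psY_inj : injective (fun f => psY * f).
Proof.
move=> f g fg; apply: ps_ext => a b.
by move/(congr1 (fun h : B => h a b.+1)): fg; rewrite !coef_psYM.
Qed.

Definition shiftX n f : B := PSeries2 (fun a b => f (a + n)%N b).
Definition shiftY n f : B := PSeries2 (fun a b => f a (b + n)%N).

Lemma psX_dvdn n f : (forall a b, (a < n)%N -> f a b = 0) ->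
  f = psX ^+ n * shiftX n f.
Proof.
move=> f0; apply: ps_ext => a b; rewrite coef_psXnM /=.
by case: leqP => [na|an]; rewrite ?subnK // f0.
Qed.

Lemma psY_dvdn n f : (forall a b, (b < n)%N -> f a b = 0) ->
  f = psY ^+ n * shiftY n f.
Proof.
move=> f0; apply: ps_ext => a b; rewrite coef_psYnM /=.
by case: leqP => [na|an]; rewrite ?subnK // f0.
Qed.

Lemma psX_dvd f : (forall b, f 0%N b = 0) -> f = psX * shiftX 1 f.
Proof. by move=> f0; rewrite -[psX]expr1; apply: psX_dvdn => -[|a]. Qed.

Lemma psY_dvd f : (forall a, f a 0%N = 0) -> f = psY * shiftY 1 f.
Proof. by move=> f0; rewrite -[psY]expr1; apply: psY_dvdn => a [|b]. Qed.

Lemma psXY_reg f g : psX * f = psY * g -> exists h, f = psY * h /\ g = psX * h.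
Proof.
move=> fg; exists (shiftY 1 f).
have fE : f = psY * shiftY 1 f.
  apply: psY_dvd => a; move/(congr1 (fun h : B => h a.+1 0%N)): fg.
  by rewrite coef_psXM coef_psYM.
by split=> //; apply: psY_inj; rewrite -fg {1}fE mulrCA.
Qed.

Lemma ps_coef00_split f : f 0 0 = 0 -> exists g h, f = psX * g + psY * h.
Proof.
move=> f0; pose h := PSeries2 (fun a b => if a == 0%N then f a b.+1 else 0) : B.
exists (shiftX 1 (f - psY * h)), h; apply/esym.
rewrite -psX_dvd ?subrK // => -[|b]; by rewrite ps_coefB coef_psYM /= ?f0 subrr.
Qed.

Lemma ps_order_psX : ps_order_ge 1 psX. Proof. exact: ps_order_lin. Qed.
Lemma ps_order_psY : ps_order_ge 1 psY. Proof. exact: ps_order_lin. Qed.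

Lemma ps_order_geMr n f g : ps_order_ge n f -> ps_order_ge n (f * g).
Proof.
by move=> fn; rewrite -[n]addn0; apply: ps_order_geM => // a b.
Qed.

Lemma ps_order_geD n f g :
  ps_order_ge n f -> ps_order_ge n g -> ps_order_ge n (f + g).
Proof. by move=> fn gn a b ab; rewrite ps_coefD fn ?gn ?addr0. Qed.

Lemma ps_order_geN n f : ps_order_ge n f -> ps_order_ge n (- f).
Proof. by move=> fn a b ab; rewrite ps_coefN fn ?oppr0. Qed.

Lemma ps_order_ge_eq0 f : (forall n, ps_order_ge n f) -> f = 0.
Proof. by move=> f0; apply: ps_ext => a b; rewrite (f0 (a + b).+1). Qed.

(** This is the full sum when [s] has no constant term: [s ^+ k] then has order at least
    [k], so that the terms beyond [a + b] do not contribute. *)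
Definition ps_sum s (h : nat -> B) : B :=
  PSeries2 (fun a b => (\sum_(k < (a + b).+1) s ^+ k * h k) a b).

Lemma ps_sum_widen s h n a b : ps_order_ge 1 s -> (a + b < n)%N ->
  ps_sum s h a b = (\sum_(k < n) s ^+ k * h k) a b.
Proof.
move=> s1 abn; rewrite /ps_sum [LHS]/= !ps_coef_sum.
rewrite (big_ord_widen n (fun k => (s ^+ k * h k) a b)) // big_mkcond.
apply: eq_bigr => k _; case: ltnP => // kab.
by rewrite (ps_order_geMr _ (ps_order_geX (n := k) s1)).
Qed.

Lemma ps_sumE s h n : ps_order_ge 1 s ->
  ps_sum s h =
  \sum_(k < n) s ^+ k * h k + s ^+ n * ps_sum s (fun k => h (n + k)%N).
Proof.
move=> s1; apply: ps_ext => a b; rewrite ps_coefD.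
rewrite (@ps_sum_widen _ _ (n + (a + b).+1)) //; last by rewrite -addnS leq_addl.
rewrite big_split_ord ps_coefD; congr (_ + _).
transitivity ((s ^+ n * \sum_(k < (a + b).+1) s ^+ k * h (n + k)%N) a b).
  by rewrite mulr_sumr; congr (coef2 _ a b); apply: eq_bigr => k _; rewrite exprD mulrA.
rewrite /=; apply: eq_bigr => i _; apply: eq_bigr => j _; congr (_ * _).
rewrite -(@ps_sum_widen s (fun k => h (n + k)%N)) //.
by rewrite ltnS leq_add ?leq_subr.
Qed.

End Series.

Arguments psX {K}.
Arguments psY {K}.

(** * Successive approximation *)

(** When every equation [f = Phi h] can be solved up to a multiple of [s'], with an error
    that is again of the kind [X], the errors can be corrected one after the other, and the
    corrections add up to a convergent series. The set [D] restricts the solutions. *)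
Lemma successive_approx (E E' : zmodType) (s : E -> E) (s' : {additive E' -> E'})
    (Phi : {additive E -> E'}) (D : set E) (X : set E') :
  (forall x, Phi (s x) = s' (Phi x)) ->
  (forall h : nat -> E, (forall k, D (h k)) ->
     exists2 x, D x & forall n, exists r, x = \sum_(k < n) iter k s (h k) + iter n s r) ->
  (forall x, (forall n, exists r, x = iter n s' r) -> x = 0) ->
  (forall f, X f -> exists h f', [/\ D h, X f' & f = Phi h + s' f']) ->
  forall f, X f -> exists2 h, D h & f = Phi h.
Proof.
move=> Phis lim sep step f Xf.
have /choice [F FP] : forall g : E', exists hg : E * E',
    X g -> [/\ D hg.1, X hg.2 & g = Phi hg.1 + s' hg.2].
  move=> g; have [Xg|nXg] := pselect (X g); last by exists (0, 0).
  by have [h [g' ?]] := step g Xg; exists (h, g').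
pose fs := fix fs n := if n is n'.+1 then (F (fs n')).2 else f.
have Xfs n : X (fs n) by elim: n => //= n /FP[].
have [x Dx xE] := lim (fun n => (F (fs n)).1) (fun n => let: And3 p _ _ := FP _ (Xfs n) in p).
exists x => //; apply/eqP; rewrite -subr_eq0; apply/eqP/sep => n.
have Phik k y : Phi (iter k s y) = iter k s' (Phi y).
  by elim: k => //= k IHk; rewrite Phis IHk.
have s'D k y z : iter k s' (y + z) = iter k s' y + iter k s' z.
  by elim: k => //= k ->; rewrite raddfD.
have s'N k y : iter k s' (- y) = - iter k s' y.
  by elim: k => //= k ->; rewrite raddfN.
have [r ->] := xE n; exists (fs n - Phi r).
rewrite raddfD raddf_sum Phik s'D s'N opprD addrA; congr (_ + _).
apply/eqP; rewrite subr_eq; apply/eqP.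
elim: n {r} => [|n IHn]; first by rewrite big_ord0 addr0.
rewrite IHn big_ord_recr /= Phik -iterS iterSr.
have fsE : fs n = Phi (F (fs n)).1 + s' (F (fs n)).2 by case: (FP _ (Xfs n)).
by rewrite [in LHS]fsE s'D addrAC addrC; congr (_ + _); exact: addrC.
Qed.

(** * Restriction to the axes, and units *)

Section Restriction.
Variable K : comNzRingType.
Local Notation B := (pseries2 K).
Implicit Types f g s : B.

Definition resX f : B := PSeries2 (fun a b => if a == 0%N then f 0%N b else 0).
Definition resY f : B := PSeries2 (fun a b => if b == 0%N then f a 0%N else 0).

Fact resX_zmod_morphism : zmod_morphism resX.
Proof.
by move=> f g; apply: ps_ext => a b; rewrite ps_coefB /=; case: eqP; rewrite ?subr0.
Qed.

Fact resX_monoid_morphism : monoid_morphism resX.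
Proof.
split=> [|f g]; apply: ps_ext => a b /=; first by case: eqP => // ->.
case: a => [|a] /=; first by rewrite !big_ord1.
apply/esym/big1 => -[[|i] ia] _; apply: big1 => j _ /=; by rewrite ?mulr0 ?mul0r.
Qed.

HB.instance Definition _ := GRing.isZmodMorphism.Build B B resX resX_zmod_morphism.
HB.instance Definition _ :=
  GRing.isMonoidMorphism.Build B B resX resX_monoid_morphism.

Fact resY_zmod_morphism : zmod_morphism resY.
Proof.
by move=> f g; apply: ps_ext => a b; rewrite ps_coefB /=; case: eqP; rewrite ?subr0.
Qed.

Fact resY_monoid_morphism : monoid_morphism resY.
Proof.
split=> [|f g]; apply: ps_ext => a b /=; first by case: a b => [|a] [|b].
case: b => [|b] /=; first by apply: eq_bigr => i _; rewrite !big_ord1.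
apply/esym/big1 => i _; apply/big1 => -[[|j] jb] _ /=; by rewrite ?mulr0 ?mul0r.
Qed.

HB.instance Definition _ := GRing.isZmodMorphism.Build B B resY resY_zmod_morphism.
HB.instance Definition _ :=
  GRing.isMonoidMorphism.Build B B resY resY_monoid_morphism.

Lemma resXE f : f = resX f + psX * shiftX 1 (f - resX f).
Proof. by rewrite -psX_dvd ?subrKC // => b; rewrite ps_coefB subrr. Qed.

End Restriction.

Section Approx.
Variable K : comNzRingType.
Local Notation B := (pseries2 K).

Definition mx_sum m n (s : B) (h : nat -> 'M[B]_(m, n)) : 'M[B]_(m, n) :=
  \matrix_(i, j) ps_sum s (fun k => h k i j).

Lemma iter_scale (V : lmodType B) (s : B) k (x : V) :
  iter k (GRing.scale s) x = s ^+ k *: x.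
Proof. by elim: k => [|k IHk]; rewrite ?scale1r //= IHk exprS scalerA. Qed.

Lemma mx_sumE m n (s : B) (h : nat -> 'M[B]_(m, n)) k : ps_order_ge 1 s ->
  exists r, mx_sum s h =
    \sum_(i < k) iter i (GRing.scale s) (h i) + iter k (GRing.scale s) r.
Proof.
move=> s1; exists (mx_sum s (fun i => h (k + i)%N)); apply/matrixP => i j.
rewrite iter_scale !mxE (ps_sumE _ k) // summxE; congr (_ + _).
by apply: eq_bigr => l _; rewrite iter_scale mxE.
Qed.

Lemma mx_sep m n (s : B) (x : 'M[B]_(m, n)) : ps_order_ge 1 s ->
  (forall k, exists r, x = iter k (GRing.scale s) r) -> x = 0.
Proof.
move=> s1 xs; apply/matrixP => i j; rewrite mxE; apply: ps_order_ge_eq0 => k.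
have [r ->] := xs k; rewrite iter_scale mxE; apply: ps_order_geMr.
exact: ps_order_geX.
Qed.

Lemma mx_approx m n m' n' (s : B) (Phi : {linear 'M[B]_(m, n) -> 'M[B]_(m', n')})
    (X : set 'M[B]_(m', n')) : ps_order_ge 1 s ->
  (forall f, X f -> exists h f', X f' /\ f = Phi h + s *: f') ->
  forall f, X f -> exists h, f = Phi h.
Proof.
move=> s1 step f Xf.
have [] := @successive_approx _ _ (GRing.scale s) (GRing.scale s) Phi setT X
    _ _ _ _ f Xf.
- by move=> x; apply: (linearZ_LR Phi).
- by move=> h _; exists (mx_sum s h) => // k; apply: mx_sumE.
- by move=> x; apply: mx_sep.
- by move=> g /step[h [g' [? ?]]]; exists h, g'.
- by move=> h _ ->; exists h.
Qed.

End Approx.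

Section Field.
Variable F : fieldType.
Local Notation B := (pseries2 F).
Implicit Types f g s : B.

(** Up to a constant [f] is [1 - s] with [s] of positive order; the geometric series is summed
    by successive approximation. *)
Lemma ps_unit f : f 0 0 != 0 -> exists g, f * g = 1.
Proof.
move=> f0; pose c := ps_const (f 0%N 0%N)^-1 : B; pose s := 1 - c * f.
have s1 : ps_order_ge 1 s.
  by move=> [|a] [|b] // _; rewrite /s ps_coefB ps_constM mulVf ?subrr.
have := @mx_approx _ 1 1 1 1 s (GRing.scale f) setT s1 _ 1%:M I.
case=> [g _|h /matrixP/(_ 0 0)]; last by rewrite !mxE => fh; exists (h 0 0); rewrite -fh.
exists (c *: g), g; split=> //.
by rewrite /= scalerA -scalerDl /s mulrC subrKC scale1r.
Qed.

(** The lexicographically least exponent of [f]. The bracket is in the form required by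
    Weierstrass division. *)
Lemma ps_lead f : f != 0 -> exists (k n : nat) (w g : B),
  w 0 0 != 0 /\ f = psX ^+ k * (psY ^+ n * w + psX * g).
Proof.
move=> f0.
have exk : exists k, `[< exists n, f k n != 0 >].
  apply: contrapT => /forallNP h; case/eqP: f0; apply: ps_ext => a b.
  by apply/eqP; apply: contrapT => /negP ab; apply: (h a); apply/asboolP; exists b.
pose k := ex_minn exk; have [/asboolP exn kmin] : `[< exists n, f k n != 0 >] /\
    forall a, `[< exists n, f a n != 0 >] -> (k <= a)%N.
  by rewrite /k; case: ex_minnP.
pose n := ex_minn exn; have [fkn nmin] : f k n != 0 /\ forall b, f k b != 0 -> (n <= b)%N.
  by rewrite /n; case: ex_minnP.
pose f' := shiftX k f; exists k, n, (shiftY n (resX f')), (shiftX 1 (f' - resX f')).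
split; first by [].
rewrite -psY_dvdn => [|a b bn]; last first.
  case: a => //=; apply/eqP; apply: contraLR bn => /nmin; by rewrite -leqNgt.
rewrite -resXE -psX_dvdn // => a b ak; apply/eqP; apply: contraLR ak => ab.
by rewrite -leqNgt; apply: kmin; apply/asboolP; exists b.
Qed.

Lemma ps_mulf_eq0 f g : f * g = 0 -> f = 0 \/ g = 0.
Proof.
move=> fg0; have [->|f0] := eqVneq f 0; first by left.
have [->|g0] := eqVneq g 0; first by right.
have [k [n [w [h [w0 fE]]]]] := ps_lead f0.
have [k' [n' [w' [h' [w'0 gE]]]]] := ps_lead g0.
move/(congr1 (fun f : B => f (k + k')%N (n + n')%N)): fg0.
have -> : f * g = psX ^+ (k + k') * (psY ^+ (n + n') * (w * w') +
    psX * (h * (psY ^+ n' * w') + psY ^+ n * w * h' + psX * h * h')).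
  by rewrite fE gE !exprD; ring.
rewrite coef_psXnM leqnn subnn ps_coefD coef_psYnM leqnn subnn coef_psXM addr0.
by rewrite ps_coef00M => /eqP; rewrite mulf_eq0 (negbTE w0) (negbTE w'0).
Qed.

Lemma ps_mulfI f : f != 0 -> injective (fun g => f * g).
Proof.
move=> f0 g h /eqP; rewrite -subr_eq0 -mulrBr => /eqP/ps_mulf_eq0[fE|/eqP].
  by rewrite fE eqxx in f0.
by rewrite subr_eq0 => /eqP.
Qed.

Lemma resX_unit f : f != 0 -> resX f = f -> exists n (g : B), f * g = psY ^+ n.
Proof.
move=> f0 fX; have exn : exists n, f 0 n != 0.
  apply: contrapT => /forallNP h; case/eqP: f0; rewrite -fX.
  by apply: ps_ext => -[|a] b //=; apply/eqP/negPn/negP/h.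
case: (ex_minnP exn) => n fn nmin; have [|g wg] := @ps_unit (shiftY n f); first by [].
exists n, g; rewrite {1}(psY_dvdn (n := n) (f := f)) -?mulrA ?wg ?mulr1 // => a b bn.
rewrite -fX /=; case: eqP => // _; apply/eqP; apply: contraLR bn => /nmin.
by rewrite -leqNgt.
Qed.

Lemma resY_unit f : f != 0 -> resY f = f -> exists n (g : B), f * g = psX ^+ n.
Proof.
move=> f0 fY; have exn : exists n, f n 0 != 0.
  apply: contrapT => /forallNP h; case/eqP: f0; rewrite -fY.
  by apply: ps_ext => a [|b] //=; apply/eqP/negPn/negP/h.
case: (ex_minnP exn) => n fn nmin; have [|g wg] := @ps_unit (shiftX n f); first by [].
exists n, g; rewrite {1}(psX_dvdn (n := n) (f := f)) -?mulrA ?wg ?mulr1 // => a b an.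
rewrite -fY /=; case: eqP => // _; apply/eqP; apply: contraLR an => /nmin.
by rewrite -leqNgt.
Qed.

End Field.

(** * Noetherianity *)

Definition submodule (S : pzRingType) (V : lmodType S) (Z : set V) :=
  [/\ Z 0, forall x y, Z x -> Z y -> Z (x + y) & forall a x, Z x -> Z (a *: x)].

Lemma submodule_sum (S : pzRingType) (V : lmodType S) (Z : set V) (I : Type)
    (r : seq I) (P : pred I) (x : I -> V) :
  submodule Z -> (forall i, P i -> Z (x i)) -> Z (\sum_(i <- r | P i) x i).
Proof. by case=> Z0 ZD _ Zx; elim/big_ind: _. Qed.

Lemma submodule_mulmx (S : comNzRingType) m n (G : 'M[S]_(m, n)) (Z : set 'rV[S]_n)
    (c : 'rV_m) : submodule Z -> (forall i, Z (row i G)) -> Z (c *m G).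
Proof.
move=> Zsub ZG; rewrite mulmx_sum_row; apply: submodule_sum => // i _.
by case: Zsub => _ _; apply.
Qed.

Section Noetherian.
Variables (F : fieldType) (n : nat).
Local Notation B := (pseries2 F).
Implicit Types (Z : set 'rV[B]_n) (I : set B).

Definition row_generated Z := exists m (G : 'M[B]_(m, n)),
  (forall i, Z (row i G)) /\ forall z, Z z -> exists c : 'rV_m, z = c *m G.

(** Submodules of the quotient of the free module by [I], written upstairs. *)
Definition noetherian_mod I := forall Z, submodule Z ->
  (forall b, I b -> forall x, Z (b *: x)) -> row_generated Z.

Lemma acc_mod I (Zs : nat -> set 'rV[B]_n) : noetherian_mod I ->
  (forall k, submodule (Zs k)) -> (forall b, I b -> forall x, Zs 0 (b *: x)) ->
  (forall k, Zs k `<=` Zs k.+1) -> exists k0, forall k, Zs k `<=` Zs k0.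
Proof.
move=> noeth Zsub Z0 Zinc.
have Zmono k l : (k <= l)%N -> Zs k `<=` Zs l.
  by move/subnK <-; elim: (l - k)%N => // d IHd x /IHd /Zinc.
have [|b Ib x|m [G [ZG Ggen]]] := noeth (fun z => exists k, Zs k z).
- split=> [|x y [k kx] [l ly]|a x [k kx]]; first by exists 0%N; case: (Zsub 0%N).
  + exists (maxn k l); case: (Zsub (maxn k l)) => _ D _.
    by apply: D; [apply: Zmono kx; apply: leq_maxl|apply: Zmono ly; apply: leq_maxr].
  + by exists k; case: (Zsub k) => _ _; apply.
- by exists 0%N; apply: Z0.
have [k kP] := choice ZG; exists (\max_i k i)%N => l x Zx.
have [|c ->] := Ggen x; first by exists l.
apply: submodule_mulmx => // i; apply: Zmono (kP i); exact: leq_bigmax.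
Qed.

(** Hilbert's basis theorem for power series. The submodule [Zs k] of initial coefficients of
    the elements of [Z] that are divisible by [s ^+ k] increases with [k], hence is constant
    from some [k0] on. Generators of [Zs k0] lift to elements that generate, by successive
    approximation, all of [Z] in order at least [k0]; the finitely many lower
    orders are added one by one. *)
Lemma noetherian_lift I (s : B) : ps_order_ge 1 s ->
  noetherian_mod (I `|` [set s]) -> noetherian_mod I.
Proof.
move=> s1 noeth Z Zsub ZI; case: (Zsub) => Z0 ZD ZZ.
pose Zs k : set 'rV[B]_n := fun z => exists w, Z (s ^+ k *: (z + s *: w)).
have Zs_sub k : submodule (Zs k).
  split=> [|x y [w xw] [w' yw]|a x [w xw]].
  - by exists 0; rewrite scaler0 addr0 scaler0.
  - exists (w + w'); have := ZD _ _ xw yw; rewrite -scalerDr.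
    by rewrite addrACA -scalerDr.
  - exists (a *: w); have := ZZ a _ xw; rewrite scalerA mulrC -scalerA scalerDr.
    by rewrite scalerA [a * s]mulrC -scalerA.
have Zs0 b : (I `|` [set s]) b -> forall x, Zs 0%N (b *: x).
  case=> [Ib|->] x; last by exists (- x); rewrite scalerN subrr scaler0.
  by exists 0; rewrite scaler0 addr0 scale1r; apply: ZI.
have Zs_inc k : Zs k `<=` Zs k.+1.
  by move=> x [w xw]; exists w; rewrite exprS -scalerA; apply: (ZZ).
have [k0 k0P] := acc_mod noeth Zs_sub Zs0 Zs_inc.
have gen k : exists m (G : 'M[B]_(m, n)), (forall i, Z (s ^+ k *: row i G)) /\
    forall z, Zs k z -> exists (c : 'rV_m) w, z = c *m G + s *: w.
  have Zsk0 b : (I `|` [set s]) b -> forall x, Zs k (b *: x).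
    by move=> Ib x; elim: k => [|k IHk]; [apply: Zs0|apply: Zs_inc].
  have [m [G [ZG Ggen]]] := noeth _ (Zs_sub k) Zsk0.
  have [w wP] := choice ZG.
  exists m, (G + s *: \matrix_(i, j) w i 0 j); split=> [i|z /Ggen[c ->]].
    rewrite linearD linearZ /=; suff -> : row i (\matrix_(i, j) w i 0 j) = w i by [].
    by apply/rowP => j; rewrite !mxE.
  exists c, (- (c *m \matrix_(i, j) w i 0 j)).
  by rewrite mulmxDr -scalemxAr scalerN addrK.
have base : exists m (G : 'M[B]_(m, n)), (forall i, Z (row i G)) /\
    forall z, Z (s ^+ k0 *: z) -> exists c : 'rV_m, s ^+ k0 *: z = c *m G.
  have [m [G [ZG Ggen]]] := gen k0; exists m, (s ^+ k0 *: G).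
  split=> [i|z Zz]; first by rewrite linearZ; apply: ZG.
  have [||c ->] := @mx_approx _ 1 m 1 n s (mulmxr G)
    (fun z => exists2 k, (k0 <= k)%N & Z (s ^+ k *: z)) s1 _ z.
  - move=> f [k kk0 Zf]; have [|c [w fE]] := Ggen f.
      by apply: (k0P k); exists 0; rewrite scaler0 addr0.
    exists c, w; split=> //; exists k.+1; first by rewrite ltnW.
    have -> : s ^+ k.+1 *: w = s ^+ k *: f - s ^+ k *: (c *m G).
      by rewrite fE scalerDr addrAC subrr add0r exprSr scalerA.
    apply: (ZD) => //; rewrite -scaleN1r; apply: (ZZ).
    rewrite -(subnK kk0) exprD -scalerA; apply: (ZZ); rewrite scalemxAr.
    by apply: submodule_mulmx => // i; rewrite linearZ; apply: ZG.
  - by exists k0.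
  - by exists c; rewrite /= scalemxAr.
suff descend k : (k <= k0)%N -> exists m (G : 'M[B]_(m, n)), (forall i, Z (row i G)) /\
    forall z, Z (s ^+ (k0 - k) *: z) -> exists c : 'rV_m, s ^+ (k0 - k) *: z = c *m G.
  have [m [G [ZG Ggen]]] := descend k0 (leqnn _); exists m, G; split=> // z Zz.
  by have := Ggen z; rewrite subnn scale1r; apply.
elim: k => [_|k IHk kk0]; first by rewrite subn0.
have [m [G [ZG Ggen]]] := IHk (ltnW kk0).
have [m' [G' [ZG' Ggen']]] := gen (k0 - k.+1)%N.
set l := (k0 - k.+1)%N in Ggen' ZG' *.
have lE : (k0 - k)%N = l.+1 by rewrite /l; lia.
rewrite lE in Ggen; exists (m' + m)%N, (col_mx (s ^+ l *: G') G); split=> [i|z Zz].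
  rewrite -(splitK i); case: (fintype.split i) => j /=.
    by rewrite rowKu linearZ; apply: ZG'.
  by rewrite rowKd.
have [|c [w zE]] := Ggen' z; first by exists 0; rewrite scaler0 addr0.
have [|c' wE] := Ggen w.
  have -> : s ^+ l.+1 *: w = s ^+ l *: z - s ^+ l *: (c *m G').
    by rewrite zE scalerDr addrAC subrr add0r exprSr scalerA.
  apply: (ZD) => //; rewrite -scaleN1r; apply: (ZZ).
  by rewrite scalemxAr; apply: submodule_mulmx => // i; rewrite linearZ; apply: ZG'.
exists (row_mx c c'); rewrite mul_row_col -wE zE scalerDr scalerA -exprSr.
by rewrite scalemxAr.
Qed.

(** Modulo the two variables the module is a finite-dimensional vector space: a matrix of
    maximal rank with rows in the subspace generates it. *)
Lemma noetherian_XY : noetherian_mod [set psX; psY].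
Proof.
move=> Z Zsub ZXY; case: (Zsub) => Z0 ZD ZZ.
pose cst m (M : 'M[F]_(m, n)) : 'M[B]_(m, n) := map_mx (@ps_const F) M.
pose at0 m (M : 'M[B]_(m, n)) : 'M[F]_(m, n) := map_mx (fun f : B => f 0%N 0%N) M.
have decomp (z : 'rV[B]_n) : exists x y, z = cst 1%N (at0 1%N z) + (psX *: x + psY *: y).
  have /choice[xy xyP] (j : 'I_n) : exists xy : B * B,
      z 0 j = ps_const (z 0 j 0%N 0%N) + (psX * xy.1 + psY * xy.2).
    have [|x [y xyE]] := @ps_coef00_split _ (z 0 j - ps_const (z 0 j 0%N 0%N)).
      by rewrite ps_coefB /= subrr.
    by exists (x, y); rewrite -xyE subrKC.
  exists (\row_j (xy j).1), (\row_j (xy j).2).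
  by apply/rowP => j; rewrite !mxE -xyP.
have ZXYs x y : Z (psX *: x + psY *: y) by apply: ZD; apply: ZXY; [left|right].
have Zcst z : Z z -> Z (cst 1%N (at0 1%N z)).
  move=> Zz; have [x [y zE]] := decomp z.
  have -> : cst 1%N (at0 1%N z) = z - (psX *: x + psY *: y) by rewrite {2}zE addrK.
  by apply: (ZD) => //; rewrite -scaleN1r; apply: (ZZ).
pose P r := `[< exists m (M : 'M[F]_(m, n)), (forall i, Z (cst 1%N (row i M))) /\ \rank M = r >].
have exP : exists r, P r.
  exists 0%N; apply/asboolP; exists 0%N, 0; rewrite mxrank0; split=> // -[//].
have Pbound r : P r -> (r <= n)%N by move=> /asboolP[m [M [_ <-]]]; apply: rank_leq_col.
case: (ex_maxnP exP Pbound) => r /asboolP[m [M [ZM rM]]] rmax.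
exists (m + (n + n))%N, (col_mx (cst m M) (col_mx (psX *: 1%:M) (psY *: 1%:M))); split.
  move=> i; rewrite -(splitK i); case: (fintype.split i) => j /=.
    by rewrite rowKu /cst -map_row; apply: ZM.
  rewrite rowKd -(splitK j); case: (fintype.split j) => l /=.
    by rewrite rowKu linearZ; apply: ZXY; left.
  by rewrite rowKd linearZ; apply: ZXY; right.
move=> z Zz; have [x [y zE]] := decomp z.
have /submxP[c cE] : (at0 1%N z <= M)%MS.
  have := submx_refl (col_mx M (at0 1%N z)); rewrite col_mx_sub => /andP[/mxrank_leqif_sup le _].
  suff : (col_mx M (at0 1%N z) <= M)%MS by rewrite col_mx_sub => /andP[].
  rewrite -le eqn_leq mxrankS ?rM ?rmax //; last first.
    by have := submx_refl (col_mx M (at0 1%N z)); rewrite col_mx_sub => /andP[].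
  apply/asboolP; exists (m + 1)%N, (col_mx M (at0 1%N z)); split=> // i.
  rewrite -(splitK i); case: (fintype.split i) => j /=; first by rewrite rowKu.
  by rewrite rowKd row_id; apply: Zcst.
exists (row_mx (map_mx (@ps_const F) c) (row_mx x y)); rewrite !mul_row_col -!scalemxAr !mulmx1.
by rewrite {1}zE cE /cst map_mxM.
Qed.

Lemma noetherian_rows Z : submodule Z -> row_generated Z.
Proof.
move=> Zsub; have noethX : noetherian_mod [set psX].
  by apply: (@noetherian_lift _ psY) noetherian_XY; apply: ps_order_psY.
have : noetherian_mod set0.
  by apply: (@noetherian_lift _ psX); rewrite ?set0U //; apply: ps_order_psX.
by apply.
Qed.

End Noetherian.

(** * Modules that are free over a power series ring *)

Section FreeModule.
Variable A : comNzRingType.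

Definition lincomb (V : lmodType A) n (g : 'I_n -> V) (x : {ffun 'I_n -> A^o}) : V :=
  \sum_i x i *: g i.

Fact lincomb_linear V n g : linear (@lincomb V n g).
Proof.
move=> a x y; rewrite /lincomb scaler_sumr -big_split; apply: eq_bigr => i _.
by rewrite !ffunE scalerDl scalerA.
Qed.

HB.instance Definition _ (V : lmodType A) n (g : 'I_n -> V) :=
  GRing.isLinear.Build A {ffun 'I_n -> A^o} V _ (@lincomb V n g) (@lincomb_linear V n g).

Definition unit_vec n (i : 'I_n) : {ffun 'I_n -> A^o} := [ffun j => (i == j)%:R].

Lemma lincomb_unit (V : lmodType A) n (g : 'I_n -> V) i : lincomb g (unit_vec i) = g i.
Proof.
rewrite /lincomb (bigD1 i) //= big1 => [|j ij]; rewrite ffunE ?eqxx ?scale1r ?addr0 //.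
by rewrite eq_sym (negbTE ij) scale0r.
Qed.

Lemma ffun_unitE n (x : {ffun 'I_n -> A^o}) : x = \sum_i x i *: unit_vec i.
Proof.
apply/ffunP => j; rewrite sum_ffunE (bigD1 j) //= big1 => [|i ij].
  by rewrite !ffunE eqxx addr0 /GRing.scale /= mulr1.
by rewrite !ffunE (negbTE ij) /GRing.scale /= mulr0.
Qed.

Lemma linear_lincomb (V : lmodType A) n (f : {linear {ffun 'I_n -> A^o} -> V}) x :
  f x = lincomb (fun i => f (unit_vec i)) x.
Proof.
rewrite {1}(ffun_unitE x) linear_sum; apply: eq_bigr => i _.
by rewrite linearZ.
Qed.

Lemma projective_free n : projective {ffun 'I_n -> A^o}.
Proof.
move=> V W p f psurj; have [g gP] := choice (fun i => psurj (f (unit_vec i))).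
exists (lincomb g) => x; rewrite (linear_lincomb f) /lincomb linear_sum.
by apply: eq_bigr => i _; rewrite linearZ gP.
Qed.

End FreeModule.

Arguments unit_vec {A n} i.

Section Coordinates.
Variables (F : fieldType) (A : comNzRingType).
Local Notation B := (pseries2 F).
Variable iota : {rmorphism B -> A}.

(** [E] is free of rank [n] over the power series ring, which acts through [iota]. Working
    with coordinates instead of a second module structure on [E] keeps the
    two rings apart. *)
Definition free_coords (E : lmodType A) n (c : E -> 'rV[B]_n) :=
  bijective c /\ forall b x y, c (iota b *: x + y) = b *: c x + c y.

Section Basics.
Variables (E : lmodType A) (n : nat) (c : E -> 'rV[B]_n).
Implicit Types (x y : E) (b s : B).
Hypothesis Ec : free_coords c.

Lemma coords_inj : injective c. Proof. by case: Ec => /bij_inj. Qed.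

Lemma coords_surj r : exists x, c x = r.
Proof. by case: Ec => -[d _ dK] _; exists (d r). Qed.

Lemma coordsD x y : c (x + y) = c x + c y.
Proof. by case: Ec => _ /(_ 1 x y); rewrite rmorph1 !scale1r. Qed.

Lemma coords0 : c 0 = 0.
Proof. by have /eqP := coordsD 0 0; rewrite addr0 addrC -subr_eq subrr eq_sym => /eqP. Qed.

Lemma coordsZ b x : c (iota b *: x) = b *: c x.
Proof. by case: Ec => _ /(_ b x 0); rewrite coords0 !addr0. Qed.

Lemma coords_sum (I : Type) (r : seq I) (P : pred I) (x : I -> E) :
  c (\sum_(i <- r | P i) x i) = \sum_(i <- r | P i) c (x i).
Proof. by rewrite (big_morph c coordsD coords0). Qed.

Lemma coords_iterZ s k x : c (iter k (GRing.scale (iota s)) x) = s ^+ k *: c x.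
Proof. by elim: k => [|k IHk]; rewrite ?scale1r //= coordsZ IHk scalerA exprS. Qed.

Lemma scaleX_eq0 x : iota psX *: x = 0 -> x = 0.
Proof.
move=> /(congr1 c); rewrite coordsZ coords0 => /rowP x0; apply: coords_inj.
rewrite coords0; apply/rowP => j; apply: psX_inj.
by have := x0 j; rewrite !mxE mulr0.
Qed.

Lemma scaleX_inj x y : iota psX *: x = iota psX *: y -> x = y.
Proof.
move=> xy; apply/eqP; rewrite -subr_eq0; apply/eqP/scaleX_eq0.
by rewrite scalerBr xy subrr.
Qed.

Lemma scaleXY_reg x y : iota psX *: x = iota psY *: y ->
  exists z, x = iota psY *: z /\ y = iota psX *: z.
Proof.
move=> /(congr1 c); rewrite !coordsZ => /rowP xy.
have /choice[z zP] (j : 'I_n) : exists z : B, c x 0 j = psY * z /\ c y 0 j = psX * z.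
  by apply: psXY_reg; have := xy j; rewrite !mxE.
have [w wE] := coords_surj (\row_j z j).
by exists w; split; apply: coords_inj; rewrite coordsZ wE; apply/rowP => j;
  rewrite !mxE; case: (zP j).
Qed.

Lemma coords_XY x : (forall j, c x 0 j 0%N 0%N = 0) ->
  exists y z, x = iota psX *: y + iota psY *: z.
Proof.
move=> x0; have /choice[gh ghP] (j : 'I_n) : exists gh : B * B,
    c x 0 j = psX * gh.1 + psY * gh.2.
  by have [g [h]] := ps_coef00_split (x0 j); exists (g, h).
have [y yE] := coords_surj (\row_j (gh j).1).
have [z zE] := coords_surj (\row_j (gh j).2).
exists y, z; apply: coords_inj; rewrite coordsD !coordsZ yE zE.
by apply/rowP => j; rewrite !mxE ghP.
Qed.

Definition basis_vec i : E := xget 0 [set x | c x = delta_mx 0 i].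

Lemma coords_basis_vec i : c (basis_vec i) = delta_mx 0 i.
Proof.
rewrite /basis_vec; case: xgetP => [y _ //|]; have [y yE] := coords_surj (delta_mx 0 i).
by move/(_ y).
Qed.

Lemma basis_vecE x : x = \sum_i iota (c x 0 i) *: basis_vec i.
Proof.
apply: coords_inj; rewrite coords_sum [LHS]row_sum_delta.
by apply: eq_bigr => i _; rewrite coordsZ coords_basis_vec.
Qed.

Lemma module_noetherian (Z : set E) : submodule Z -> exists m (g : 'I_m -> E),
  (forall i, Z (g i)) /\ forall z, Z z -> exists a, z = lincomb g a.
Proof.
move=> [Z0 ZD ZZ]; have [|m [G [ZG Ggen]]] := @noetherian_rows _ _ (c @` Z).
  split=> [|_ _ [x Zx <-] [y Zy <-]|a _ [x Zx <-]].
  - by exists 0; rewrite ?coords0.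
  - by exists (x + y); rewrite ?coordsD //; apply: ZD.
  - by exists (iota a *: x); rewrite ?coordsZ //; apply: ZZ.
have /choice[g gP] i : exists x, Z x /\ c x = row i G.
  by have [x] := ZG i; exists x.
exists m, g; split=> [i|z Zz]; first by case: (gP i).
have [|a aE] := Ggen (c z); first by exists z.
exists [ffun i => iota (a 0 i)]; apply: coords_inj; rewrite aE /lincomb coords_sum.
rewrite mulmx_sum_row; apply: eq_bigr => i _; rewrite ffunE coordsZ.
by case: (gP i) => _ ->.
Qed.

Lemma module_lim (s : B) (h : nat -> E) : ps_order_ge 1 s ->
  exists x, forall k, exists r,
    x = \sum_(i < k) iter i (GRing.scale (iota s)) (h i) + iter k (GRing.scale (iota s)) r.
Proof.
move=> s1; have [x xE] := coords_surj (mx_sum s (fun i => c (h i))).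
exists x => k; have [r rE] := mx_sumE (fun i => c (h i)) k s1.
have [y yE] := coords_surj r; exists y; apply: coords_inj.
rewrite xE rE coordsD coords_sum coords_iterZ iter_scale yE; congr (_ + _).
by apply: eq_bigr => i _; rewrite coords_iterZ iter_scale.
Qed.

Lemma module_sep (s : B) (x : E) : ps_order_ge 1 s ->
  (forall k, exists r, x = iter k (GRing.scale (iota s)) r) -> x = 0.
Proof.
move=> s1 xs; apply: coords_inj; rewrite coords0; apply: (mx_sep s1) => k.
by have [r ->] := xs k; exists (c r); rewrite coords_iterZ iter_scale.
Qed.

End Basics.

Lemma module_approx (E E' : lmodType A) n n' (c : E -> 'rV[B]_n) (c' : E' -> 'rV[B]_n')
    (s : B) (Phi : {linear E -> E'}) (X : set E') :
  free_coords c -> free_coords c' -> ps_order_ge 1 s ->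
  (forall f, X f -> exists h f', X f' /\ f = Phi h + iota s *: f') ->
  forall f, X f -> exists h, f = Phi h.
Proof.
move=> Ec Ec' s1 step f Xf.
have [] := @successive_approx _ _ (GRing.scale (iota s)) (GRing.scale (iota s)) Phi setT X
    _ _ _ _ f Xf.
- by move=> x; apply: (linearZ_LR Phi).
- by move=> h _; have [x] := module_lim Ec h s1; exists x.
- by move=> x; apply: (module_sep Ec').
- by move=> g /step[h [g' [? ?]]]; exists h, g'.
- by move=> h _ ->; exists h.
Qed.

Definition ffun_coords (E : lmodType A) n (c : E -> 'rV[B]_n) k
  (x : {ffun 'I_k -> E}) : 'rV[B]_(k * n) := mxvec (\matrix_i c (x i)).

Lemma ffun_coordsP (E : lmodType A) n (c : E -> 'rV[B]_n) k :
  free_coords c -> free_coords (@ffun_coords E n c k).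
Proof.
move=> Ec; have [[d cK dK] _] := Ec; split=> [|b x y].
  exists (fun r => [ffun i => d (row i (vec_mx r))]) => [x|r].
    by apply/ffunP => i; rewrite ffunE mxvecK rowK cK.
  rewrite /ffun_coords; apply: (canLR vec_mxK); apply/row_matrixP => i.
  by rewrite rowK ffunE dK.
rewrite /ffun_coords -linearZ -linearD; congr mxvec; apply/row_matrixP => i.
by rewrite linearD linearZ /= !rowK !ffunE (proj2 Ec).
Qed.

Definition pair_coords (E E' : lmodType A) n n' (c : E -> 'rV[B]_n) (c' : E' -> 'rV[B]_n')
  (x : E * E') : 'rV[B]_(n + n') := row_mx (c x.1) (c' x.2).

Lemma pair_coordsP (E E' : lmodType A) n n' (c : E -> 'rV[B]_n) (c' : E' -> 'rV[B]_n') :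
  free_coords c -> free_coords c' -> free_coords (pair_coords c c').
Proof.
move=> Ec Ec'; have [[d cK dK] _] := Ec; have [[d' cK' dK'] _] := Ec'.
split=> [|b x y]; last first.
  by rewrite /pair_coords /= (proj2 Ec) (proj2 Ec') scale_row_mx add_row_mx.
exists (fun r => (d (lsubmx r), d' (rsubmx r))) => [[x y]|r].
  by rewrite /pair_coords row_mxKl row_mxKr cK cK'.
by rewrite /pair_coords /= dK dK' hsubmxK.
Qed.

End Coordinates.

(** * Weierstrass division *)

Section Weierstrass.
Variable F : fieldType.
Local Notation B := (pseries2 F).

Definition at0 (f : B) : B := ps_const (f 0%N 0%N).

Fact at0_zmod_morphism : zmod_morphism at0.
Proof. by move=> f g; rewrite /at0 ps_coefB rmorphB. Qed.

Fact at0_monoid_morphism : monoid_morphism at0.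
Proof. by split=> [|f g]; rewrite /at0 ?ps_coef00M ?rmorphM // rmorph1. Qed.

HB.instance Definition _ := GRing.isZmodMorphism.Build B B at0 at0_zmod_morphism.
HB.instance Definition _ := GRing.isMonoidMorphism.Build B B at0 at0_monoid_morphism.

Lemma resY_ps_sum (h : nat -> B) :
  (forall k, resY (h k) = h k) -> resY (ps_sum psX h) = ps_sum psX h.
Proof.
move=> hY; apply: ps_ext => a [|b] //=; apply/esym.
rewrite -/(coef2 (\sum_(k < (a + b.+1).+1) psX ^+ k * h k) a b.+1) ps_coef_sum big1 //.
by move=> k _; rewrite coef_psXnM; case: ifP => // _; rewrite -hY.
Qed.

(** Modulo [X] the divisor is [Y ^+ n] times a unit, so that division with remainder is
    possible there; successive approximation in powers of [X] does the rest and keeps the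
    coefficients of the remainder free of [Y]. *)
Lemma weierstrass_division (n : nat) (w g f : B) : w 0 0 != 0 ->
  exists (c : 'I_n -> B) (h : B), (forall j, resY (c j) = c j) /\
    f = \sum_j c j * psY ^+ j + h * (psY ^+ n * w + psX * g).
Proof.
move=> /ps_unit[v wv]; set b := psY ^+ n * w + psX * g.
pose G : 'M[B]_(n + 1, 1) := col_mx (\col_(j < n) psY ^+ j) b%:M.
pose D : set 'rV[B]_(n + 1) := fun r => forall j, resY (lsubmx r 0 j) = lsubmx r 0 j.
have [] := @successive_approx _ _ (GRing.scale psX) (GRing.scale psX)
    (mulmxr G : {linear 'rV[B]_(n + 1) -> 'rV[B]_1}) D setT _ _ _ _ (f%:M : 'rV[B]_1) I.
- by move=> r; apply: (linearZ_LR (mulmxr G)).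
- move=> h Dh; exists (mx_sum psX h) => [j|k]; last exact: mx_sumE (ps_order_psX _).
  rewrite !mxE; apply: resY_ps_sum => k.
  by have := Dh k j; rewrite mxE.
- by move=> x; apply: mx_sep; apply: ps_order_psX.
- move=> f1 _; pose f' := f1 0 0; pose r := shiftY n (resX f').
  exists (row_mx (\row_(j < n) ps_const (f' 0%N j)) (v * r)%:M).
  exists (shiftX 1 (f' - resX f') - g * v * r)%:M; split=> // [j|].
    by rewrite row_mxKl !mxE; apply: ps_ext => -[|a] [|b'].
  apply/rowP => i; rewrite (ord1 i) {i} /G /= mul_row_col !mxE big_ord1 !mxE eqxx.
  rewrite -/f' [LHS]resXE !mulr1n; set q := shiftX _ _.
  have -> : resX f' = \sum_(j < n) ps_const (f' 0%N j) * psY ^+ j + psY ^+ n * r.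
    rewrite {1}/r; have -> : psY ^+ n * shiftY n (resX f') =
        psY ^+ n * shiftY n (resX f' - \sum_(j < n) ps_const (f' 0%N j) * psY ^+ j).
      congr (_ * _); apply: ps_ext => a b'; rewrite [RHS]/= -/(coef2 _ _ _) ps_coef_sum.
      rewrite big1 ?subr0 // => j _; rewrite ps_constM -[psY ^+ j]mul1r -(expr0 psX).
      rewrite coef_monom [_ && _](_ : _ = false) ?mulr0 //.
      by have := ltn_ord j; lia.
    rewrite -psY_dvdn ?subrKC // => a b' bn; rewrite ps_coefB ps_coef_sum.
    rewrite (bigD1 (Ordinal bn)) // [X in _ - (_ + X)]big1 => [|j jb].
      rewrite addr0 ps_constM -[psY ^+ b']mul1r -(expr0 psX) coef_monom eqxx andbT /=.
      by case: eqP; rewrite ?mulr1 ?mulr0 subrr.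
    rewrite ps_constM -[psY ^+ j]mul1r -(expr0 psX) coef_monom [b' == j]eq_sym.
    by move: jb; rewrite -val_eqE /= => /negbTE ->; rewrite andbF mulr0.
  rewrite -!addrA; congr (_ + _).
    by apply: eq_bigr => j _; rewrite !mxE.
  rewrite /GRing.scale /= /b.
  have -> : psY ^+ n * r = (psY ^+ n * w) * (v * r) by rewrite mulrA -[_ * w * v]mulrA wv mulr1.
  by ring.
move=> r Dr /matrixP/(_ 0 0).
rewrite -[r]hsubmxK /G /= mul_row_col !mxE big_ord1 eqxx !mxE eqxx !mulr1n => fE.
exists (fun j => lsubmx r 0 j), (rsubmx r 0 0); split=> //.
rewrite fE; congr (_ + _); last by rewrite mxE.
by apply: eq_bigr => j _; rewrite !mxE.
Qed.

End Weierstrass.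

(** * Local rings that are finite and free over a power series ring *)

Section Ideals.
Variable A : comNzRingType.
Implicit Types (J p q : set A) (a b : A).

Lemma idealB J a b : ideal J -> J a -> J b -> J (a - b).
Proof. by case=> _ D M Ja Jb; apply: D => //; rewrite -mulN1r; apply: M. Qed.

Lemma ideal_sum J (I : Type) (r : seq I) (P : pred I) (x : I -> A) :
  ideal J -> (forall i, P i -> J (x i)) -> J (\sum_(i <- r | P i) x i).
Proof. by case=> J0 JD _ Jx; elim/big_ind: _. Qed.

Lemma prime_expP p a n : prime_ideal p -> p (a ^+ n) -> p a.
Proof.
move=> [_ p1 pM]; elim: n => [/p1//|n IHn]; rewrite exprS => /pM[]//.
Qed.

(** Cayley-Hamilton, by the adjugate trick: the matrix [a - M] maps the vector [v] into [J],
    hence so does multiplication by its determinant, and [v] generates the unit modulo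
    [J]. *)
Lemma char_poly_ideal (S : comNzRingType) (f : {rmorphism S -> A}) J r (v : 'I_r -> A)
    (M : 'M[S]_r) a : ideal J ->
  (forall i, J (a * v i - \sum_j f (M i j) * v j)) ->
  (forall x, exists c : 'I_r -> S, J (x - \sum_j f (c j) * v j)) ->
  J (map_poly f (char_poly M)).[a].
Proof.
move=> Jid Mv gen; case: (Jid) => J0 JD JM.
pose h : {rmorphism {poly S} -> A} := horner_eval a \o map_poly f.
pose N : 'M[A]_r := map_mx h (char_poly_mx M).
have hE (q : {poly S}) : h q = (map_poly f q).[a] by [].
have NE i j : N i j = a *+ (i == j) - f (M i j).
  rewrite !mxE hE rmorphB rmorphMn /= map_polyX map_polyC /=.
  by rewrite hornerD hornerN hornerC hornerMn hornerX.
pose w : 'cV[A]_r := \col_i v i.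
have JN i : J ((N *m w) i 0).
  suff -> : (N *m w) i 0 = a * v i - \sum_j f (M i j) * v j by [].
  rewrite mxE -[a * v i](_ : \sum_j (a *+ (i == j)) * v j = _) -?sumrB.
    by apply: eq_bigr => j _; rewrite NE mxE mulrBl.
  rewrite (bigD1 i) //= eqxx big1 ?addr0 // => j ij.
  by rewrite eq_sym (negbTE ij) mul0r.
have Jdet i : J (\det N * v i).
  have -> : \det N * v i = (\adj N *m (N *m w)) i 0.
    by rewrite mulmxA mul_adj_mx mul_scalar_mx !mxE.
  by rewrite mxE; apply: ideal_sum => // j _; apply: JM.
rewrite -hE /char_poly -det_map_mx -/N; have [c c1] := gen 1.
rewrite -[\det N]mulr1 -[1](subrK (\sum_j f (c j) * v j)) mulrDr.
apply: (JD); first exact: JM.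
rewrite mulr_sumr; apply: ideal_sum => // j _.
by rewrite mulrCA; apply: JM.
Qed.

(** Used to extract from an equation for [a] modulo a prime that avoids [a] an element of the
    base ring that lies in every larger prime containing [a]. *)
Lemma lowest_coef (S : nzRingType) (f : {rmorphism S -> A}) (P : {poly S}) a : P != 0 ->
  exists i r, P`_i != 0 /\ (map_poly f P).[a] = a ^+ i * (f P`_i + a * r).
Proof.
move=> P0; have exi : exists i, P`_i != 0.
  by exists (size P).-1; rewrite -lead_coefE lead_coef_eq0.
case: (ex_minnP exi) => i Pi imin; exists i, (map_poly f (drop_poly i.+1 P)).[a].
split=> //; rewrite -{1}(poly_take_drop i.+1 P).
have -> : take_poly i.+1 P = P`_i *: 'X^i.
  apply/polyP => j; rewrite coef_take_poly coefZ coefXn ltnS.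
  case: ltngtP => [ji|//|<-]; rewrite ?mulr0 ?mulr1 //.
  by apply/eqP; apply: contraLR ji => /imin; rewrite leqNgt.
rewrite rmorphD rmorphM /= map_polyXn map_polyZ /= map_polyXn.
by rewrite hornerD hornerM hornerZ !hornerXn exprSr; ring.
Qed.

End Ideals.

Section Ring.
Variables (F : fieldType) (A : comNzRingType).
Local Notation B := (pseries2 F).
Variables (iota : {rmorphism B -> A}) (eps : {rmorphism A -> F}).
Variables (N : nat) (c : A^o -> 'rV[B]_N).
Hypothesis Ac : free_coords iota c.
Hypothesis eps_iota : forall b, eps (iota b) = b 0%N 0%N.
Hypothesis unitA : forall a, eps a != 0 -> exists b, a * b = 1.
Hypothesis domA : forall a b : A, a * b = 0 -> a = 0 \/ b = 0.
Implicit Types (a x y : A) (J p q : set A).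

Let X := iota psX.
Let Y := iota psY.
Definition aug_ideal : set A := [set a | eps a = 0].
Local Notation m := aug_ideal.

Lemma noetherianA : noetherian A.
Proof.
move=> J [J0 JD JM]; have [|k [g [Jg gen]]] := module_noetherian Ac (Z := J); first by [].
exists k, g => a; split=> [/gen[x ->]|[x ->]].
  by exists (fun i => x i).
by apply: ideal_sum => // i _; apply: JM.
Qed.

Lemma aug_ideal_ideal : ideal m.
Proof.
split=> [|a b|a b]; rewrite /m /= ?rmorph0 // ?rmorphD ?rmorphM.
  by move=> -> ->; rewrite addr0.
by move=> ->; rewrite mulr0.
Qed.

Lemma proper_sub_aug J : ideal J -> ~ J 1 -> J `<=` m.
Proof.
move=> [_ _ JM] J1 a Ja; apply/eqP/negPn/negP => /unitA[b ab]; apply: J1.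
by rewrite -ab mulrC; apply: JM.
Qed.

Lemma aug_maximal : maximal_ideal m.
Proof.
split=> [||J Jid J1 mJ]; first exact: aug_ideal_ideal.
  by rewrite /m /= rmorph1 => /eqP; rewrite oner_eq0.
by apply/seteqP; split=> //; apply: proper_sub_aug.
Qed.

Lemma local_ringA : local_ring m.
Proof.
split; [exact: noetherianA|exact: aug_maximal|] => J [Jid J1 Jmax].
apply/esym/Jmax; [exact: aug_ideal_ideal| |exact: proper_sub_aug].
by case: aug_maximal.
Qed.

Let coord_vec i : A := basis_vec c i.

Lemma coord_vecE x : x = \sum_i iota (c x 0 i) * coord_vec i.
Proof. exact: (basis_vecE Ac). Qed.

Definition XY_ideal : set A := fun a => exists x y, a = X * x + Y * y.

Lemma XY_ideal_ideal : ideal XY_ideal.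
Proof.
split=> [|a b [x [y ->]] [x' [y' ->]]|a b [x [y ->]]].
- by exists 0, 0; rewrite !mulr0 addr0.
- by exists (x + x'), (y + y'); ring.
- by exists (a * x), (a * y); ring.
Qed.

(** The idempotent [g] singles out a subring of the base ring: its fixed elements. If the
    matrix of multiplication by [a] has entries there, so does its
    characteristic polynomial. *)
Lemma finite_over_fixed J (g : {rmorphism B -> B}) r (v : 'I_r -> A) a : ideal J ->
  (forall x, exists c : 'I_r -> B, (forall j, g (c j) = c j) /\
     J (x - \sum_j iota (c j) * v j)) ->
  exists P : {poly B}, [/\ P \is monic, map_poly g P = P & J (map_poly iota P).[a]].
Proof.
move=> Jid gen; have /choice[M MP] := fun i => gen (a * v i).
pose MM : 'M[B]_r := \matrix_(i, j) M i j.
exists (char_poly MM); split; first exact: char_poly_monic.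
  rewrite map_char_poly; congr char_poly; apply/matrixP => i j.
  by rewrite !mxE; case: (MP i).
apply: char_poly_ideal => // [i|x].
  case: (MP i) => _; congr (J (_ - _)).
  by apply: eq_bigr => j _; rewrite mxE.
by have [d [_ dP]] := gen x; exists d.
Qed.

Lemma coord_vec_fixed J (g : {rmorphism B -> B}) : ideal J ->
  (forall b, g (g b) = g b) -> (forall b, J (iota (b - g b))) ->
  forall x, exists c : 'I_N -> B, (forall j, g (c j) = c j) /\
     J (x - \sum_j iota (c j) * coord_vec j).
Proof.
move=> Jid gg gJ x; exists (fun i => g (c x 0 i)); split=> //.
rewrite {1}[x]coord_vecE -sumrB; apply: ideal_sum => // i _.
by rewrite -mulrBl -rmorphB mulrC; case: Jid => _ _; apply; apply: gJ.
Qed.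

(** Modulo [(X, Y)] the element [a] satisfies an equation with constant coefficients, and its
    cofactor of the lowest power of [a] is a unit. *)
Lemma aug_nilpotent a : m a -> exists k, XY_ideal (a ^+ k).
Proof.
move=> ma; have XYid := XY_ideal_ideal.
have [|P [Pm PP PJ]] := @finite_over_fixed _ (@at0 F) _ coord_vec a XYid.
  apply: coord_vec_fixed => // b; have [|f [g E]] := @ps_coef00_split _ (b - at0 b).
    by rewrite ps_coefB subrr.
  by exists (iota f), (iota g); rewrite E rmorphD !rmorphM.
have [i [r [Pi PE]]] := lowest_coef iota a (monic_neq0 Pm).
have [|b bE] := @unitA (iota P`_i + a * r).
  rewrite rmorphD rmorphM eps_iota ma mul0r addr0; apply: contraNneq Pi => P0.
  by rewrite -PP coef_map /= /at0 P0 rmorph0.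
exists i; rewrite -[a ^+ i]mulr1 -bE mulrA -PE mulrC.
by case: XYid => _ _; apply.
Qed.

(** Multiplying by powers of the generators of the maximal ideal, one generator after the
    other, as long as the product stays outside [(X, Y)]. *)
Lemma socle_exists : exists2 s, ~ XY_ideal s & forall a, m a -> XY_ideal (a * s).
Proof.
have [_ XYD XYM] := XY_ideal_ideal.
have [k [g gP]] := noetherianA aug_ideal_ideal.
have mg i : m (g i).
  apply/gP; exists (fun j => (j == i)%:R).
  rewrite (bigD1 i) //= eqxx mul1r big1 ?addr0 // => j /negbTE ->.
  by rewrite mul0r.
have step (r : seq 'I_k) : exists2 s, ~ XY_ideal s &
    forall i, i \in r -> XY_ideal (g i * s).
  elim: r => [|i r [s s0 sP]].
    exists 1 => // -[x [y /(congr1 eps)]].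
    by rewrite rmorph1 rmorphD !rmorphM !eps_iota !mul0r addr0 => /eqP; rewrite oner_eq0.
  have exn : exists n, `[< XY_ideal (g i ^+ n * s) >].
    by have [n gn] := aug_nilpotent (mg i); exists n; apply/asboolP; rewrite mulrC; apply: XYM.
  case: (ex_minnP exn) => -[|n] /asboolP gn nmin; first by rewrite mul1r in gn.
  exists (g i ^+ n * s) => [gn'|j].
    by have /asboolP/nmin := gn'; rewrite ltnn.
  rewrite inE => /orP[/eqP ->|/sP js]; first by rewrite mulrA -exprS.
  by rewrite mulrCA; apply: XYM.
have [s s0 sP] := step (enum 'I_k); exists s => // a /gP[x ->].
rewrite mulr_suml; apply: ideal_sum XY_ideal_ideal _ => i _.
by rewrite -mulrA; apply: XYM; apply: sP; rewrite mem_enum.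
Qed.

(** * Depth *)

Lemma X_reg x : X * x = 0 -> x = 0. Proof. exact: (scaleX_eq0 Ac). Qed.

Lemma X_inj x y : X * x = X * y -> x = y. Proof. exact: (scaleX_inj Ac). Qed.

Lemma XY_reg x y : X * x = Y * y -> exists z, x = Y * z /\ y = X * z.
Proof. exact: (scaleXY_reg Ac). Qed.

Lemma span2 a1 a2 x : span [:: a1; a2] x <-> exists y z, x = y * a1 + z * a2.
Proof.
split=> [[d ->]|[y [z ->]]].
  by exists (d 0%N), (d 1%N); rewrite /= big_ord_recl big_ord1.
by exists (fun i => if i == 0%N then y else z); rewrite /= big_ord_recl big_ord1.
Qed.

Lemma span1 a1 x : span [:: a1] x <-> exists y, x = y * a1.
Proof.
split=> [[d ->]|[y ->]]; first by exists (d 0%N); rewrite /= big_ord1.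
by exists (fun=> y); rewrite /= big_ord1.
Qed.

Lemma span0 x : span [::] x <-> x = 0.
Proof.
by split=> [[d ->]|->]; [rewrite big_ord0|exists (fun=> 0); rewrite big_ord0].
Qed.

Lemma XY_regular_seq : regular_seq m [:: X; Y].
Proof.
split.
- by move=> a; rewrite !inE => /orP[]/eqP ->; rewrite /m /= eps_iota.
- move=> /span2[y [z /(congr1 eps)]].
  rewrite rmorph1 rmorphD !rmorphM !eps_iota !mulr0 addr0 => /eqP.
  by rewrite oner_eq0.
- move=> [|[|//]] _ a /=; first by move=> /span0/X_reg ->; apply/span0.
  move=> /span1[y E]; have [z [_ ->]] := XY_reg (etrans (mulrC _ _) (esym E)).
  by apply/span1; exists z; rewrite mulrC.
Qed.

(** A regular sequence [a1, a2, a3] would contradict the existence of the socle element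
    [s] modulo [(X, Y)]: the exchange [X s' = a2 al1 - a1 al2], where
    [ai s = X bi - Y ali], turns [s] into a socle element [s'] modulo [(a1, a2)]. *)
Lemma regular_seq_size s : regular_seq m s -> (size s <= 2)%N.
Proof.
case: s => [|a1 [|a2 [|a3 s]]] // [sm _ sreg]; exfalso.
have ma i : (i < (size s).+3)%N -> m [:: a1, a2, a3 & s]`_i by move=> ?; apply/sm/mem_nth.
have reg1 x : a1 * x = 0 -> x = 0.
  by move=> x0; apply/span0; apply: (sreg 0%N) => //=; apply/span0.
have reg2 x y : a2 * x = a1 * y -> exists z, x = a1 * z.
  move=> xy; have /span1[z ->] : span (take 1 [:: a1, a2, a3 & s]) x.
    by apply: (sreg 1%N) => //=; rewrite ?take0; apply/span1; exists y; rewrite xy mulrC.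
  by exists z; rewrite mulrC.
have reg3 x y z : a3 * x = y * a1 + z * a2 -> exists y z, x = y * a1 + z * a2.
  move=> xyz; apply/span2; have := sreg 2%N; rewrite /= ?take0; apply=> //.
  by apply/span2; exists y, z.
have inj1 x y : a1 * x = a1 * y -> x = y.
  by move=> xy; apply/eqP; rewrite -subr_eq0; apply/eqP/reg1; rewrite mulrBr xy subrr.
have [s0 s0N s0m] := socle_exists.
have sol i : (i < 3)%N -> exists al be, [:: a1, a2, a3 & s]`_i * s0 = X * be - Y * al.
  move=> i3; have [|x [y ->]] := s0m [:: a1, a2, a3 & s]`_i; first by apply: ma; lia.
  by exists (- y), x; rewrite mulrN opprK.
have [/= al1 [be1 E1]] := sol 0%N isT.
have [/= al2 [be2 E2]] := sol 1%N isT.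
have [/= al3 [be3 E3]] := sol 2%N isT.
have elim i j ai aj bi bj : i * s0 = X * bi - Y * ai -> j * s0 = X * bj - Y * aj ->
    exists g, j * ai - i * aj = X * g.
  move=> Ei Ej; have [|g [_ gE]] := @XY_reg (j * bi - i * bj) (j * ai - i * aj).
    apply/eqP; rewrite -subr_eq0; apply/eqP.
    transitivity (j * (X * bi - Y * ai) - i * (X * bj - Y * aj)); first by ring.
    by rewrite -Ei -Ej; ring.
  by exists g.
have [s' s'E] := elim _ _ _ _ _ _ E1 E2.
have [g1 g1E] := elim _ _ _ _ _ _ E1 E3.
have [g2 g2E] := elim _ _ _ _ _ _ E2 E3.
have [|h1 [h2 hE]] := @reg3 s' (- g2) g1.
  apply: X_inj; transitivity (a3 * (X * s')); first by ring.
  rewrite -s'E; transitivity (a2 * (X * g1) - a1 * (X * g2)); last by ring.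
  by rewrite -g1E -g2E; ring.
have [h' al1E] : exists h, al1 - X * h2 = a1 * h.
  apply: (reg2 _ (al2 + X * h1)); apply/eqP; rewrite -subr_eq0; apply/eqP.
  transitivity (a2 * al1 - a1 * al2 - X * (h1 * a1 + h2 * a2)); first by ring.
  by rewrite -hE s'E subrr.
have al2E : al2 + X * h1 = a2 * h'.
  apply: inj1; rewrite mulrCA -al1E; apply/eqP; rewrite -subr_eq0; apply/eqP.
  transitivity (- (a2 * al1 - a1 * al2) + X * (h1 * a1 + h2 * a2)); first by ring.
  by rewrite -hE s'E addNr.
pose v := s0 + Y * h'.
have v1 : a1 * v = X * (be1 - Y * h2).
  rewrite /v mulrDr E1 [a1 * (Y * _)]mulrCA -al1E; ring.
have v2 : a2 * v = X * (be2 + Y * h1).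
  rewrite /v mulrDr E2 [a2 * (Y * _)]mulrCA -al2E; ring.
have [y yE] : exists y, be1 - Y * h2 = a1 * y.
  apply: (reg2 _ (be2 + Y * h1)); apply: X_inj.
  by rewrite mulrCA -v1 [RHS]mulrCA -v2 mulrCA.
apply: s0N; exists y, (- h').
have : v = X * y by apply: inj1; rewrite v1 yE mulrCA.
by move=> vE; rewrite mulrN -vE /v addrK.
Qed.

Lemma depthA : depth m 2.
Proof.
split; last exact: regular_seq_size.
by exists [:: X; Y]; split=> //; apply: XY_regular_seq.
Qed.

(** * Dimension *)

Lemma prime_finite p q (g : {rmorphism B -> B}) r (v : 'I_r -> A) a :
  prime_ideal p -> prime_ideal q -> p `<=` q -> q a -> ~ p a ->
  (forall x, exists c : 'I_r -> B, (forall j, g (c j) = c j) /\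
     p (x - \sum_j iota (c j) * v j)) ->
  exists b : B, [/\ b != 0, g b = b & q (iota b)].
Proof.
move=> pp qp pq qa pa gen; have [pid _ pM] := pp; have [qid _ _] := qp.
have [P [Pm PP PJ]] := finite_over_fixed a pid gen.
have [i [r' [Pi PE]]] := lowest_coef iota a (monic_neq0 Pm).
exists P`_i; split=> //; first by rewrite -{2}PP coef_map.
move: PJ; rewrite PE => /pM[/(prime_expP pp)//|/pq qE].
rewrite -[iota _](addrK (a * r')); apply: idealB => //.
by rewrite mulrC; case: qid => _ _; apply.
Qed.

(** If [X] lies in [p], then [A / p] is finite over the series in [Y]. Otherwise a nonzero
    element of the base ring that lies in [p], freed from its factor [X ^+ k], is
    regular in [Y], and [A / p] is finite over the series in [X] by Weierstrass division.
    In both cases the larger prime meets that ring in a nonzero series,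
    hence contains its variable. *)
Lemma prime_XY p q x a : prime_ideal p -> prime_ideal q -> p `<=` q ->
  p x -> x <> 0 -> q a -> ~ p a -> q X /\ q Y.
Proof.
move=> pp qp pq px x0 qa pa; have [pid p1 pM] := pp; have [qid q1 qM] := qp.
have Xpow k (b d : B) : q (iota b) -> b * d = psX ^+ k -> q X.
  move=> qb bd; apply: (prime_expP (n := k) qp).
  by rewrite -rmorphXn -bd rmorphM mulrC; case: qid => _ _; apply.
have Ypow k (b d : B) : q (iota b) -> b * d = psY ^+ k -> q Y.
  move=> qb bd; apply: (prime_expP (n := k) qp).
  by rewrite -rmorphXn -bd rmorphM mulrC; case: qid => _ _; apply.
have [pX|pX] := pselect (p X).
  have [b [b0 bX qb]] : exists b : B, [/\ b != 0, resX b = b & q (iota b)].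
    apply: (prime_finite pp qp pq qa pa); apply: coord_vec_fixed => // b.
    by rewrite {1}[b]resXE addrC addKr rmorphM mulrC; case: pid => _ _; apply.
  by split; [apply: pq|have [k [d]] := resX_unit b0 bX; apply: Ypow].
have zid : ideal [set (0 : A)].
  by split=> // [a' b' /= -> ->|a' b' /= ->]; rewrite ?addr0 ?mulr0.
have [|P [Pm _ /= P0]] := @finite_over_fixed _ (idfun : {rmorphism B -> B}) _ coord_vec x zid.
  by apply: coord_vec_fixed => // b; rewrite /= subrr rmorph0.
have [i [r [Pi PE]]] := lowest_coef iota x (monic_neq0 Pm).
have pb : p (iota P`_i).
  move: P0; rewrite PE => /domA[x0'|/eqP].
    by case: x0; elim: (i) x0' => [/eqP|n IHn]; rewrite ?oner_eq0 // exprS => /domA[].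
  by rewrite addr_eq0 => /eqP ->; rewrite -mulrN mulrC; case: pid => _ _; apply.
have [k [n [w [g [w0 bE]]]]] := ps_lead Pi.
have {}pb : p (iota (psY ^+ n * w + psX * g)).
  move: pb; rewrite bE rmorphM rmorphXn => /pM[]// /(prime_expP pp) //.
have [b [b0 bY qb]] : exists b : B, [/\ b != 0, resY b = b & q (iota b)].
  pose v (i : 'I_#|{: 'I_N * 'I_n}|) : A :=
    iota (psY ^+ (enum_val i).2) * coord_vec (enum_val i).1.
  apply: (@prime_finite p q _ _ v a) => // y.
  have /choice[dh dhP] j : exists dh : ('I_n -> B) * B, (forall i, resY (dh.1 i) = dh.1 i) /\
      c y 0 j = \sum_i dh.1 i * psY ^+ i + dh.2 * (psY ^+ n * w + psX * g).
    by have [d [h]] := weierstrass_division n g (c y 0 j) w0; exists (d, h).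
  exists (fun i => (dh (enum_val i).1).1 (enum_val i).2).
  split=> [j|]; first by have [H _] := dhP (enum_val j).1; apply: H.
  rewrite -(big_enum_val (fun ij : 'I_N * 'I_n => iota ((dh ij.1).1 ij.2) *
      (iota (psY ^+ ij.2) * coord_vec ij.1))) /=.
  rewrite -(pair_big xpredT xpredT (fun i j => iota ((dh i).1 j) *
      (iota (psY ^+ j) * coord_vec i))) /=.
  rewrite {1}[y]coord_vecE -sumrB; apply: ideal_sum => // j _.
  case: (dhP j) => _ ->; rewrite rmorphD rmorph_sum mulrDl mulr_suml.
  rewrite [X in X + _ - _](eq_bigr (fun j' : 'I_n =>
    iota ((dh j).1 j') * (iota (psY ^+ j') * coord_vec j))) => [|j' _]; last first.
    by rewrite rmorphM mulrA.
  rewrite addrC addKr mulrC [X in _ * X]rmorphM.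
  by case: pid => _ _ M; apply: (M); apply: (M).
have qX : q X by have [l [d]] := resY_unit b0 bY; apply: Xpow.
split=> //; have [d wd] := ps_unit w0.
apply: (@Ypow n (psY ^+ n * w) d); last by rewrite -mulrA wd mulr1.
rewrite -[_ * w](addrK (psX * g)) rmorphB; apply: idealB => //; first exact: pq.
by rewrite rmorphM mulrC; case: qid => _ _; apply.
Qed.

Lemma prime_XY_aug q : prime_ideal q -> q X -> q Y -> m `<=` q.
Proof.
move=> qp qX qY a /aug_nilpotent[k [x [y E]]].
have [[_ qD qM] _ _] := qp; apply: (prime_expP (n := k) qp); rewrite E.
by apply: qD; rewrite mulrC; apply: qM.
Qed.

Lemma krull_dimA (P : set A) : prime_ideal P -> (exists2 x, P x & x <> 0) ->
  ~ m `<=` P -> krull_dim A 2.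
Proof.
move=> Pp [x Px x0] mP; have [Pid P1 PM] := Pp; split.
  exists (fun n => match n with 0%N => [set 0] | 1%N => P | _ => m end); split.
    move=> [|[|[|//]]] _ //.
      split=> [|/= /eqP|a b /= /domA//]; last by rewrite oner_eq0.
      by split=> // [a' b' /= -> ->|a' b' /= ->]; rewrite ?addr0 ?mulr0.
    have [mid m1 _] := aug_maximal; split=> // a b; rewrite /m /= rmorphM => /eqP.
    by rewrite mulf_eq0 => /orP[]/eqP; [left|right].
  move=> [|[|//]] _; split=> //; last exact: proper_sub_aug.
    by move=> y /= ->; case: Pid.
  by move=> P0; apply: x0; apply: P0.
move=> n p [pp pinc]; rewrite leqNgt; apply/negP => n2.
have [pp1 pp2 pp3] : [/\ prime_ideal (p 1%N), prime_ideal (p 2%N) & prime_ideal (p 3%N)].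
  by split; apply: pp; lia.
have [_ /existsNP[y1 /not_implyP[py1 p0y1]]] := pinc 0%N (ltnW (ltnW n2)).
have [p12 /existsNP[y2 /not_implyP[py2 p1y2]]] := pinc 1%N (ltnW n2).
have [p23 /existsNP[y3 /not_implyP[py3 p2y3]]] := pinc 2%N n2.
have y10 : y1 <> 0.
  by move=> y10; apply: p0y1; rewrite y10; have [[]] := pp 0%N isT.
have [qX qY] := prime_XY pp1 pp2 p12 py1 y10 py2 p1y2.
apply: p2y3; apply: prime_XY_aug => //.
by have [id3 p31 _] := pp3; apply: (proper_sub_aug id3 p31).
Qed.

End Ring.

(** * Cohomology in degree at least three *)

Section ResidueField.
Variables (F : fieldType) (A : comNzRingType) (eps : {rmorphism A -> F}).

(* The scalar action goes through [eps], hence the dependence on it. *)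
Definition residue : Type := let _ := eps in F.
HB.instance Definition _ := GRing.Zmodule.copy residue F.

Definition residue_scale (a : A) (x : residue) : residue := eps a * (x : F).

Fact residue_scaleA a b x :
  residue_scale a (residue_scale b x) = residue_scale (a * b) x.
Proof. by rewrite /residue_scale rmorphM mulrA. Qed.
Fact residue_scale1 : left_id 1 residue_scale.
Proof. by move=> x; rewrite /residue_scale rmorph1 mul1r. Qed.
Fact residue_scaleDr : right_distributive residue_scale +%R.
Proof. by move=> a x y; rewrite /residue_scale -mulrDr. Qed.
Fact residue_scaleDl x : {morph residue_scale^~ x : a b / a + b}.
Proof. by move=> a b; rewrite /residue_scale rmorphD mulrDl. Qed.

HB.instance Definition _ := GRing.Zmodule_isLmodule.Build A residue
  residue_scaleA residue_scale1 residue_scaleDr residue_scaleDl.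

End ResidueField.

Section Pull.
Variables (A : comNzRingType) (W : lmodType A) (n n' : nat).
Variable (D : {linear {ffun 'I_n' -> A^o} -> {ffun 'I_n -> A^o}}).

Definition pull (h : {ffun 'I_n -> W}) : {ffun 'I_n' -> W} :=
  [ffun j => lincomb h (D (unit_vec j))].

Lemma lincombD m (h h' : {ffun 'I_m -> W}) x : lincomb (h + h') x = lincomb h x + lincomb h' x.
Proof. by rewrite /lincomb -big_split; apply: eq_bigr => i _; rewrite ffunE scalerDr. Qed.

Lemma lincombZ m a (h : {ffun 'I_m -> W}) x : lincomb (a *: h) x = a *: lincomb h x.
Proof.
rewrite /lincomb scaler_sumr; apply: eq_bigr => i _.
by rewrite ffunE !scalerA mulrC.
Qed.

Fact pull_linear : linear pull.
Proof. by move=> a h h'; apply/ffunP => j; rewrite !ffunE lincombD lincombZ. Qed.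

HB.instance Definition _ := GRing.isLinear.Build A _ _ _ pull pull_linear.

Lemma lincomb_pull h x : lincomb (pull h) x = lincomb h (D x).
Proof.
rewrite -[RHS]/((lincomb h \o D) x) [RHS]linear_lincomb.
by congr (lincomb _ x); apply/funext => i; rewrite ffunE.
Qed.

Definition pull_mod (s : A) (hf : {ffun 'I_n -> W} * {ffun 'I_n' -> W}) :=
  pull hf.1 + s *: hf.2.

Fact pull_mod_linear s : linear (pull_mod s).
Proof.
move=> a h h'; rewrite /pull_mod linearP /= scalerDr scalerA [s * a]mulrC -scalerA.
by rewrite scalerDr addrACA.
Qed.

HB.instance Definition _ s := GRing.isLinear.Build A _ _ _ (pull_mod s) (pull_mod_linear s).

End Pull.

(** On the row space of [G] the pseudoinverse of [G] is a section. *)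
Lemma linear_factor (F : fieldType) m n p (G : 'M[F]_(m, n)) (H : 'M[F]_(m, p)) :
  (forall v : 'rV_m, v *m G = 0 -> v *m H = 0) -> exists T, H = G *m T.
Proof.
move=> GH; exists (pinvmx G *m H); apply/eqP; rewrite -subr_eq0 mulmxA.
rewrite -{1}[H]mul1mx -mulmxBl; apply/eqP/row_matrixP => i.
rewrite row_mul row0; apply: GH; rewrite -row_mul mulmxBl mul1mx.
by rewrite mulmxKpV ?submx_refl // subrr row0.
Qed.

Section Ext.
Variables (F : fieldType) (A : comNzRingType).
Local Notation B := (pseries2 F).
Variables (iota : {rmorphism B -> A}) (eps : {rmorphism A -> F}).
Variables (N : nat) (c : A^o -> 'rV[B]_N).
Hypothesis Ac : free_coords iota c.
Hypothesis eps_iota : forall b, eps (iota b) = b 0%N 0%N.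

(** The functionals to the residue field that kill the multiples of [X] and [Y]; they are the
    linear functionals on the reduction of [E]. *)
Definition residual (E : lmodType A) (psi : E -> F) :=
  (forall x y, psi (x + y) = psi x + psi y) /\
  (forall b x, psi (iota b *: x) = b 0%N 0%N * psi x).

Lemma residual_sum (E : lmodType A) (psi : E -> F) (I : Type) (r : seq I) (P : pred I)
  (x : I -> E) : residual psi ->
  psi (\sum_(i <- r | P i) x i) = \sum_(i <- r | P i) psi (x i).
Proof.
case=> psiD psiZ; apply: big_morph => //.
by have := psiZ 0 0; rewrite rmorph0 scale0r mul0r.
Qed.

Lemma residual_XY (E : lmodType A) (psi : E -> F) x y : residual psi ->
  psi (iota psX *: x + iota psY *: y) = 0.
Proof. by case=> psiD psiZ; rewrite psiD !psiZ !mul0r addr0. Qed.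

Variables (W : lmodType A) (M : nat) (cW : W -> 'rV[B]_M) (ell : W -> F).
Hypothesis Wc : free_coords iota cW.
Hypothesis ellP : residual ell.
(* The next two hypotheses say that [ell] makes the reduction of [W] the dual of the reduction
   of [A]. *)
Hypothesis ell_onto : forall psi : A^o -> F, residual psi ->
  exists h, forall a : A, ell (a *: h) = psi a.
Hypothesis ell_faithful : forall w, (forall a, ell (a *: w) = 0) ->
  exists w1 w2, w = iota psX *: w1 + iota psY *: w2.
Local Notation X := (iota psX).
Local Notation Y := (iota psY).
Local Notation free n := ({ffun 'I_n -> A^o}).

Definition red (E : lmodType A) n (d : E -> 'rV[B]_n) (x : E) : 'rV[F]_n :=
  map_mx (fun f : B => f 0%N 0%N) (d x).

Section Red.
Variables (E : lmodType A) (n : nat) (d : E -> 'rV[B]_n).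
Hypothesis Ed : free_coords iota d.

Lemma redD x y : red d (x + y) = red d x + red d y.
Proof. by apply/rowP => i; rewrite !mxE (coordsD Ed) mxE. Qed.

Lemma redZ b x : red d (iota b *: x) = b 0%N 0%N *: red d x.
Proof. by apply/rowP => i; rewrite !mxE (coordsZ Ed) mxE ps_coef00M. Qed.

Lemma red_sum (I : Type) (r : seq I) (P : pred I) (x : I -> E) :
  red d (\sum_(i <- r | P i) x i) = \sum_(i <- r | P i) red d (x i).
Proof.
apply: (big_morph _ redD); apply/rowP => i.
by rewrite !mxE (coords0 Ed) mxE.
Qed.

End Red.

(** Both maps kill the multiples of [X] and [Y], so that the question is about
    matrices over the residue field. *)
Lemma residual_factor (E E' : lmodType A) n n' (d : E -> 'rV[B]_n) (d' : E' -> 'rV[B]_n')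
    (D : {linear E -> E'}) (psi : E -> F) :
  free_coords iota d -> free_coords iota d' -> residual psi ->
  (forall x y y', D x = X *: y + Y *: y' -> psi x = 0) ->
  exists psi' : E' -> F, residual psi' /\ forall x, psi x = psi' (D x).
Proof.
move=> Ed Ed' psiP psiD; pose b := basis_vec d; have bE := basis_vecE Ed.
pose G : 'M[F]_(n, n') := \matrix_i red d' (D (b i)).
pose H : 'M[F]_(n, 1) := \col_i psi (b i).
have DG x : red d' (D x) = red d x *m G.
  rewrite {1}[x]bE linear_sum (red_sum Ed') mulmx_sum_row; apply: eq_bigr => i _.
  by rewrite linearZ (redZ Ed') rowK mxE.
have psiH x : psi x = (red d x *m H) 0 0.
  rewrite {1}[x]bE (residual_sum _ _ _ psiP) mxE; apply: eq_bigr => i _.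
  by rewrite (proj2 psiP) !mxE.
have [v vG|T HT] := @linear_factor _ _ _ _ G H.
  have [x xE] := coords_surj Ed (map_mx (@ps_const F) v).
  have xv : red d x = v by rewrite /red xE; apply/rowP => i; rewrite !mxE.
  apply/rowP => i; rewrite (ord1 i) -xv -psiH mxE.
  have [|y [y' yE]] := @coords_XY _ _ _ _ _ _ Ed' (D x); last exact: psiD yE.
  by move=> j; have /rowP/(_ j) := DG x; rewrite xv vG !mxE.
exists (fun y => (red d' y *m T) 0 0); split; last first.
  by move=> x; rewrite psiH HT mulmxA DG.
split=> [x y|s x]; first by rewrite (redD Ed') mulmxDl mxE.
by rewrite (redZ Ed') -scalemxAl mxE.
Qed.

Lemma free_residual n (psi : free n -> F) : residual psi ->
  exists h : {ffun 'I_n -> W}, forall x, ell (lincomb h x) = psi x.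
Proof.
move=> psiP; have [psiD psiZ] := psiP.
have /choice[h hP] k : exists h, forall a : A, ell (a *: h) = psi (a *: unit_vec k).
  apply: ell_onto; split=> [x y|b x]; first by rewrite scalerDl psiD.
  by rewrite -psiZ scalerA.
exists [ffun k => h k] => x; rewrite {2}[x]ffun_unitE /lincomb.
rewrite (residual_sum _ _ _ ellP) (residual_sum _ _ _ psiP).
by apply: eq_bigr => k _; rewrite ffunE hP.
Qed.

Lemma faithful_lincomb n (f : {ffun 'I_n -> W}) : (forall x, ell (lincomb f x) = 0) ->
  exists f1 f2, f = X *: f1 + Y *: f2.
Proof.
move=> f0; have /choice[g gP] j : exists g : W * W, f j = X *: g.1 + Y *: g.2.
  have [|w1 [w2 wE]] := @ell_faithful (f j); last by exists (w1, w2).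
  by move=> a; rewrite -(lincomb_unit f) -linearZ f0.
exists [ffun j => (g j).1], [ffun j => (g j).2].
by apply/ffunP => j; rewrite !ffunE gP.
Qed.

Section HighExt.
Variables (n0 n1 n2 n3 n4 : nat).
Variables (D0 : {linear free n1 -> free n0}) (D1 : {linear free n2 -> free n1})
  (D2 : {linear free n3 -> free n2}) (D3 : {linear free n4 -> free n3}).
Hypothesis ex1 : forall x, D0 x = 0 <-> exists y, D1 y = x.
Hypothesis ex2 : forall x, D1 x = 0 <-> exists y, D2 y = x.
Hypothesis ex3 : forall x, D2 x = 0 <-> exists y, D3 y = x.

Let freeP n : free_coords iota (@ffun_coords _ _ _ _ c n) := ffun_coordsP n Ac.
Let WfreeP n : free_coords iota (@ffun_coords _ _ _ _ cW n) := ffun_coordsP n Wc.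

(** The complex stays exact modulo [X] and [Y] in the third place: the higher Tor
    of the regular sequence [X, Y] vanishes. *)
Lemma exact_mod_XY x y y' : D2 x = X *: y + Y *: y' ->
  exists z s s', x = D3 z + X *: s + Y *: s'.
Proof.
move=> xE.
have D1D2 t : D1 (D2 t) = 0 by apply/ex2; exists t.
have D0D1 t : D0 (D1 t) = 0 by apply/ex1; exists t.
have /(scaleXY_reg (freeP n1))[w [w1 w2]] : X *: D1 y = Y *: (- D1 y').
  apply/eqP; rewrite scalerN -subr_eq0 opprK -!linearZ -linearD -xE.
  by rewrite D1D2.
have [v vE] : exists v, D1 v = w.
  apply/ex1; apply: (scaleX_inj (freeP n0)).
  by rewrite scaler0 -linearZ -w2 linearN D0D1 oppr0.
have [s sE] : exists s, D2 s = y - Y *: v.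
  by apply/ex2; rewrite linearB linearZ /= vE w1 subrr.
have [s' s'E] : exists s, D2 s = y' + X *: v.
  by apply/ex2; rewrite linearD linearZ /= vE -w2 subrr.
have [z zE] : exists z, D3 z = x - (X *: s + Y *: s').
  apply/ex3; rewrite linearB linearD !linearZ /= sE s'E xE !scalerDr !scalerN !scalerA.
  rewrite [Y * X]mulrC; apply/eqP; rewrite subr_eq0; apply/eqP.
  by rewrite [RHS]addrACA addNr addr0.
by exists z, s, s'; rewrite zE -addrA subrK.
Qed.

(** Two successive approximations, modulo [Y] and modulo [X], reduce the vanishing of the
    cohomology to the residue field, where functionals extend. *)
Lemma high_ext (f : {linear free n3 -> W}) : (forall x, f (D3 x) = 0) ->
  exists h : {linear free n2 -> W}, forall x, f x = h (D2 x).
Proof.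
move=> fD3; pose X1 : set {ffun 'I_n3 -> W} :=
  fun f => forall x, exists w, lincomb f (D3 x) = X *: w.
pose X2 : set {ffun 'I_n3 -> W} := fun f => forall x, lincomb f (D3 x) = 0.
have D2D3 x : D2 (D3 x) = 0 by apply/ex3; exists x.
have step1 f1 : X1 f1 -> exists hf, f1 = pull_mod D2 X hf.
  move: f1; apply: (module_approx (pair_coordsP (WfreeP n2) (WfreeP n3)) (WfreeP n3)
    (ps_order_psY F)) => f1 Xf1.
  have fres : residual (fun x => ell (lincomb f1 x)).
    split=> [x y|b x]; first by rewrite linearD (proj1 ellP).
    by rewrite linearZ (proj2 ellP).
  have [|psi [psiP psiE]] := residual_factor (freeP n3) (freeP n2) (D := D2) fres.
    move=> x y y' /exact_mod_XY[z [s [s' ->]]].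
    have [w wE] := Xf1 z; rewrite -addrA linearD linearD !linearZ /= wE (proj1 ellP).
    by rewrite residual_XY // (proj2 ellP) mul0r addr0.
  have [h hE] := free_residual psiP.
  have [|g1 [g2 gE]] := @faithful_lincomb _ (f1 - pull D2 h).
    move=> x; rewrite lincombD -scaleN1r lincombZ lincomb_pull -[-1](rmorphN1 iota).
    by rewrite (proj1 ellP) (proj2 ellP) hE psiE ps_coefN mulN1r subrr.
  have f1E : f1 = pull_mod D2 X (h, g1) + Y *: g2.
    by rewrite /pull_mod /= -addrA -gE subrKC.
  exists (h, g1), g2; split=> // x; have [w wE] := Xf1 x.
  have [|z [_ zE]] := @scaleXY_reg _ _ _ _ _ _ Wc (w - lincomb g1 (D3 x)) (lincomb g2 (D3 x)).
    rewrite scalerBr -wE f1E !lincombD lincomb_pull D2D3 linear0 add0r !lincombZ.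
    by rewrite addrAC subrr add0r.
  by exists z.
have step2 f2 : X2 f2 -> exists h, f2 = pull D2 h.
  move: f2; apply: (module_approx (WfreeP n2) (WfreeP n3) (ps_order_psX F)) => f2 Xf2.
  have [|[h g] fE] := step1 f2; first by move=> x; exists 0; rewrite Xf2 scaler0.
  exists h, g; split=> // x; apply: (scaleX_inj Wc).
  have := Xf2 x; rewrite fE /pull_mod /= lincombD lincomb_pull D2D3 linear0 add0r.
  by rewrite lincombZ scaler0.
have [|h hE] := step2 [ffun j => f (unit_vec j)].
  move=> x; rewrite -(fD3 x) [RHS]linear_lincomb.
  by congr (lincomb _ _); apply/funext => j; rewrite ffunE.
exists (lincomb h) => x; rewrite /= -lincomb_pull -hE linear_lincomb.
by congr (lincomb _ x); apply/funext => j; rewrite ffunE.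
Qed.

End HighExt.

End Ext.

(** * A free resolution of the residue field *)

Section Resolution.
Variables (F : fieldType) (A : comNzRingType).
Local Notation B := (pseries2 F).
Variables (iota : {rmorphism B -> A}) (eps : {rmorphism A -> F}).
Variables (N : nat) (c : A^o -> 'rV[B]_N).
Hypothesis Ac : free_coords iota c.
Hypothesis eps_iota : forall b, eps (iota b) = b 0%N 0%N.
Local Notation free n := ({ffun 'I_n -> A^o}).

Lemma kernel_generators m n (g : 'I_m -> free n) : exists k (g' : 'I_k -> free m),
  forall x, lincomb g x = 0 <-> exists y, lincomb g' y = x.
Proof.
have [|k [g' [gg' gen]]] := module_noetherian (ffun_coordsP m Ac)
    (Z := [set x | lincomb g x = 0]).
  split=> [|x y /= x0 y0|a x /= x0]; first exact: (linear0 (lincomb g)).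
    by rewrite [LHS](linearD (lincomb g)) /= x0 y0 addr0.
  by rewrite [LHS](linearZ_LR (lincomb g)) /= x0 scaler0.
exists k, g' => x; split=> [/gen[a ->]|[y <-]]; first by exists a.
rewrite {2}/lincomb [LHS](linear_sum (lincomb g)) big1 // => i _.
by rewrite (linearZ_LR (lincomb g)) /= gg' scaler0.
Qed.

(** One step of the resolution. The source of a stage is, by computation, the target of the
    next, which makes the maps of the resolution composable without casts. *)
Record stage := Stage { stage_src : nat; stage_tgt : nat;
  stage_map : 'I_stage_src -> free stage_tgt }.

(** The term of degree 0 is [A] itself, which appears through [al] and its basis [u]. *)
Lemma free_resolution_exists : exists (n : nat -> nat)
    (d : forall i, {linear free (n i.+1) -> free (n i)})
    (al : {linear free (n 0%N) -> A^o}) (u : free (n 0%N)),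
  [/\ al u = 1, forall x, x = (al x : A) *: u,
      forall x, eps (al x) = 0 <-> exists y, d 0%N y = x
    & forall i x, d i x = 0 <-> exists y, d i.+1 y = x].
Proof.
have [k [g gP]] := noetherianA Ac (aug_ideal_ideal eps).
have nx_ex (s : stage) : exists t : {k & 'I_k -> free (stage_src s)},
    forall x, lincomb (@stage_map s) x = 0 <-> exists y, lincomb (projT2 t) y = x.
  by have [k' [g' g'P]] := kernel_generators (@stage_map s); exists (existT _ k' g').
pose nx s := projT1 (cid (nx_ex s)).
have nxP s := projT2 (cid (nx_ex s)).
pose next s := Stage (projT2 (nx s)).
pose s0 := @Stage k 1 (fun i => [ffun _ => g i]).
pose st := fix st i := if i is j.+1 then next (st j) else s0.
exists (fun i => stage_tgt (st i)).
exists (fun i => lincomb (@stage_map (st i))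
  : {linear free (stage_tgt (st i.+1)) -> free (stage_tgt (st i))}).
exists (lincomb (fun=> 1 : A^o) : {linear free 1 -> A^o}), (unit_vec ord0).
have alE (x : free 1) : lincomb (fun=> 1 : A^o) x = x ord0.
  by rewrite /lincomb big_ord1 /GRing.scale /= mulr1.
split=> [|x|x|i x]; last exact: nxP.
- by rewrite /= alE ffunE.
- by apply/ffunP => i; rewrite /= alE !ffunE (ord1 i) /GRing.scale /= mulr1.
rewrite /= alE; split=> [/gP[a aE]|[y <-]].
  exists [ffun i => a i]; apply/ffunP => i; rewrite (ord1 i) aE /lincomb sum_ffunE.
  by apply: eq_bigr => j _; rewrite !ffunE.
rewrite /lincomb sum_ffunE; apply/gP; exists y.
by apply: eq_bigr => j _; rewrite !ffunE.
Qed.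

End Resolution.

(** * The canonical module *)

Section Canonical.
Variables (F : fieldType) (A : comNzRingType).
Local Notation B := (pseries2 F).
Variables (iota : {rmorphism B -> A}) (eps : {rmorphism A -> F}).
Variables (N : nat) (c : A^o -> 'rV[B]_N).
Hypothesis Ac : free_coords iota c.
Hypothesis eps_iota : forall b, eps (iota b) = b 0%N 0%N.
Variables (W : lmodType A) (M : nat) (cW : W -> 'rV[B]_M) (ell : W -> F).
Hypothesis Wc : free_coords iota cW.
Hypothesis ellP : residual iota ell.
Hypothesis ell_onto : forall psi : A^o -> F, residual iota psi ->
  exists h, forall a : A, ell (a *: h) = psi a.
Hypothesis ell_faithful : forall w, (forall a, ell (a *: w) = 0) ->
  exists w1 w2, w = iota psX *: w1 + iota psY *: w2.
Local Notation X := (iota psX).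
Local Notation Y := (iota psY).
Local Notation free n := ({ffun 'I_n -> A^o}).

(** The counterpart in [W] of the augmentation: its class spans the socle of [W / (X, Y)]. *)
Lemma socle_generator : exists s, forall a, ell (a *: s) = eps a.
Proof.
apply: ell_onto; split=> [x y|b x]; first by rewrite rmorphD.
by rewrite /GRing.scale /= rmorphM eps_iota.
Qed.

Section LowExt.
Variables (n0 n1 n2 n3 : nat).
Variables (D0 : {linear free n1 -> free n0}) (D1 : {linear free n2 -> free n1})
  (D2 : {linear free n3 -> free n2}) (al : {linear free n0 -> A^o}) (u : free n0).
Hypothesis al_u : al u = 1.
Hypothesis alE : forall x, x = (al x : A) *: u.
Hypothesis ex_aug : forall x, eps (al x) = 0 <-> exists y, D0 y = x.
Hypothesis ex0 : forall x, D0 x = 0 <-> exists y, D1 y = x.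
Hypothesis ex1 : forall x, D1 x = 0 <-> exists y, D2 y = x.

Lemma al_scale (a : A) : al (a *: u) = a.
Proof. by rewrite linearZ /= al_u /GRing.scale /= mulr1. Qed.

Lemma D0_onto (a : A) : eps a = 0 -> exists y, D0 y = a *: u.
Proof. by move=> a0; apply/ex_aug; rewrite linearZ /= al_u /GRing.scale /= mulr1. Qed.

Lemma D0D1 x : D0 (D1 x) = 0. Proof. by apply/ex0; exists x. Qed.
Lemma D1D2 x : D1 (D2 x) = 0. Proof. by apply/ex1; exists x. Qed.

Let epsX : eps X = 0. Proof. by rewrite eps_iota. Qed.
Let epsY : eps Y = 0. Proof. by rewrite eps_iota. Qed.

(** A map that vanishes on the maximal ideal sends [u] to an element killed by [X]. *)
Lemma ext0 (f : {linear free n0 -> W}) : (forall x, f (D0 x) = 0) -> forall x, f x = 0.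
Proof.
move=> f0 x; rewrite [x]alE linearZ /=; suff -> : f u = 0 by rewrite scaler0.
apply: (scaleX_inj Wc); rewrite scaler0 -linearZ.
by have [y <-] := D0_onto epsX.
Qed.

Lemma koszul : exists e1 e2 k,
  [/\ D0 e1 = X *: u, D0 e2 = Y *: u & D1 k = Y *: e1 - X *: e2].
Proof.
have [e1 e1E] := D0_onto epsX; have [e2 e2E] := D0_onto epsY.
have [|k kE] := (ex0 (Y *: e1 - X *: e2)).1; last by exists e1, e2, k.
by rewrite linearB !linearZ /= e1E e2E ?scalerN !scalerA mulrC subrr.
Qed.

(** Applying [f] to the Koszul relation gives [Y f(e1) = X f(e2)], so that [f(e1) = X w]; then
    [f] is multiplication by [w]. *)
Lemma ext1 (f : {linear free n1 -> W}) : (forall x, f (D1 x) = 0) ->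
  exists h : {linear free n0 -> W}, forall x, f x = h (D0 x).
Proof.
move=> f0; have [e1 [e2 [k [e1E e2E kE]]]] := koszul.
have [|w [_ wE]] := @scaleXY_reg _ _ _ _ _ _ Wc (f e2) (f e1).
  apply/esym/eqP; rewrite -subr_eq0 -!linearZ -linearB; apply/eqP.
  by rewrite -kE f0.
have hlin : linear (fun y : free n0 => (al y : A) *: w).
  by move=> a x y; rewrite linearP scalerDl scalerA.
pose h : {linear free n0 -> W} := HB.pack (fun y : free n0 => (al y : A) *: w)
  (GRing.isLinear.Build _ _ _ _ _ hlin).
exists h => x; rewrite /h /=; apply: (scaleX_inj Wc).
have [|z zE] := (ex0 ((al (D0 x) : A) *: e1 - X *: x)).1.
  by rewrite linearB !linearZ /= e1E ?scalerN [Z in _ - _ *: Z]alE !scalerA mulrC subrr.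
have /eqP := f0 z; rewrite zE linearB !linearZ /= wE scalerN subr_eq0 => /eqP <-.
by rewrite !scalerA mulrC.
Qed.

Section Koszul.
Variables (e1 e2 : free n1) (k : free n2).
Hypothesis e1E : D0 e1 = X *: u.
Hypothesis e2E : D0 e2 = Y *: u.
Hypothesis kE : D1 k = Y *: e1 - X *: e2.

Lemma cocycle_factor (f : {linear free n2 -> W}) z z' :
  (forall x, f (D2 x) = 0) -> D1 z = D1 z' -> f z = f z'.
Proof.
move=> f0 zz'; apply/eqP; rewrite -subr_eq0 -linearB; apply/eqP.
have [|y <-] := (ex1 (z - z')).1; last exact: f0.
by rewrite linearB zz' subrr.
Qed.

(** The elements [X y] and [Y y] are, up to multiples of [e1] and [e2], boundaries. This is how
    a cocycle, which is only known on boundaries, is compared with its value at [k]. *)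
Lemma koszul_lift (y : free n1) : exists z1 z2,
  D1 z1 = X *: y - (al (D0 y) : A) *: e1 /\ D1 z2 = Y *: y - (al (D0 y) : A) *: e2.
Proof.
have [|z1 z1E] := (ex0 (X *: y - (al (D0 y) : A) *: e1)).1.
  by rewrite linearB !linearZ /= e1E ?scalerN {1}[D0 y]alE !scalerA mulrC subrr.
have [|z2 z2E] := (ex0 (Y *: y - (al (D0 y) : A) *: e2)).1.
  by rewrite linearB !linearZ /= e2E ?scalerN {1}[D0 y]alE !scalerA mulrC subrr.
by exists z1, z2.
Qed.

Lemma koszul_relation (f : {linear free n2 -> W}) y z1 z2 : (forall x, f (D2 x) = 0) ->
  D1 z1 = X *: y - (al (D0 y) : A) *: e1 -> D1 z2 = Y *: y - (al (D0 y) : A) *: e2 ->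
  Y *: f z1 - X *: f z2 = - ((al (D0 y) : A) *: f k).
Proof.
move=> f0 z1E z2E.
have -> : Y *: f z1 - X *: f z2 = f (Y *: z1 - X *: z2) by rewrite linearB !linearZ /= ?scalerN.
have -> : - ((al (D0 y) : A) *: f k) = f (- ((al (D0 y) : A) *: k))
  by rewrite linearN [in RHS]linearZ.
apply: cocycle_factor => //.
rewrite linearB linearN !linearZ /= kE z1E z2E ?scalerN !scalerBr !scalerA.
rewrite [Y * X]mulrC opprB addrACA addrC.
by rewrite [Y * al _]mulrC [X * al _]mulrC -addrA addKr opprB addrC.
Qed.

(** By [koszul_relation] the maximal ideal maps [f k] into [(X, Y) W]. *)
Lemma ell_koszul (f : {linear free n2 -> W}) a : (forall x, f (D2 x) = 0) ->
  ell (a *: f k) = eps a * ell (f k).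
Proof.
move=> f0; have : eps (a - iota (ps_const (eps a))) = 0.
  by rewrite rmorphB eps_iota /= subrr.
move=> /D0_onto[y yE]; have [z1 [z2 [z1E z2E]]] := koszul_lift y.
have := koszul_relation f0 z1E z2E; rewrite yE al_scale.
rewrite scalerBl => rel; have -> : a *: f k = iota (ps_const (eps a)) *: f k +
    (X *: f z2 + Y *: - f z1).
  by rewrite scalerN -opprB rel opprK subrKC.
by rewrite (proj1 ellP) (proj2 ellP) residual_XY // addr0.
Qed.

(** If [f k = X w2 + Y w1], the relation of [koszul_relation] makes the value of [f] at the
    first lift of a basis vector, corrected by [w1], divisible by [X]; the quotients define
    the extension [h]. *)
Lemma ext2_coboundary (f : {linear free n2 -> W}) : (forall x, f (D2 x) = 0) ->
  ell (f k) = 0 <-> exists h : {linear free n1 -> W}, forall x, f x = h (D1 x).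
Proof.
move=> f0; split=> [fk0|[h hE]]; last first.
  have -> : f k = X *: (- h e2) + Y *: h e1.
    by rewrite hE kE linearB !linearZ /= !scalerN addrC.
  exact: residual_XY ellP.
have [|w2 [w1 wE]] := @ell_faithful (f k).
  by move=> a; rewrite ell_koszul // fk0 mulr0.
have /choice[w wP] j : exists w, forall z, D1 z = X *: unit_vec j -
    (al (D0 (unit_vec j)) : A) *: e1 -> f z + (al (D0 (unit_vec j)) : A) *: w1 = X *: w.
  have [z1 [z2 [z1E z2E]]] := koszul_lift (unit_vec j).
  have rel := koszul_relation f0 z1E z2E; set a : A := al _ in z1E z2E rel *.
  have [|w [_ zE]] := @scaleXY_reg _ _ _ _ _ _ Wc (f z2 - a *: w2) (f z1 + a *: w1).
    move/eqP: rel; rewrite subr_eq => /eqP rel.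
    rewrite [RHS]scalerDr rel wE scalerBr !scalerDr !scalerA [X * a]mulrC [Y * a]mulrC.
    by rewrite opprD [RHS]addrAC subrK addrC.
  by exists w => z zE'; rewrite -zE; congr (_ + _); apply: cocycle_factor => //; rewrite zE'.
exists (lincomb w) => z; apply: (scaleX_inj Wc); rewrite -linearZ.
have /choice[zs zsP] j : exists z, D1 z = X *: unit_vec j - (al (D0 (unit_vec j)) : A) *: e1.
  by have [z1 [_ [? _]]] := koszul_lift (unit_vec j); exists z1.
have zE : D1 z = \sum_j D1 z j *: unit_vec j by exact: ffun_unitE.
have a0 : \sum_j D1 z j * (al (D0 (unit_vec j)) : A) = 0.
  transitivity (al (D0 (D1 z)) : A); last by rewrite D0D1 linear0.
  rewrite [Z in D0 Z]zE !linear_sum; apply: eq_bigr => j _.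
  by rewrite !linearZ.
transitivity (f (\sum_j D1 z j *: zs j)).
  apply: cocycle_factor => //; rewrite linear_sum linearZ /= {1}zE scaler_sumr.
  rewrite [RHS](eq_bigr (fun j => X *: (D1 z j *: unit_vec j) -
    (D1 z j * (al (D0 (unit_vec j)) : A)) *: e1)) => [|j _]; last first.
    by rewrite linearZ /= zsP scalerBr !scalerA [X * _]mulrC.
  by rewrite sumrB -scaler_suml a0 scale0r subr0.
rewrite /= linear_sum /lincomb scaler_sumr.
rewrite (eq_bigr (fun j => X *: (D1 z j *: w j) -
    (D1 z j * (al (D0 (unit_vec j)) : A)) *: w1)) => [|j _]; last first.
  rewrite linearZ /= -[f (zs j)](addrK ((al (D0 (unit_vec j)) : A) *: w1)) (wP _ _ (zsP j)).
  by rewrite scalerBr !scalerA [X * _]mulrC.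
by rewrite sumrB -scaler_suml a0 scale0r subr0.
Qed.

(** Since the maximal ideal maps the socle element [w] into [(X, Y) W], there are linear [Al]
    and [Be] with [D0 y w = X Be(y) - Y Al(y)]. On cycles [Al] is divisible by [X],
    and the quotient is the cocycle. *)
Lemma ext2_onto (s : F) : exists2 f : {linear free n2 -> W},
  (forall x, f (D2 x) = 0) & ell (f k) = s.
Proof.
have [s0 s0P] := socle_generator.
pose w := iota (ps_const s) *: s0.
have wP a : eps a = 0 -> exists be al, a *: w = X *: be + Y *: al.
  move=> a0; apply: ell_faithful => b.
  have -> : b *: (a *: w) = iota (ps_const s) *: ((b * a) *: s0).
    by rewrite /w !scalerA; congr (_ *: _); ring.
  rewrite (proj2 ellP) s0P.
  by rewrite rmorphM a0 mulr0 mulr0.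
have /choice[ab abP] j : exists ab : W * W,
    (al (D0 (unit_vec j)) : A) *: w = X *: ab.2 - Y *: ab.1.
  have [|be [al' E]] := wP (al (D0 (unit_vec j))).
    by apply/ex_aug; exists (unit_vec j).
  by exists (- al', be); rewrite /= scalerN opprK.
pose Al := lincomb (fun j => (ab j).1); pose Be := lincomb (fun j => (ab j).2).
have AB y : (al (D0 y) : A) *: w = X *: Be y - Y *: Al y.
  rewrite {1}[y]ffun_unitE !linear_sum scaler_suml /Be /Al /lincomb -big_split.
  apply: eq_bigr => j _ /=.
  have -> : al (D0 (y j *: unit_vec j)) = y j * al (D0 (unit_vec j)) :> A by rewrite !linearZ.
  by rewrite -scalerA abP scalerBr !scalerA [X * _]mulrC [Y * _]mulrC.
have AlX y : D0 y = 0 -> exists g, Al y = X *: g.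
  move=> y0; have := AB y; rewrite y0 linear0 scale0r => /esym/eqP.
  by rewrite subr_eq0 => /eqP/(scaleXY_reg Wc)[g [_ ->]]; exists g.
have /choice[g gP] j : exists g, Al (D1 (unit_vec j)) = X *: g by apply/AlX/D0D1.
have XfE z : X *: lincomb g z = Al (D1 z).
  transitivity (lincomb (fun j => Al (D1 (unit_vec j))) z).
    rewrite /lincomb scaler_sumr; apply: eq_bigr => j _.
    by rewrite gP !scalerA mulrC.
  exact/esym/(linear_lincomb (lincomb (fun j => (ab j).1) \o D1)).
exists (lincomb g) => [x|].
  by apply: (scaleX_inj Wc); rewrite /= scaler0 XfE D1D2 /Al linear0.
have [|g1 [g1E Ale1]] := @scaleXY_reg _ _ _ _ _ _ Wc (Be e1 - w) (Al e1).
  have := AB e1; rewrite e1E al_scale scalerBr => ->.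
  by rewrite opprB subrKC.
have [|g2 [_ Ale2]] := @scaleXY_reg _ _ _ _ _ _ Wc (Be e2) (w + Al e2).
  have := AB e2; rewrite e2E al_scale scalerDr => ->.
  by rewrite subrK.
have E : lincomb g k = (X *: (- g2) + Y *: g1) + w.
  apply: (scaleX_inj Wc); rewrite XfE kE /Al linearB !linearZ /= -/Al ?scalerN Ale1.
  rewrite -[Al e2](addKr w) Ale2 !scalerDr !scalerN !scalerA mulrC.
by rewrite opprD opprK [RHS]addrAC [RHS]addrC; congr (_ + _); exact: addrC.
rewrite /= E (proj1 ellP) residual_XY // add0r /w (proj2 ellP) /=.
by rewrite -[s0]scale1r s0P rmorph1 mulr1.
Qed.

End Koszul.
End LowExt.

Lemma residue_fieldA : residue_field (aug_ideal eps) (residue eps).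
Proof.
have plin : linear (eps : A^o -> residue eps).
  by move=> a x y; rewrite rmorphD /GRing.scale /= rmorphM.
pose p : {linear A^o -> residue eps} := HB.pack (eps : A^o -> residue eps)
  (GRing.isLinear.Build _ _ _ _ _ plin).
by exists p; split=> // y; exists (iota (ps_const (y : F))); rewrite /p /= eps_iota.
Qed.

(** A class in degree 2 is represented by the coefficient of its value at the Koszul
    relation [k]. *)
Lemma is_Ext_residue :
  is_Ext 2 (residue eps) W (residue eps) /\
  forall i, i <> 2%N -> is_Ext i (residue eps) W 'rV[A]_0.
Proof.
have [n [d [al [u [al_u alE ex_aug ex]]]]] := free_resolution_exists eps Ac.
have auglin : linear (fun x : free (n 0%N) => eps (al x) : residue eps).
  by move=> a x y; rewrite linearP rmorphD /GRing.scale /= rmorphM.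
pose aug : {linear free (n 0%N) -> residue eps} := HB.pack
  (fun x : free (n 0%N) => eps (al x) : residue eps) (GRing.isLinear.Build _ _ _ _ _ auglin).
have aug_surj : surj aug.
  move=> y; exists (iota (ps_const (y : F)) *: u).
  by rewrite /aug /= (al_scale al_u) eps_iota.
pose P := @ProjectiveResolution A (residue eps) (fun i => free (n i)) d aug
  (fun i => @projective_free A (n i)) aug_surj ex_aug ex.
have [e1 [e2 [k [e1E e2E kE]]]] := koszul al_u ex_aug (ex 0%N).
split; last first.
  move=> i i2; exists P, (fun=> 0); split=> [a f g h _ _ _|y|f f0].
  - by rewrite scaler0 addr0.
  - exists (lincomb (fun=> 0) : {linear free (n i) -> W}); last by apply/rowP => -[].
    by move=> x; rewrite /= /lincomb big1 // => j _; rewrite scaler0.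
  split=> // _; case: i i2 f f0 => [|[|[|i]]] // _ f f0.
  - exact: (ext0 al_u alE ex_aug).
  - exact: (ext1 al_u alE ex_aug (ex 0%N)).
  - exact: (high_ext Ac Wc ellP ell_onto ell_faithful (ex i) (ex i.+1) (ex i.+2)).
exists P, (fun f : {linear P 2 -> W} => ell (f k)); split.
- move=> a f g h f0 g0 ->; rewrite (proj1 ellP).
  by rewrite (ell_koszul al_u alE ex_aug (ex 0%N) (ex 1%N) e1E e2E kE).
- move=> y; have [f f0 fE] := ext2_onto al_u ex_aug (ex 0%N) (ex 1%N) e1E e2E kE y.
  by exists f.
- move=> f f0.
  exact: (ext2_coboundary al_u alE ex_aug (ex 0%N) (ex 1%N) e1E e2E kE f0).
Qed.

Lemma canonical_moduleW : krull_dim A 2 -> canonical_module (aug_ideal eps) W.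
Proof.
move=> dimA; split; last first.
  have [ext2 extn] := is_Ext_residue.
  by exists 2, (residue eps); split=> //; apply: residue_fieldA.
exists M, (basis_vec cW) => x; exists (fun i => iota (cW x 0 i)).
exact: (basis_vecE Wc).
Qed.

End Canonical.

(** * Substitution *)

Section Subst.
Variable K : comNzRingType.
Local Notation R := (pseries2 K).
Implicit Types f g x y : R.

Definition subst_morph x y (x1 : ps_order_ge 1 x) (y1 : ps_order_ge 1 y) f := ps_subst f x y.

Fact subst_morph_zmod x y (x1 : ps_order_ge 1 x) (y1 : ps_order_ge 1 y) :
  zmod_morphism (subst_morph x1 y1).
Proof. by move=> f g; apply: ps_substB. Qed.

Fact subst_morph_monoid x y (x1 : ps_order_ge 1 x) (y1 : ps_order_ge 1 y) :
  monoid_morphism (subst_morph x1 y1).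
Proof. by split=> [|f g]; [apply: ps_subst1|apply: ps_substM]. Qed.

HB.instance Definition _ x y (x1 : ps_order_ge 1 x) (y1 : ps_order_ge 1 y) :=
  GRing.isZmodMorphism.Build R R
  (subst_morph x1 y1) (subst_morph_zmod x1 y1).
HB.instance Definition _ x y (x1 : ps_order_ge 1 x) (y1 : ps_order_ge 1 y) :=
  GRing.isMonoidMorphism.Build R R
  (subst_morph x1 y1) (subst_morph_monoid x1 y1).

Lemma coef_subst_pick f x y a b i j (e : K) : (i <= a + b)%N -> (j <= a + b)%N ->
  (forall k l, (x ^+ k * y ^+ l) a b = if (k == i) && (l == j) then e else 0) ->
  ps_subst f x y a b = f i j * e.
Proof.
move=> iab' jab' E; have iab : (i < (a + b).+1)%N by [].
have jab : (j < (a + b).+1)%N by [].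
transitivity (\sum_(k < (a + b).+1) \sum_(l < (a + b).+1)
    f k l * (if (k == i :> nat) && (l == j :> nat) then e else 0)).
  by apply: eq_bigr => k _; apply: eq_bigr => l _; rewrite E.
rewrite (bigD1 (Ordinal iab)) //= (bigD1 (Ordinal jab)) //= !eqxx.
rewrite [X in _ + X + _]big1 => [|l lj]; last first.
  by rewrite -[l == j :> nat]/(l == Ordinal jab) (negbTE lj) andbF mulr0.
rewrite addr0 [X in _ + X]big1 ?addr0 // => k ki; rewrite big1 // => l _.
by rewrite -[k == i :> nat]/(k == Ordinal iab) (negbTE ki) mulr0.
Qed.

Lemma coef_scaled_monom (c d : K) k l a b :
  ((ps_const c * psX) ^+ k * (ps_const d * psY) ^+ l) a b =
  if (k == a) && (l == b) then c ^+ a * d ^+ b else 0.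
Proof.
rewrite !exprMn mulrACA -!rmorphXn -rmorphM ps_constM coef_monom.
rewrite [a == k]eq_sym [b == l]eq_sym.
by case: andP => [[/eqP -> /eqP ->]|_]; rewrite ?mulr1 ?mulr0.
Qed.

Lemma subst_diag f (c d : K) a b :
  ps_subst f (ps_const c * psX) (ps_const d * psY) a b = f a b * (c ^+ a * d ^+ b).
Proof.
apply: coef_subst_pick; rewrite ?leq_addr ?leq_addl // => k l.
exact: coef_scaled_monom.
Qed.

Lemma subst_antidiag f (c d : K) a b :
  ps_subst f (ps_const c * psY) (ps_const d * psX) a b = f b a * (d ^+ a * c ^+ b).
Proof.
apply: coef_subst_pick; rewrite ?leq_addr ?leq_addl // => k l.
by rewrite mulrC coef_scaled_monom andbC.
Qed.

Lemma subst_id f : ps_subst f psX psY = f.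
Proof.
apply: ps_ext => a b; rewrite -[psX]mul1r -[psY]mul1r -(rmorph1 (@ps_const K)).
by rewrite subst_diag !expr1n !mulr1.
Qed.

Lemma subst_monom (c : K) i j x y : ps_order_ge 1 x -> ps_order_ge 1 y ->
  ps_subst (ps_const c * (psX ^+ i * psY ^+ j)) x y = ps_const c * (x ^+ i * y ^+ j).
Proof.
move=> x1 y1; apply: ps_ext => a b; rewrite ps_constM coef_subst.
have fE k l : (ps_const c * (psX ^+ i * psY ^+ j)) k l =
    if (k == i) && (l == j) then c else 0.
  by rewrite ps_constM coef_monom; case: andP; rewrite ?mulr1 ?mulr0.
have [iab|iab] := ltnP i (a + b).+1; last first.
  rewrite (ps_monom_eq0 x1 y1) ?mulr0 ?(leq_trans iab) ?leq_addr //.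
  apply: big1 => k _; apply: big1 => l _; rewrite fE (_ : _ == _ = false) ?mul0r //.
  by apply/negbTE; rewrite neq_ltn (leq_trans (ltn_ord k)).
have [jab|jab] := ltnP j (a + b).+1; last first.
  rewrite (ps_monom_eq0 x1 y1) ?mulr0 ?(leq_trans jab) ?leq_addl //.
  apply: big1 => k _; apply: big1 => l _; rewrite fE andbC (_ : _ == _ = false) ?mul0r //.
  by apply/negbTE; rewrite neq_ltn (leq_trans (ltn_ord l)).
have [g gE] : exists g : nat -> nat -> K, forall k l, (x ^+ k * y ^+ l) a b = g k l.
  by exists (fun k l => (x ^+ k * y ^+ l) a b).
transitivity (\sum_(k < (a + b).+1) \sum_(l < (a + b).+1)
    (if (k == i :> nat) && (l == j :> nat) then c else 0) * g k l).
  by apply: eq_bigr => k _; apply: eq_bigr => l _; rewrite fE gE.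
transitivity (c * g i j); last by rewrite gE.
rewrite (bigD1 (Ordinal iab)) //= (bigD1 (Ordinal jab)) //= !eqxx.
rewrite [X in _ + X + _]big1 => [|l lj]; last first.
  by rewrite -[l == j :> nat]/(l == Ordinal jab) (negbTE lj) andbF mul0r.
rewrite addr0 [X in _ + X]big1 ?addr0 // => k ki; rewrite big1 // => l _.
by rewrite -[k == i :> nat]/(k == Ordinal iab) (negbTE ki) mul0r.
Qed.

Lemma substX x y : ps_order_ge 1 x -> ps_order_ge 1 y -> ps_subst psX x y = x.
Proof.
by move=> x1 y1; have := subst_monom 1 1 0 x1 y1; rewrite rmorph1 !mul1r !mulr1 !expr1.
Qed.

Lemma substY x y : ps_order_ge 1 x -> ps_order_ge 1 y -> ps_subst psY x y = y.
Proof.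
by move=> x1 y1; have := subst_monom 1 0 1 x1 y1; rewrite rmorph1 !mul1r !expr1.
Qed.

Lemma subst_const (c : K) x y : ps_order_ge 1 x -> ps_order_ge 1 y ->
  ps_subst (ps_const c) x y = ps_const c.
Proof.
by move=> x1 y1; have := subst_monom c 0 0 x1 y1; rewrite !expr0 !mulr1.
Qed.

Lemma subst_order n f x y : ps_order_ge 1 x -> ps_order_ge 1 y ->
  ps_order_ge n f -> ps_order_ge n (ps_subst f x y).
Proof.
move=> x1 y1 fn a b abn; rewrite coef_subst big1 // => i _; rewrite big1 // => j _.
have [ij|ij] := ltnP (i + j) n; first by rewrite fn // mul0r.
by rewrite (ps_monom_eq0 x1 y1) ?mulr0 // (leq_trans abn).
Qed.

(** A continuous morphism is determined by the images of the constants and of the two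
    variables. *)
Lemma rmorph_ext (L L' : {rmorphism R -> R}) :
  (forall n f, ps_order_ge n f -> ps_order_ge n (L f)) ->
  (forall n f, ps_order_ge n f -> ps_order_ge n (L' f)) ->
  (forall c, L (ps_const c) = L' (ps_const c)) -> L psX = L' psX -> L psY = L' psY ->
  L =1 L'.
Proof.
move=> Ln L'n Lc LX LY f; apply/eqP; rewrite -subr_eq0; apply/eqP.
apply: ps_order_ge_eq0 => n.
pose fn := \sum_(i < n) \sum_(j < n) ps_const (f i j) * (psX ^+ i * psY ^+ j).
have fnE : L fn = L' fn.
  rewrite !rmorph_sum; apply: eq_bigr => i _; rewrite !rmorph_sum; apply: eq_bigr => j _.
  by rewrite !rmorphM !rmorphXn Lc /= LX LY.
have ffn : ps_order_ge n (f - fn).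
  move=> a b abn; rewrite ps_coefB.
  have -> : fn a b = \sum_(i < n) \sum_(j < n) f i j * ((a == i :> nat) && (b == j :> nat))%:R.
    rewrite ps_coef_sum; apply: eq_bigr => i _; rewrite ps_coef_sum.
    by apply: eq_bigr => j _; rewrite ps_constM coef_monom.
  have an : (a < n)%N by apply: leq_ltn_trans abn; apply: leq_addr.
  have bn : (b < n)%N by apply: leq_ltn_trans abn; apply: leq_addl.
  rewrite (bigD1 (Ordinal an)) //= (bigD1 (Ordinal bn)) //= !eqxx mulr1.
  rewrite [X in _ + X + _]big1 ?addr0 => [|j jb]; last first.
    by rewrite [b == j :> nat]eq_sym -[j == b :> nat]/(j == Ordinal bn) (negbTE jb) mulr0.
  rewrite [X in _ - (_ + X)]big1 ?addr0 ?subrr // => i ia; rewrite big1 // => j _.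
  by rewrite [a == i :> nat]eq_sym -[i == a :> nat]/(i == Ordinal an) (negbTE ia) mulr0.
have -> : L f - L' f = L (f - fn) - L' (f - fn).
  by rewrite !rmorphB fnE opprB addrA subrK.
by apply: ps_order_geD; [apply: Ln|apply/ps_order_geN/L'n].
Qed.

(** Both sides are continuous morphisms in [f]. *)
Lemma subst_comp f x y x' y' :
  ps_order_ge 1 x -> ps_order_ge 1 y -> ps_order_ge 1 x' -> ps_order_ge 1 y' ->
  ps_subst (ps_subst f x y) x' y' = ps_subst f (ps_subst x x' y') (ps_subst y x' y').
Proof.
move=> x1 y1 x1' y1'.
have xx1 : ps_order_ge 1 (ps_subst x x' y') by apply: subst_order.
have yy1 : ps_order_ge 1 (ps_subst y x' y') by apply: subst_order.
apply: (@rmorph_ext (subst_morph x1' y1' \o subst_morph x1 y1) (subst_morph xx1 yy1)).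
- by move=> n g gn; do 2!apply: subst_order => //.
- by move=> n g gn; apply: subst_order.
- by move=> c; rewrite /= /subst_morph !subst_const.
- by rewrite /= /subst_morph !substX.
- by rewrite /= /subst_morph !substY.
Qed.

(** * The linear action *)

Fact ps_act_zmod s : zmod_morphism (@ps_act K s).
Proof. by move=> f g; apply: ps_substB; apply: ps_order_lin. Qed.

Fact ps_act_monoid s : monoid_morphism (@ps_act K s).
Proof.
by split=> [|f g]; [apply: ps_subst1|apply: ps_substM]; apply: ps_order_lin.
Qed.

HB.instance Definition _ s := GRing.isZmodMorphism.Build R R (@ps_act K s) (ps_act_zmod s).
HB.instance Definition _ s := GRing.isMonoidMorphism.Build R R (@ps_act K s) (ps_act_monoid s).

Lemma act_const s c : ps_act s (ps_const c) = ps_const c :> R.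
Proof. by apply: subst_const; apply: ps_order_lin. Qed.

Lemma act_X s : ps_act s psX = ps_const (s 0 0) * psX + ps_const (s 0 1) * psY :> R.
Proof. by rewrite /ps_act substX; [exact: ps_linE|exact: ps_order_lin..]. Qed.

Lemma act_Y s : ps_act s psY = ps_const (s 1 0) * psX + ps_const (s 1 1) * psY :> R.
Proof. by rewrite /ps_act substY; [exact: ps_linE|exact: ps_order_lin..]. Qed.

Lemma act_subst s f x y : ps_order_ge 1 x -> ps_order_ge 1 y ->
  ps_act s (ps_subst f x y) = ps_subst f (ps_act s x) (ps_act s y).
Proof. by move=> x1 y1; apply: subst_comp => //; apply: ps_order_lin. Qed.

Lemma sum_I2 (V : nmodType) (x : 'I_2 -> V) : \sum_i x i = x 0 + x 1.
Proof. by rewrite big_ord_recl big_ord1; congr (_ + x _); apply: val_inj. Qed.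

(** The action on series is a right action: it comes from substitution. *)
Lemma act_mul (g h : 'M[K]_2) f : ps_act (g *m h) f = ps_act h (ps_act g f).
Proof.
rewrite [in RHS]/(ps_act g) act_subst; try exact: ps_order_lin.
rewrite [in RHS]ps_linE [in RHS]ps_linE !rmorphD !rmorphM /= !act_const act_X act_Y.
rewrite /ps_act !ps_linE !mxE !sum_I2; congr (ps_subst f _ _).
  by rewrite !rmorphD !rmorphM /=; ring.
by rewrite !rmorphD !rmorphM /=; ring.
Qed.

Lemma act_one f : ps_act 1%:M f = f.
Proof.
by rewrite /ps_act !mxE /= !ps_linE rmorph0 rmorph1 !mul0r !mul1r addr0 add0r subst_id.
Qed.

End Subst.

(** * Invariants of the binary octahedral group *)

Section Octahedral.
Variable K : fieldType.
Local Notation R := (pseries2 K).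
Local Notation u := (psX : R).
Local Notation v := (psY : R).
Local Notation "c %:S" := (ps_const c : R) (at level 2, format "c %:S").
Implicit Types f g : R.

(* The forms of degree 6, 8 and 12 of the regular octahedron: its vertices, the centres of
   its faces and the midpoints of its edges. *)
Definition formT : R := u * v * (u ^+ 4 - v ^+ 4).
Definition formW : R := u ^+ 8 + 14%:R * (u * v) ^+ 4 + v ^+ 8.
Definition formX : R :=
  u ^+ 12 - 33%:R * u ^+ 8 * v ^+ 4 - 33%:R * u ^+ 4 * v ^+ 8 + v ^+ 12.
Local Notation T := formT.
Local Notation W := formW.
Local Notation chi := formX.

Lemma octahedral_syzygy : chi ^+ 2 = W ^+ 3 - 108%:R * T ^+ 4.
Proof. by rewrite /formX /formW /formT; ring. Qed.

Lemma formX_factor :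
  chi = (u ^+ 4 + v ^+ 4) * ((u ^+ 4 + v ^+ 4) ^+ 2 - 36%:R * (u * v) ^+ 4).
Proof. by rewrite /formX; ring. Qed.

Lemma rmorph_formX (L : {rmorphism R -> R}) : L chi =
  (L u ^+ 4 + L v ^+ 4) * ((L u ^+ 4 + L v ^+ 4) ^+ 2 - 36%:R * (L u * L v) ^+ 4).
Proof.
rewrite formX_factor rmorphM rmorphB rmorphXn rmorphM rmorphXn rmorph_nat.
by rewrite rmorphD !rmorphXn rmorphM.
Qed.

Variables (zeta ii r : K).
Hypothesis zeta8 : 8.-primitive_root zeta.
Hypothesis ii2 : ii ^+ 2 = -1.
Hypothesis r2 : 2%:R * r ^+ 2 = 1.

Definition psi_mx : 'M[K]_2 := mx2 zeta 0 0 zeta^-1.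
Definition tau_mx : 'M[K]_2 := mx2 0 ii ii 0.
Definition eta_mx : 'M[K]_2 := mx2 (r * zeta) (r * zeta ^+ 3) (r * zeta) (r * zeta ^+ 7).

Lemma act_mx2X a b c d : ps_act (mx2 a b c d) u = a%:S * u + b%:S * v.
Proof. by rewrite act_X !mxE. Qed.

Lemma act_mx2Y a b c d : ps_act (mx2 a b c d) v = c%:S * u + d%:S * v.
Proof. by rewrite act_Y !mxE. Qed.

Lemma K2 : 2%:R != 0 :> K.
Proof. by apply/eqP => K0; move/eqP: r2; rewrite K0 mul0r eq_sym oner_eq0. Qed.

Lemma zeta_neq0 : zeta != 0.
Proof.
apply/eqP => z0; have := prim_expr_order zeta8.
by rewrite z0 expr0n /= => /eqP; rewrite eq_sym oner_eq0.
Qed.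

Lemma zeta4 : zeta ^+ 4 = -1.
Proof.
have : zeta ^+ 4 ^+ 2 == 1 by rewrite -exprM (prim_expr_order zeta8).
rewrite sqrf_eq1 => /orP[|/eqP//].
by rewrite -(prim_order_dvd zeta8).
Qed.

Let j : R := (zeta ^+ 2)%:S.
Let a : R := r%:S ^+ 2.
Let w : R := zeta%:S.
Let j2 : j ^+ 2 = -1. Proof. by rewrite /j -rmorphXn -exprM zeta4 rmorphN1. Qed.
Let a2 : 2%:R * a = 1.
Proof. by rewrite /a -rmorphXn -[2%:R](rmorph_nat (@ps_const K)) -rmorphM r2 rmorph1. Qed.
Let w2 : w ^+ 2 = j. Proof. by rewrite /w /j rmorphXn. Qed.
Let s : R := r%:S.
Let s2 : s ^+ 2 = a. Proof. by []. Qed.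

(* With [j] the square of [zeta], the substitution [eta] is [u + j v], [u - j v] up to a common
   factor whose square is half of [j]. *)
Lemma eta_X : ps_act eta_mx u = s * w * (u + j * v).
Proof. by rewrite act_mx2X /j !(rmorphM (@ps_const K) r) !rmorphXn /s /w; ring. Qed.

Lemma eta_Y : ps_act eta_mx v = s * w * (u - j * v).
Proof.
rewrite act_mx2Y (_ : zeta ^+ 7 = - zeta ^+ 3).
  by rewrite /j !(rmorphM (@ps_const K) r) rmorphN !rmorphXn /s /w; ring.
by rewrite (exprD _ 4 3) zeta4 mulN1r.
Qed.

Lemma eta_XY : ps_act eta_mx (u * v) = a * j * (u ^+ 2 + v ^+ 2).
Proof.
rewrite rmorphM /= eta_X eta_Y.
transitivity (s ^+ 2 * w ^+ 2 * (u ^+ 2 - j ^+ 2 * v ^+ 2)); first by ring.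
by rewrite s2 w2 j2; ring.
Qed.

Lemma eta_X4 : ps_act eta_mx (u ^+ 4) = - a ^+ 2 * (u + j * v) ^+ 4.
Proof.
rewrite rmorphXn /= eta_X -s2; transitivity (s ^+ 4 * (w ^+ 2) ^+ 2 * (u + j * v) ^+ 4).
  by ring.
by rewrite w2 j2; ring.
Qed.

Lemma eta_Y4 : ps_act eta_mx (v ^+ 4) = - a ^+ 2 * (u - j * v) ^+ 4.
Proof.
rewrite rmorphXn /= eta_Y -s2; transitivity (s ^+ 4 * (w ^+ 2) ^+ 2 * (u - j * v) ^+ 4).
  by ring.
by rewrite w2 j2; ring.
Qed.

Let A : R := u ^+ 4 - 6%:R * u ^+ 2 * v ^+ 2 + v ^+ 4.

Lemma eta_sum : ps_act eta_mx (u ^+ 4 + v ^+ 4) = - a * A.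
Proof.
rewrite rmorphD /= eta_X4 eta_Y4.
transitivity (- a * (2%:R * a) *
  (u ^+ 4 + 6%:R * j ^+ 2 * u ^+ 2 * v ^+ 2 + (j ^+ 2) ^+ 2 * v ^+ 4)).
  by ring.
by rewrite a2 j2 /A; ring.
Qed.

Lemma eta_diff : ps_act eta_mx (u ^+ 4 - v ^+ 4) = - (4%:R * a) * j * (u * v * (u ^+ 2 - v ^+ 2)).
Proof.
rewrite rmorphB /= eta_X4 eta_Y4.
transitivity (- (4%:R * a) * (2%:R * a) * (j * u ^+ 3 * v + j * j ^+ 2 * u * v ^+ 3)).
  by ring.
by rewrite a2 j2; ring.
Qed.

Lemma act_eta_T : ps_act eta_mx T = T.
Proof.
rewrite /formT rmorphM /= eta_XY eta_diff.
transitivity (- (2%:R * a) ^+ 2 * j ^+ 2 * ((u ^+ 2 + v ^+ 2) * (u * v * (u ^+ 2 - v ^+ 2)))).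
  by ring.
by rewrite a2 j2; ring.
Qed.

Lemma act_eta_W : ps_act eta_mx W = W.
Proof.
have -> : W = (u ^+ 4 + v ^+ 4) ^+ 2 + 12%:R * (u * v) ^+ 4 by rewrite /formW; ring.
rewrite rmorphD rmorphXn rmorphM rmorphXn rmorph_nat /= eta_sum eta_XY.
transitivity (a ^+ 2 * (A ^+ 2 + 3%:R * (2%:R * a) ^+ 2 * (j ^+ 2) ^+ 2 * (u ^+ 2 + v ^+ 2) ^+ 4)).
  by ring.
rewrite a2 j2 /A.
transitivity ((2%:R * a) ^+ 2 * ((u ^+ 4 + v ^+ 4) ^+ 2 + 12%:R * (u * v) ^+ 4)); first by ring.
by rewrite a2 expr1n mul1r.
Qed.

Lemma act_eta_chi : ps_act eta_mx chi = chi.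
Proof.
rewrite formX_factor.
rewrite rmorphM rmorphB rmorphXn rmorphM rmorphXn rmorph_nat /= eta_sum eta_XY.
transitivity (- a ^+ 3 * A *
  (A ^+ 2 - 9%:R * (2%:R * a) ^+ 2 * (j ^+ 2) ^+ 2 * (u ^+ 2 + v ^+ 2) ^+ 4)).
  by ring.
rewrite a2 j2 /A.
transitivity ((2%:R * a) ^+ 3 *
  ((u ^+ 4 + v ^+ 4) * ((u ^+ 4 + v ^+ 4) ^+ 2 - 36%:R * (u * v) ^+ 4))).
  by ring.
by rewrite a2 expr1n mul1r.
Qed.

Let i : R := ii%:S.
Let i2 : i ^+ 2 = -1. Proof. by rewrite /i -rmorphXn ii2 rmorphN1. Qed.

Lemma tau_X : ps_act tau_mx u = i * v.
Proof. by rewrite act_mx2X rmorph0 mul0r add0r. Qed.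
Lemma tau_Y : ps_act tau_mx v = i * u.
Proof. by rewrite act_mx2Y rmorph0 mul0r addr0. Qed.

Lemma act_tau_T : ps_act tau_mx T = T.
Proof.
rewrite /formT rmorphM rmorphB rmorphM !rmorphXn /= tau_X tau_Y.
transitivity ((i ^+ 2) ^+ 3 * (u * v * (v ^+ 4 - u ^+ 4))); first by ring.
by rewrite i2; ring.
Qed.

Lemma act_tau_W : ps_act tau_mx W = W.
Proof.
rewrite /formW !rmorphD rmorphM !rmorphXn rmorphM rmorph_nat /= tau_X tau_Y.
transitivity ((i ^+ 2) ^+ 4 * W); rewrite /formW; first by ring.
by rewrite i2; ring.
Qed.

Lemma act_tau_chi : ps_act tau_mx chi = chi.
Proof.
rewrite rmorph_formX /= tau_X tau_Y formX_factor.
transitivity ((i ^+ 2) ^+ 6 * ((u ^+ 4 + v ^+ 4) *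
    ((u ^+ 4 + v ^+ 4) ^+ 2 - 36%:R * (u * v) ^+ 4))); first by ring.
by rewrite i2; ring.
Qed.

Let w' : R := zeta^-1%:S.
Let ww' : w * w' = 1. Proof. by rewrite /w /w' -rmorphM mulfV ?rmorph1 ?zeta_neq0. Qed.
Let w4 : w ^+ 4 = -1. Proof. by rewrite /w -rmorphXn zeta4 rmorphN1. Qed.
Let w'4 : w' ^+ 4 = -1. Proof. by rewrite /w' -rmorphXn exprVn zeta4 invrN invr1 rmorphN1. Qed.

Lemma psi_X : ps_act psi_mx u = w * u.
Proof. by rewrite act_mx2X rmorph0 mul0r addr0. Qed.
Lemma psi_Y : ps_act psi_mx v = w' * v.
Proof. by rewrite act_mx2Y rmorph0 mul0r add0r. Qed.

Lemma act_psi_T : ps_act psi_mx T = - T.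
Proof.
rewrite /formT rmorphM rmorphB rmorphM !rmorphXn /= psi_X psi_Y.
transitivity (w * w' * (u * v * (w ^+ 4 * u ^+ 4 - w' ^+ 4 * v ^+ 4))); first by ring.
by rewrite w4 w'4 ww'; ring.
Qed.

Lemma act_psi_W : ps_act psi_mx W = W.
Proof.
rewrite /formW !rmorphD rmorphM !rmorphXn rmorphM rmorph_nat /= psi_X psi_Y.
transitivity ((w ^+ 4) ^+ 2 * u ^+ 8 + 14%:R * (w * w') ^+ 4 * (u * v) ^+ 4
  + (w' ^+ 4) ^+ 2 * v ^+ 8).
  by ring.
by rewrite w4 w'4 ww'; ring.
Qed.

Lemma act_psi_chi : ps_act psi_mx chi = - chi.
Proof.
rewrite rmorph_formX /= psi_X psi_Y formX_factor.
transitivity ((w ^+ 4 * u ^+ 4 + w' ^+ 4 * v ^+ 4) * ((w ^+ 4 * u ^+ 4 + w' ^+ 4 * v ^+ 4) ^+ 2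
    - 36%:R * (w * w') ^+ 4 * (u * v) ^+ 4)); first by ring.
by rewrite w4 w'4 ww'; ring.
Qed.

End Octahedral.

Section OctahedralInvariants.
Variable K : fieldType.
Local Notation R := (pseries2 K).
Local Notation u := (psX : R).
Local Notation v := (psY : R).
Local Notation "c %:S" := (ps_const c : R) (at level 2, format "c %:S").
Implicit Types f g : R.

Lemma formT_order : ps_order_ge 1 (formT K).
Proof. by apply: ps_order_geMr; apply: ps_order_geMr; apply: ps_order_psX. Qed.

Lemma coef_expX n d : (u ^+ n) d 0%N = (d == n)%:R.
Proof. by rewrite -[u ^+ n]mulr1 -(expr0 v) coef_monom andbT. Qed.

Lemma formT_neq0 : formT K != 0.
Proof.
apply/eqP => /(congr1 (fun f : R => f 5%N 1%N)).
rewrite /formT -mulrA coef_psXM coef_psYM ps_coefB coef_expX -[v ^+ 4]mul1r -(expr0 u).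
by rewrite coef_monom ps_coef0 subr0 => /eqP; rewrite oner_eq0.
Qed.

Lemma formW_order : ps_order_ge 1 (formW K).
Proof.
have X1 n : (0 < n)%N -> ps_order_ge 1 (u ^+ n).
  by case: n => // n _; rewrite exprS; apply/ps_order_geMr/ps_order_psX.
have Y1 n : (0 < n)%N -> ps_order_ge 1 (v ^+ n).
  by case: n => // n _; rewrite exprS; apply/ps_order_geMr/ps_order_psY.
apply: ps_order_geD; last exact: Y1.
apply: ps_order_geD; first exact: X1.
by rewrite mulrC exprMn -mulrA; apply/ps_order_geMr/X1.
Qed.

Lemma formT2_order : ps_order_ge 1 (formT K ^+ 2).
Proof. by apply/ps_order_geMr/formT_order. Qed.

Definition ev f := ps_subst f (formW K) (formT K ^+ 2).

Fact ev_zmod : zmod_morphism ev.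
Proof. by move=> f g; apply: ps_substB. Qed.
Fact ev_monoid : monoid_morphism ev.
Proof.
by split=> [|f g]; [apply: ps_subst1|apply: ps_substM];
  first [exact: formW_order|exact: formT2_order].
Qed.
HB.instance Definition _ := GRing.isZmodMorphism.Build R R ev ev_zmod.
HB.instance Definition _ := GRing.isMonoidMorphism.Build R R ev ev_monoid.

Lemma evX : ev psX = formW K.
Proof. by rewrite /ev substX //; [apply: formW_order|apply: formT2_order]. Qed.
Lemma evY : ev psY = formT K ^+ 2.
Proof. by rewrite /ev substY //; [apply: formW_order|apply: formT2_order]. Qed.
Lemma ev_const (c : K) : ev c%:S = c%:S.
Proof. by apply: subst_const; [apply: formW_order|apply: formT2_order]. Qed.

Definition formZ : R := formT K * formX K.

(** These elements are closed under products, because [octahedral_syzygy] expresses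
    [formZ ^+ 2] as a series in [W] and [T ^ 2]. *)
Definition ev2 (F : R * R) : R := ev F.1 + formZ * ev F.2.

Fact ev2_zmod : zmod_morphism ev2.
Proof. by move=> F G; rewrite /ev2 !raddfB /=; ring. Qed.
HB.instance Definition _ := GRing.isZmodMorphism.Build (R * R)%type R ev2 ev2_zmod.

Local Notation T := (formT K).
Local Notation W := (formW K).
Local Notation chi := (formX K).

Variables (zeta ii r : K).
Hypothesis zeta8 : 8.-primitive_root zeta.
Hypothesis ii2 : ii ^+ 2 = -1.
Hypothesis r2 : 2%:R * r ^+ 2 = 1.

(** The two values of [e] correspond to the two linear characters of the binary octahedral
    group; [tau] and [eta] lie in the kernel of the nontrivial one. *)
Definition semi_invariant (e : bool) f :=
  [/\ ps_act (psi_mx zeta) f = (-1) ^+ e * f, ps_act (tau_mx ii) f = f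
    & ps_act (eta_mx zeta r) f = f].

Lemma semi_invariantB e f g :
  semi_invariant e f -> semi_invariant e g -> semi_invariant e (f - g).
Proof.
by move=> [f1 f2 f3] [g1 g2 g3]; split; rewrite rmorphB /= ?f1 ?f2 ?f3 ?g1 ?g2 ?g3 // mulrBr.
Qed.

Lemma semi_invariantM e e' f g :
  semi_invariant e f -> semi_invariant e' g -> semi_invariant (e (+) e') (f * g).
Proof.
move=> [f1 f2 f3] [g1 g2 g3].
split; rewrite rmorphM /= ?f1 ?f2 ?f3 ?g1 ?g2 ?g3 // signr_addb; ring.
Qed.

Lemma semi_invariant_T : semi_invariant true T.
Proof.
by split; rewrite ?(act_psi_T zeta8) ?(act_tau_T ii2) ?(act_eta_T zeta8 r2) // mulN1r.
Qed.

Lemma semi_invariant_W : semi_invariant false W.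
Proof.
by split; rewrite ?(act_psi_W zeta8) ?(act_tau_W ii2) ?(act_eta_W zeta8 r2) // mul1r.
Qed.

Lemma semi_invariant_chi : semi_invariant true chi.
Proof.
by split; rewrite ?(act_psi_chi zeta8) ?(act_tau_chi ii2) ?(act_eta_chi zeta8 r2) // mulN1r.
Qed.

Lemma act_mx2 (a b c d : K) f : ps_act (mx2 a b c d) f =
  ps_subst f (a%:S * u + b%:S * v) (c%:S * u + d%:S * v).
Proof. by rewrite /ps_act !ps_linE !mxE. Qed.

Lemma psi_coef f a b : ps_act (psi_mx zeta) f a b = f a b * (zeta ^+ a * zeta^-1 ^+ b).
Proof. by rewrite act_mx2 rmorph0 !mul0r addr0 add0r subst_diag. Qed.

Lemma tau_coef f a b : ps_act (tau_mx ii) f a b = f b a * (ii ^+ a * ii ^+ b).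
Proof. by rewrite act_mx2 rmorph0 !mul0r addr0 add0r subst_antidiag. Qed.

Lemma coef_resY f d : f d 0%N = resY f d 0%N. Proof. by []. Qed.

Lemma resY_psX : resY u = u. Proof. by apply: ps_ext => -[|[|a]] [|b]; rewrite /= ?if_same. Qed.
Lemma resY_psY : resY v = 0. Proof. by apply: ps_ext => -[|a] [|[|b]]; rewrite /= ?if_same. Qed.
Lemma resY_const (c : K) : resY c%:S = c%:S. Proof. by apply: ps_ext => -[|a] [|b]. Qed.

(** Both variables have the same restriction to the line [v = 0] after the substitution [eta],
    so that the restriction is given by the values of [f] on the line [u = v]. *)
Lemma eta_coef f d : ps_act (eta_mx zeta r) f d 0%N =
  (r * zeta) ^+ d * \sum_(i < d.+1) f i (d - i)%N.
Proof.
rewrite act_mx2; set x := _ + _; set y := _ + _.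
have resE i j : (x ^+ i * y ^+ j) d 0%N = ((r * zeta) ^+ d) *+ (d == i + j)%N.
  have resxy : resY (x ^+ i * y ^+ j) = ((r * zeta) ^+ (i + j))%:S * u ^+ (i + j).
    rewrite rmorphM !rmorphXn /= /x /y !rmorphD !(rmorphM (@resY K)) /= !resY_const.
    by rewrite resY_psX resY_psY !mulr0 !addr0 -!exprD exprMn -rmorphXn.
  rewrite coef_resY resxy ps_constM coef_expX.
  by case: eqP => [->|_]; rewrite ?mulr1 ?mulr0.
rewrite coef_subst addn0 mulr_sumr; apply: eq_bigr => i _.
rewrite (eq_bigr (fun j : 'I_d.+1 => f i j * ((r * zeta) ^+ d *+ (d == i + j)%N))); last first.
  by move=> j _; rewrite resE.
have jd : (d - i < d.+1)%N by rewrite ltnS leq_subr.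
have id : (i <= d)%N by rewrite -ltnS.
rewrite (bigD1 (Ordinal jd) isT) big1 => [|j jE].
  by rewrite /= addr0 subnKC // eqxx mulr1n mulrC.
rewrite (_ : (d == _) = false) ?mulr0 //; apply: contraNF jE => /eqP dE.
by apply/eqP/val_inj; rewrite /= {2}dE addKn.
Qed.

Lemma semi_psi e f a b : semi_invariant e f -> f a b != 0 -> a = b + 4 * e %[mod 8].
Proof.
move=> [fpsi _ _] fab; have := congr1 (fun f : R => f a b) fpsi.
rewrite psi_coef -(rmorphN1 (@ps_const K)) -rmorphXn ps_constM mulrC => /(mulIf fab) E.
apply/eqP; rewrite -(eq_prim_root_expr zeta8) exprD [_ ^+ (4 * e)]exprM (zeta4 zeta8) -E.
by rewrite exprVn mulrC mulfVK // expf_neq0 // (zeta_neq0 zeta8).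
Qed.

Lemma semi_tau e f d : semi_invariant e f -> f d 0%N = 0 -> f 0%N d = 0.
Proof. by move=> [_ fE _] fd; rewrite -fE tau_coef fd mul0r. Qed.

Lemma semi_eta e f d : semi_invariant e f ->
  f d 0%N = (r * zeta) ^+ d * \sum_(i < d.+1) f i (d - i)%N.
Proof. by move=> [_ _ fE]; rewrite -{1}fE eta_coef. Qed.

Lemma r_neq0 : r != 0.
Proof. by apply/eqP => r0; move/eqP: r2; rewrite r0 expr0n mulr0 eq_sym oner_eq0. Qed.

Lemma semi_sum e f d : semi_invariant e f -> f d 0%N = 0 ->
  \sum_(i < d.+1) f i (d - i)%N = 0.
Proof.
move=> fe /eqP; rewrite (semi_eta d fe) mulf_eq0 => /orP[|/eqP //].
by rewrite (negbTE (expf_neq0 _ _)) // mulf_neq0 ?r_neq0 ?(zeta_neq0 zeta8).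
Qed.

(** By [tau] and [eta] the vanishing on [v = 0] carries over to the lines [u = 0] and [u = v].
    The exponents of [u] that occur in a given degree lie in a single class modulo 4, so that
    the partial sums of the coefficients, which vanish at the end, are constant between
    members of the class. They are the coefficients of the quotient by
    [u ^ 4 - v ^ 4]. *)
Lemma semi_dvd_T e f : semi_invariant e f -> (forall d, f d 0%N = 0) -> exists g, f = T * g.
Proof.
move=> fe f0; pose f1 : R := PSeries2 (fun a b => f a.+1 b.+1).
have fE : f = u * v * f1.
  apply: ps_ext => a b; rewrite -mulrA coef_psXM; case: a => [|a].
    exact: (semi_tau fe (f0 b)).
  by rewrite coef_psYM; case: b => [|b]; rewrite ?f0.
have wt a b : f1 a b != 0 -> a = b + 4 * e %[mod 8].
  by move=> /(semi_psi fe) /eqP; rewrite -addn1 -[b.+1]addn1 addnAC eqn_modDr => /eqP.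
pose S d m := \sum_(i < m) f1 i (d - i)%N.
have S0 d : S d d.+1 = 0.
  have := semi_sum fe (f0 d.+2); rewrite big_ord_recl big_ord_recr /=.
  rewrite subn0 (semi_tau fe (f0 _)) /bump /= add1n subnn add0r f0 addr0 => E.
  rewrite -[RHS]E; apply: eq_bigr => i _ /=; congr (f _ _).
  by have := ltn_ord i; rewrite /bump /=; lia.
have Sext d m m' : (m <= m')%N -> (forall i, (m <= i < m')%N -> f1 i (d - i)%N = 0) ->
    S d m' = S d m.
  move=> /subnKC <-; elim: (m' - m)%N => [|k IHk] zi; first by rewrite addn0.
  have -> : S d (m + k.+1)%N = S d (m + k)%N + f1 (m + k)%N (d - (m + k))%N.
    by rewrite addnS /S big_ord_recr.
  rewrite zi ?addr0; last by lia.
  by apply: IHk => i ik; apply: zi; lia.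
pose g : R := PSeries2 (fun a b =>
  if (a == b + 4 + 4 * e %[mod 8])%N then - S (a + b + 4)%N a.+1 else 0).
have gE a b : g a b =
  if (a == b + 4 + 4 * e %[mod 8])%N then - S (a + b + 4)%N a.+1 else 0 by [].
exists g; rewrite fE /formT -!mulrA; congr (u * (v * _)); apply: ps_ext => a b.
rewrite mulrBl ps_coefB coef_psXnM coef_psYnM !gE.
have [ab|ab] := eqVneq (a %% 8)%N ((b + 4 * e) %% 8)%N; last first.
  have -> : f1 a b = 0 by apply/eqP; apply: contraNT ab => /wt/eqP.
  rewrite [X in X - _](_ : _ = 0) ?[X in _ - X](_ : _ = 0) ?subrr //.
    by case: ifP => // b4; case: ifP => // c; lia.
  by case: ifP => // a4; case: ifP => // c; lia.
have zero i : (i <= a + b)%N -> i != a -> (i < a + 4)%N -> (a < i + 4)%N ->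
    f1 i (a + b - i)%N = 0.
  by move=> *; apply/eqP; apply: contraT => /wt; lia.
have top : S (a + b)%N a.+1 = S (a + b)%N a + f1 a b.
  by rewrite /S big_ord_recr /= addKn.
have low : (a < 4)%N -> S (a + b)%N a = 0.
  move=> a4; rewrite (@Sext _ 0) // => [|i ia]; first by rewrite /S big_ord0.
  by apply: zero; lia.
have mid : (4 <= a)%N -> S (a + b)%N a = S (a + b)%N (a - 3)%N.
  by move=> a4; apply: Sext => [|i ia]; [lia|apply: zero; lia].
have high : (b < 4)%N -> S (a + b)%N a.+1 = 0.
  move=> b4; rewrite -(S0 (a + b)%N); apply/esym/Sext => [|i ia]; first by lia.
  by apply: zero; lia.
have [a4|a4] := leqP 4 a; have [b4|b4] := leqP 4 b.
- rewrite (_ : (_ == _) = true); last by apply/eqP; lia.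
  rewrite (_ : (_ == _) = true); last by apply/eqP; lia.
  rewrite (_ : a - 4 + b + 4 = a + b)%N; last by lia.
  rewrite (_ : a + (b - 4) + 4 = a + b)%N; last by lia.
  rewrite (_ : (a - 4).+1 = a - 3)%N; last by lia.
  by rewrite top mid // opprK addKr.
- rewrite (_ : (_ == _) = true); last by apply/eqP; lia.
  rewrite (_ : a - 4 + b + 4 = a + b)%N; last by lia.
  rewrite (_ : (a - 4).+1 = a - 3)%N; last by lia.
  by rewrite subr0 -mid //; apply/eqP; rewrite -addr_eq0 addrC -top high.
- rewrite (_ : (_ == _) = true); last by apply/eqP; lia.
  rewrite (_ : a + (b - 4) + 4 = a + b)%N; last by lia.
  by rewrite top low // !add0r opprK.
- by rewrite subrr -(high b4) top low ?add0r.
Qed.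

Lemma semi_div_T e f g : semi_invariant e f -> f = T * g -> semi_invariant (~~ e) g.
Proof.
move=> [f1 f2 f3] fE; have [t1 t2 t3] := semi_invariant_T; have inj := ps_mulfI formT_neq0.
split; apply: inj => /=.
- have E : (-1) ^+ true * T * ps_act (psi_mx zeta) g = (-1) ^+ e * (T * g).
    by rewrite -t1 -rmorphM /= -fE f1 fE.
  transitivity (- ((-1) ^+ true * T * ps_act (psi_mx zeta) g)).
    by rewrite expr1 mulN1r mulNr opprK.
  by rewrite E; case: (e); rewrite /= ?expr0 ?expr1; ring.
- by rewrite -{1}t2 -rmorphM /= -fE f2.
- by rewrite -{1}t3 -rmorphM /= -fE f3.
Qed.

Lemma resY_formT : resY T = 0.
Proof. by rewrite /formT rmorphM rmorphM /= resY_psY mulr0 mul0r. Qed.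

Lemma resY_formW : resY W = u ^+ 8.
Proof.
rewrite /formW !rmorphD rmorphM !rmorphXn rmorphM /= resY_psX resY_psY.
by rewrite mulr0 !expr0n mulr0 !addr0.
Qed.

Lemma resY_formX : resY chi = u ^+ 12.
Proof. by rewrite rmorph_formX /= resY_psX resY_psY mulr0 !expr0n /=; ring. Qed.

Lemma resY_coef_mul f g n d : resY f = u ^+ n ->
  (f * g) d 0%N = if (n <= d)%N then g (d - n)%N 0%N else 0.
Proof.
move=> fn; have E : resY (f * g) = u ^+ n * resY g by rewrite rmorphM /= fn.
by rewrite (coef_resY (f * g)) E coef_psXnM.
Qed.

Lemma ev_coef0 f d : ev f d 0%N = if (8 %| d)%N then f (d %/ 8)%N 0%N else 0.
Proof.
rewrite (@coef_subst_pick _ _ _ _ _ _ (d %/ 8) 0 (8 %| d)%N%:R) //.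
- by case: ifP; rewrite ?mulr1 ?mulr0.
- by rewrite addn0 leq_div.
move=> k l; have E : resY (W ^+ k * (T ^+ 2) ^+ l) = u ^+ (8 * k) * (l == 0%N)%:R.
  by rewrite rmorphM !rmorphXn /= resY_formW resY_formT -exprM expr0n /= expr0n.
rewrite coef_resY E; case: (l =P 0%N) => [_|_].
  rewrite mulr1 coef_expX andbT; case: eqP => [->|dk].
    by rewrite mulKn // eqxx dvdn_mulr.
  case: eqP => // kd; rewrite (_ : (8 %| d)%N = false) //.
  by apply/negP => /dvdnP[k' dk']; move: dk; rewrite kd dk' mulnK // mulnC.
by rewrite mulr0 andbF.
Qed.

Lemma act_ev s f : ps_act s W = W -> ps_act s (T ^+ 2) = T ^+ 2 -> ps_act s (ev f) = ev f.
Proof.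
move=> sW sT; rewrite /ev act_subst; [|exact: formW_order|exact: formT2_order].
by rewrite sW sT.
Qed.

Lemma semi_ev f : semi_invariant false (ev f).
Proof.
have [w1 w2 w3] := semi_invariant_W; have [t1 t2 t3] := semi_invariant_T.
split; rewrite ?expr0 ?mul1r; apply: act_ev.
- by rewrite w1 mul1r.
- by rewrite rmorphXn /= t1 expr1 mulN1r sqrrN.
- exact: w2.
- by rewrite rmorphXn /= t2.
- exact: w3.
- by rewrite rmorphXn /= t3.
Qed.

Lemma peel_even f : semi_invariant false f -> exists F g,
  semi_invariant true g /\ f = ev F + T * g.
Proof.
move=> fe; pose F : R := PSeries2 (fun a b => if b == 0%N then f (8 * a)%N 0%N else 0).
have [|g gE] := semi_dvd_T (semi_invariantB fe (semi_ev F)).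
  move=> d; rewrite ps_coefB ev_coef0 [F _ _]/=; case: ifP => [/dvdnP[k ->]|d8].
    by rewrite mulnK // mulnC subrr.
  rewrite subr0; apply/eqP; apply: contraFT d8 => /(semi_psi fe); lia.
exists F, g; rewrite -gE subrKC; split=> //.
exact: semi_div_T (semi_invariantB fe (semi_ev F)) gE.
Qed.

Hypothesis K3 : 3%:R != 0 :> K.

(** On the line [v = 0] only the exponents that are 4 modulo 8 occur, and the exponent 4 does
    not: it comes from a multiple of [u ^ 4 + v ^ 4], which [eta] does not fix. *)
Lemma peel_odd f : semi_invariant true f -> exists F g,
  semi_invariant false g /\ f = chi * ev F + T * g.
Proof.
move=> fe; pose F : R := PSeries2 (fun a b => if b == 0%N then f (8 * a + 12)%N 0%N else 0).
have ce : semi_invariant true (chi * ev F).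
  exact: semi_invariantM semi_invariant_chi (semi_ev F).
have f4 : f 4%N 0%N = 0.
  have z a b : a != b + 4 * true %[mod 8] -> f a b = 0.
    by move=> ab; apply/eqP; apply: contraNT ab => /(semi_psi fe)/eqP.
  have f04 : f 0%N 4%N = f 4%N 0%N.
    have [_ fE _] := fe; rewrite -{1}fE tau_coef expr0 mul1r (exprM ii 2 2) ii2.
    by rewrite sqrrN expr1n mulr1.
  have r4 : 4%:R * (r * zeta) ^+ 4 = -1.
    rewrite exprMn (zeta4 zeta8); transitivity (- (2%:R * r ^+ 2) ^+ 2); first by ring.
    by rewrite r2 expr1n.
  have E : f 4%N 0%N = (r * zeta) ^+ 4 * (f 4%N 0%N + f 4%N 0%N).
    rewrite {1}(semi_eta 4 fe) !big_ord_recl big_ord0; congr (_ * _).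
    rewrite -[LHS]/(f 0%N 4%N + (f 1%N 3%N + (f 2%N 2%N + (f 3%N 1%N + (f 4%N 0%N + 0))))).
    by rewrite (z 1 3)%N // (z 2 2)%N // (z 3 1)%N // f04 !add0r addr0.
  have /eqP : 2%:R * 3%:R * f 4%N 0%N = 0.
    transitivity (4%:R * f 4%N 0%N - -1 * (f 4%N 0%N + f 4%N 0%N)); first by ring.
    by rewrite {1}E mulrA r4 subrr.
  by rewrite !mulf_eq0 (negbTE (K2 r2)) (negbTE K3) => /eqP.
have [|g gE] := semi_dvd_T (semi_invariantB fe ce).
  move=> d; rewrite ps_coefB (resY_coef_mul _ _ resY_formX) ev_coef0 [F _ _]/=.
  have [d12|d12] := leqP 12 d.
    case: ifP => [/dvdnP[k dk]|d8]; first by rewrite dk mulnK // mulnC -dk subnK // subrr.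
    rewrite subr0; apply/eqP; apply: contraFT d8 => /(semi_psi fe); lia.
  rewrite subr0; have [->//|d4] := eqVneq d 4%N.
  apply/eqP; apply: contraTT d12 => /(semi_psi fe); lia.
exists F, g; rewrite -gE subrKC; split=> //.
exact: semi_div_T (semi_invariantB fe ce) gE.
Qed.

End OctahedralInvariants.

Section Structure.
Variable K : fieldType.
Local Notation R := (pseries2 K).
Local Notation u := (psX : R).
Local Notation v := (psY : R).
Local Notation "c %:S" := (ps_const c : R) (at level 2, format "c %:S").
Implicit Types (f g : R) (F : (R * R)%type).
Local Notation T := (formT K).
Local Notation W := (formW K).
Local Notation chi := (formX K).
Local Notation Z := (formZ K).

Lemma resY_mulT f d : (T * f) d 0%N = 0.
Proof.
have E : resY (T * f) = 0 by rewrite rmorphM /= resY_formT mul0r.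
by rewrite (coef_resY (T * f)) E.
Qed.

(** Restricting to [v = 0], dividing by [T] and restricting again shows that both components
    are divisible by the second variable. *)
Lemma ev2_eq0_step F : ev2 F = 0 -> exists F', F = (v * F'.1, v * F'.2) /\ ev2 F' = 0.
Proof.
case: F => F1 F2; rewrite /ev2 /= => F0.
have cancelT f : T * f = 0 -> f = 0.
  by move=> Tf; apply: (ps_mulfI (@formT_neq0 K)); rewrite /= mulr0.
have F10 a : F1 a 0%N = 0.
  have := congr1 (fun f : R => f (8 * a)%N 0%N) F0.
  by rewrite ps_coefD /formZ -mulrA resY_mulT addr0 ev_coef0 dvdn_mulr // mulKn.
have [F1' F1E] : exists F1' : R, F1 = v * F1' by exists (shiftY 1 F1); apply: psY_dvd.
have F0' : T * ev F1' + chi * ev F2 = 0.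
  apply: cancelT; rewrite -F0 F1E rmorphM /= evY /formZ; ring.
have F20 a : F2 a 0%N = 0.
  have := congr1 (fun f : R => f (8 * a + 12)%N 0%N) F0'.
  rewrite ps_coefD resY_mulT add0r (resY_coef_mul _ _ (resY_formX K)) leq_addl addnK.
  by rewrite ev_coef0 dvdn_mulr // mulKn.
have [F2' F2E] : exists F2' : R, F2 = v * F2' by exists (shiftY 1 F2); apply: psY_dvd.
exists (F1', F2'); rewrite /= -F1E -F2E; split=> //; apply: cancelT.
by rewrite -F0' F2E rmorphM /= evY /formZ; ring.
Qed.

Lemma ev2_eq0 F : ev2 F = 0 -> F = 0.
Proof.
move=> F0; suff E b : forall F, ev2 F = 0 -> forall a, F.1 a b = 0 /\ F.2 a b = 0.
  rewrite [F]surjective_pairing; congr (_, _); apply: ps_ext => a b;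
  by have [] := E b F F0 a.
elim: b {F F0} => [|b IHb] F /ev2_eq0_step[F' [-> F'0]] a;
  rewrite [fst _]/= [snd _]/= !coef_psYM //.
exact: IHb.
Qed.

Lemma ev2_inj : injective (@ev2 K).
Proof.
by move=> F G FG; apply/eqP; rewrite -subr_eq0; apply/eqP/ev2_eq0; rewrite raddfB /= FG subrr.
Qed.

Lemma ev2_mul f F : ev f * ev2 F = ev2 (f * F.1, f * F.2).
Proof. by rewrite /ev2 /= !rmorphM /=; ring. Qed.

Lemma ev2_mulZ F : Z * ev2 F = ev2 (v * (u ^+ 3 - 108%:R * v ^+ 2) * F.2, F.1).
Proof.
rewrite /ev2 /= 2!rmorphM rmorphB rmorphXn rmorphM rmorphXn rmorph_nat /= evX evY.
rewrite -[T ^+ 2 ^+ 2]exprM -octahedral_syzygy /formZ; ring.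
Qed.

Lemma ev2_coef00 F : ev2 F 0 0 = F.1 0%N 0%N.
Proof. by rewrite /ev2 ps_coefD /formZ -mulrA resY_mulT addr0 ev_coef0 dvdn0 div0n. Qed.

Section Action.
Variables (zeta ii r lam : K).
Hypothesis zeta8 : 8.-primitive_root zeta.
Hypothesis ii2 : ii ^+ 2 = -1.
Hypothesis r2 : 2%:R * r ^+ 2 = 1.
Hypothesis K3 : 3%:R != 0 :> K.
Hypothesis lam22 : 22.-primitive_root lam.

Local Notation semi_invariant := (semi_invariant zeta ii r).

(** Successive approximation in powers of [T ^ 2], each step being a peeling of either
    parity. *)
Lemma ev2_onto f : semi_invariant false f -> exists F, f = ev2 F.
Proof.
move=> fs; pose s (F : R * R) := (v * F.1, v * F.2).
have sE k F : iter k s F = (v ^+ k * F.1, v ^+ k * F.2).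
  by elim: k => [|k IHk]; rewrite ?mul1r -?surjective_pairing //= IHk /s /= !exprS !mulrA.
pose Phi : {additive R * R -> R^o} := @ev2 K.
have [] := @successive_approx (R * R)%type R^o s (GRing.scale (T ^+ 2)) Phi setT
  (semi_invariant false) _ _ _ _ f fs.
- by move=> F; rewrite /Phi /s /= -[RHS]/(T ^+ 2 * ev2 F) -evY ev2_mul.
- move=> h _; pose x := (ps_sum v (fun k => (h k).1), ps_sum v (fun k => (h k).2)).
  exists x => // n.
  exists (ps_sum v (fun k => (h (n + k)%N).1), ps_sum v (fun k => (h (n + k)%N).2)).
  rewrite sE (eq_bigr (fun k : 'I_n => (v ^+ k * (h k).1, v ^+ k * (h k).2)))
    => [|k _]; last exact: sE.
  rewrite /x (ps_sumE (fun k => (h k).1) n (ps_order_psY K)).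
  rewrite (ps_sumE (fun k => (h k).2) n (ps_order_psY K)).
  have -> : \sum_(k < n) (v ^+ k * (h k).1, v ^+ k * (h k).2) =
      (\sum_(k < n) v ^+ k * (h k).1, \sum_(k < n) v ^+ k * (h k).2).
    elim: (n) => [|m IHm]; first by rewrite !big_ord0.
    by rewrite !big_ord_recr IHm.
  by [].
- move=> x xT; apply: ps_order_ge_eq0 => n; have [y ->] := xT n.
  rewrite iter_scale; apply: ps_order_geMr; apply: ps_order_geX; exact: formT2_order.
- move=> g gs; have [F0 [g' [g's gE]]] := peel_even zeta8 ii2 r2 gs.
  have [F1 [h [hs g'E]]] := peel_odd zeta8 ii2 r2 K3 g's.
  exists (F0, F1), h; split=> //.
  change (g = ev F0 + T * chi * ev F1 + T ^+ 2 * h :> R).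
  by rewrite gE g'E; ring.
- by move=> F _ ->; exists F.
Qed.

Lemma semi_Z : semi_invariant false Z.
Proof.
exact: semi_invariantM (semi_invariant_T zeta8 ii2 r2) (semi_invariant_chi zeta8 ii2 r2).
Qed.

Lemma semi_ev2 F : semi_invariant false (ev2 F).
Proof.
have [z1 z2 z3] := semi_Z; have [e1 e2 e3] := semi_ev zeta8 ii2 r2 F.1.
have [g1 g2 g3] := semi_ev zeta8 ii2 r2 F.2.
by split; rewrite /ev2 rmorphD rmorphM /= ?z1 ?z2 ?z3 ?e1 ?e2 ?e3 ?g1 ?g2 ?g3 ?expr0 ?mul1r.
Qed.

Definition phi_mx : 'M[K]_2 := mx2 lam 0 0 lam.

Let l : R := lam%:S.
Lemma phi_X : ps_act phi_mx u = l * u.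
Proof. by rewrite act_mx2X rmorph0 mul0r addr0. Qed.
Lemma phi_Y : ps_act phi_mx v = l * v.
Proof. by rewrite act_mx2Y rmorph0 mul0r add0r. Qed.

Lemma phi_T : ps_act phi_mx T = l ^+ 6 * T.
Proof. by rewrite /formT rmorphM rmorphB rmorphM !rmorphXn /= phi_X phi_Y; ring. Qed.
Lemma phi_W : ps_act phi_mx W = l ^+ 8 * W.
Proof. by rewrite /formW !rmorphD rmorphM !rmorphXn rmorphM rmorph_nat /= phi_X phi_Y; ring. Qed.
Lemma phi_chi : ps_act phi_mx chi = l ^+ 12 * chi.
Proof. by rewrite rmorph_formX /= phi_X phi_Y formX_factor; ring. Qed.

Definition rescale f := ps_subst f ((lam ^+ 8)%:S * u) ((lam ^+ 12)%:S * v).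

Lemma phi_ev f : ps_act phi_mx (ev f) = ev (rescale f).
Proof.
have EW : ps_act phi_mx W = ev ((lam ^+ 8)%:S * u).
  by rewrite phi_W rmorphM /= ev_const evX rmorphXn.
have ET : ps_act phi_mx (T ^+ 2) = ev ((lam ^+ 12)%:S * v).
  by rewrite rmorphXn /= phi_T [ev _]rmorphM /= ev_const evY rmorphXn; ring.
rewrite /ev act_subst; [|exact: formW_order|exact: formT2_order].
rewrite EW ET /rescale subst_comp; first exact: erefl.
- by rewrite mulrC; apply/ps_order_geMr/ps_order_psX.
- by rewrite mulrC; apply/ps_order_geMr/ps_order_psY.
- exact: formW_order.
- exact: formT2_order.
Qed.

Lemma phi_ev2 F : ps_act phi_mx (ev2 F) = ev2 (rescale F.1, (lam ^+ 18)%:S * rescale F.2).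
Proof.
rewrite /ev2 rmorphD rmorphM /= !phi_ev rmorphM /= phi_T phi_chi rmorphM /= ev_const.
by rewrite !rmorphXn -/l /formZ; ring.
Qed.

(** Since [lam] has order 22, the last condition says that the degrees of the terms of [f] are
    congruent to [k] modulo 22. *)
Definition semi22 k f := semi_invariant false f /\ ps_act phi_mx f = (lam ^+ k)%:S * f.

Lemma lam_expr_eq m n (x : K) : x != 0 -> (x * lam ^+ m = lam ^+ n * x) <-> (m = n %[mod 22]).
Proof.
move=> x0; split=> [|mn].
  by rewrite mulrC => /(mulIf x0)/eqP; rewrite (eq_prim_root_expr lam22) => /eqP.
by rewrite mulrC; congr (_ * _); apply/eqP; rewrite (eq_prim_root_expr lam22); apply/eqP.
Qed.

Lemma semi22_ev2 k F : semi22 k (ev2 F) <->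
  (forall a b, F.1 a b != 0 -> 8 * a + 12 * b = k %[mod 22]) /\
  (forall a b, F.2 a b != 0 -> 8 * a + 12 * b + 18 = k %[mod 22]).
Proof.
have c1 f a b : rescale f a b = f a b * lam ^+ (8 * a + 12 * b).
  by rewrite /rescale subst_diag -!exprM -exprD.
have kE : (lam ^+ k)%:S * ev2 F = ev2 ((lam ^+ k)%:S * F.1, (lam ^+ k)%:S * F.2).
  by rewrite -ev2_mul ev_const.
split=> [[_]|[F1 F2]].
  rewrite phi_ev2 kE => /ev2_inj E.
  have E1 : rescale F.1 = (lam ^+ k)%:S * F.1 := congr1 fst E.
  have E2 : (lam ^+ 18)%:S * rescale F.2 = (lam ^+ k)%:S * F.2 := congr1 snd E.
  split=> a b Fab.
    by apply/(lam_expr_eq _ _ Fab); rewrite -c1 -ps_constM -E1.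
  apply/(lam_expr_eq _ _ Fab); rewrite exprD mulrA -c1 mulrC -ps_constM E2.
  by rewrite ps_constM.
split; first exact: semi_ev2.
rewrite phi_ev2 kE; congr (ev2 (_, _)); apply: ps_ext => a b.
  rewrite ps_constM c1; have [->|Fab] := eqVneq (F.1 a b) 0; first by rewrite mul0r mulr0.
  by apply/(lam_expr_eq _ _ Fab)/F1.
rewrite !ps_constM c1; have [->|Fab] := eqVneq (F.2 a b) 0; first by rewrite mul0r !mulr0.
by rewrite mulrC -mulrA -exprD; apply/(lam_expr_eq _ _ Fab)/F2.
Qed.

Lemma semi22P k f : semi22 k f -> exists2 F, f = ev2 F & semi22 k (ev2 F).
Proof. by move=> fs; have [F E] := ev2_onto fs.1; exists F; rewrite -?E. Qed.

End Action.
End Structure.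

(** * Monomial bases *)

Section Monomials.
Variable K : fieldType.
Local Notation R := (pseries2 K).
Local Notation u := (psX : R).
Local Notation v := (psY : R).
Implicit Types (f g : R) (F : (R * R)%type).

Definition dilate f := ps_subst f (u ^+ 11) (v ^+ 11).

Let X11 : ps_order_ge 1 (u ^+ 11).
Proof. by rewrite exprS; apply/ps_order_geMr/ps_order_psX. Qed.
Let Y11 : ps_order_ge 1 (v ^+ 11).
Proof. by rewrite exprS; apply/ps_order_geMr/ps_order_psY. Qed.

Fact dilate_zmod : zmod_morphism dilate.
Proof. by move=> f g; apply: ps_substB. Qed.
Fact dilate_monoid : monoid_morphism dilate.
Proof.
by split=> [|f g]; [apply: ps_subst1|apply: ps_substM];
  [exact: X11|exact: Y11|exact: X11|exact: Y11].
Qed.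
HB.instance Definition _ := GRing.isZmodMorphism.Build R R dilate dilate_zmod.
HB.instance Definition _ := GRing.isMonoidMorphism.Build R R dilate dilate_monoid.

Lemma dilate_coef f a b : dilate f a b =
  if (11 %| a)%N && (11 %| b)%N then f (a %/ 11)%N (b %/ 11)%N else 0.
Proof.
rewrite (@coef_subst_pick _ _ _ _ _ _ (a %/ 11) (b %/ 11) ((11 %| a)%N && (11 %| b)%N)%:R).
- by case: ifP; rewrite ?mulr1 ?mulr0.
- by apply: leq_trans (leq_div _ _) _; apply: leq_addr.
- by apply: leq_trans (leq_div _ _) _; apply: leq_addl.
move=> k l; have -> : (u ^+ 11) ^+ k * (v ^+ 11) ^+ l = u ^+ (11 * k) * v ^+ (11 * l).
  by rewrite !exprM.
rewrite coef_monom.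
have E m n : (m == 11 * n)%N = (11 %| m)%N && (n == m %/ 11)%N.
  by apply/idP/idP; lia.
by rewrite !E; case: (11 %| a)%N; case: (11 %| b)%N; case: (k == _); case: (l == _).
Qed.

Lemma dilateX : dilate u = u ^+ 11. Proof. by rewrite /dilate substX. Qed.
Lemma dilateY : dilate v = v ^+ 11. Proof. by rewrite /dilate substY. Qed.

(** The exponent [b] for which [W ^ a T ^ (2 b) z ^ c] has degree [2 h] modulo 22. *)
Definition expY (h a c : nat) := ((2 * h + 3 * a + 4 * c) %% 11)%N.

Definition slot (c a : nat) : 'I_22 := inord (11 * c + a).

(** The index of a basis monomial encodes [c] and [a]; the exponent of the second variable is
    then forced by the degree. *)
Definition assemble h c (x : 'rV[R]_22) : R :=
  \sum_(a < 11) dilate (x 0 (slot c a)) * (u ^+ a * v ^+ expY h a c).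

Lemma assemble_coef h c x a b : assemble h c x a b =
  if (b %% 11 == expY h (a %% 11) c)%N then x 0 (slot c (a %% 11)) (a %/ 11)%N (b %/ 11)%N
  else 0.
Proof.
rewrite /assemble ps_coef_sum.
have a11 : (a %% 11 < 11)%N by rewrite ltn_mod.
rewrite (eq_bigr (fun a' : 'I_11 => if (a' <= a)%N && (expY h a' c <= b)%N &&
    ((11 %| a - a')%N && (11 %| b - expY h a' c)%N) then
    x 0 (slot c a') ((a - a') %/ 11)%N ((b - expY h a' c) %/ 11)%N else 0)); last first.
  by move=> a' _; rewrite mulrC coef_monomM dilate_coef; case: ifP.
rewrite (bigD1 (Ordinal a11)) //= big1 ?addr0 => [|a' a'a]; last first.
  case: ifP => // /andP[/andP[ha _] /andP[ha' _]]; case/eqP: a'a; apply: val_inj => /=.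
  by have := ltn_ord a'; lia.
have bE : (expY h (a %% 11) c < 11)%N by rewrite ltn_mod.
set e := expY _ _ _ in bE *.
rewrite (_ : (a %% 11 <= a)%N); last by rewrite leq_mod.
have [be|be] := eqVneq (b %% 11)%N e.
  rewrite (_ : (e <= b)%N); last by lia.
  rewrite (_ : (11 %| a - a %% 11)%N); last by lia.
  rewrite (_ : (11 %| b - e)%N); last by lia.
  by congr (coef2 _ _ _); lia.
by case: ifP => // /andP[eb /andP[_ h']]; move: be; lia.
Qed.

Lemma assemble_linear h c (b : R) (x y : 'rV[R]_22) :
  assemble h c (b *: x + y) = dilate b * assemble h c x + assemble h c y.
Proof.
rewrite /assemble mulr_sumr -big_split; apply: eq_bigr => a _.
by rewrite !mxE rmorphD rmorphM /= mulrDl -[in LHS]mulrA.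
Qed.

Definition decode h (x : 'rV[R]_22) : R := ev2 (assemble h 0 x, assemble h 1 x).

Lemma decode_linear h (b : R) (x y : 'rV[R]_22) :
  decode h (b *: x + y) = ev (dilate b) * decode h x + decode h y.
Proof. by rewrite /decode ev2_mul -raddfD /= !assemble_linear. Qed.

Lemma slotE (i : 'I_22) : slot (i %/ 11) (i %% 11) = i.
Proof. by apply: val_inj; rewrite /= inordK; have := ltn_ord i; lia. Qed.

Lemma decode_inj h : injective (decode h).
Proof.
move=> x y /ev2_inj E.
have E0 : assemble h 0 x = assemble h 0 y := congr1 fst E.
have E1 : assemble h 1 x = assemble h 1 y := congr1 snd E.
have Ec c : (c < 2)%N -> assemble h c x = assemble h c y by case: c => [|[|]].
apply/rowP => i; apply: ps_ext => k l.
have c2 : (i %/ 11 < 2)%N by have := ltn_ord i; lia.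
have := congr1 (fun f : R =>
  f (11 * k + i %% 11)%N (11 * l + expY h (i %% 11) (i %/ 11))%N) (Ec _ c2).
have eE : (expY h (i %% 11) (i %/ 11) < 11)%N by rewrite ltn_mod.
rewrite !assemble_coef (_ : (11 * k + i %% 11) %% 11 = i %% 11)%N; last by lia.
rewrite (_ : _ == _); last by apply/eqP; lia.
rewrite slotE (_ : (11 * k + i %% 11) %/ 11 = k)%N; last by lia.
by rewrite (_ : (11 * l + _) %/ 11 = l)%N //; lia.
Qed.

Lemma decode_unit h i : decode h (delta_mx 0 i) =
  ev (u ^+ (i %% 11) * v ^+ expY h (i %% 11) (i %/ 11)) *
  (if (i < 11)%N then 1 else formZ K).
Proof.
have [i22 e11] : (i < 22)%N /\ (i %% 11 < 11)%N by rewrite ltn_ord ltn_mod.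
have aE c : (c < 2)%N -> assemble h c (delta_mx 0 i) = if (i %/ 11 == c)%N then
    u ^+ (i %% 11) * v ^+ expY h (i %% 11) (i %/ 11) else 0.
  move=> c2; have sE a : (a < 11)%N -> (slot c a == i) = (i %/ 11 == c)%N && (a == i %% 11)%N.
    move=> a11; rewrite -val_eqE /= inordK; last by lia.
    by apply/eqP/andP => [?|[/eqP ? /eqP ?]]; [split; apply/eqP|]; lia.
  rewrite /assemble (bigD1 (Ordinal e11)) //= big1 => [|a ai].
    by rewrite !mxE sE // !eqxx andbT addr0 /=; case: eqP => [->|_];
      rewrite ?rmorph1 ?mul1r ?rmorph0 ?mul0r.
  rewrite !mxE sE // -[a == _ :> nat]/(a == Ordinal e11) (negbTE ai) andbF.
  by rewrite rmorph0 mul0r.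
rewrite /decode !aE // /ev2; case: ltnP => i11.
  by rewrite divn_small //= rmorph0 mulr0 addr0 mulr1.
by rewrite (_ : (i %/ 11)%N = 1%N) /=; [rewrite rmorph0 add0r mulrC|lia].
Qed.

Section Decode.
Variables (zeta ii r lam : K).
Hypothesis zeta8 : 8.-primitive_root zeta.
Hypothesis ii2 : ii ^+ 2 = -1.
Hypothesis r2 : 2%:R * r ^+ 2 = 1.
Hypothesis K3 : 3%:R != 0 :> K.
Hypothesis lam22 : 22.-primitive_root lam.
Local Notation semi22 := (semi22 zeta ii r lam).

Lemma decode_semi h x : semi22 (2 * h) (decode h x).
Proof.
apply/semi22_ev2 => //; split=> a b; rewrite assemble_coef; case: ifP; rewrite ?eqxx //.
  by move=> /eqP bE _; rewrite /expY in bE; lia.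
by move=> /eqP bE _; rewrite /expY in bE; lia.
Qed.

Lemma decode_onto h f : semi22 (2 * h) f -> exists x, f = decode h x.
Proof.
move=> /semi22P[] // F -> /semi22_ev2[] // F1 F2.
pose x : 'rV[R]_22 := \row_i PSeries2 (fun k l =>
  (if (i < 11)%N then F.1 else F.2) (11 * k + i %% 11)%N
    (11 * l + expY h (i %% 11) (i %/ 11))%N).
have xE c a : (c < 2)%N -> x 0 (slot c (a %% 11)) = PSeries2 (fun k l =>
    (if (c == 0)%N then F.1 else F.2) (11 * k + a %% 11)%N (11 * l + expY h (a %% 11) c)%N).
  move=> c2; have a11 : (a %% 11 < 11)%N by rewrite ltn_mod.
  rewrite mxE /= inordK; last by lia.
  rewrite (_ : (11 * c + a %% 11) %% 11 = a %% 11)%N; last by lia.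
  rewrite (_ : (11 * c + a %% 11) %/ 11 = c)%N; last by lia.
  by rewrite (_ : (11 * c + a %% 11 < 11)%N = (c == 0)%N) //; lia.
have recompose c a b : (c < 2)%N -> ((if (c == 0)%N then F.1 else F.2) a b != 0 ->
    (b %% 11)%N = expY h (a %% 11) c) ->
    (if (c == 0)%N then F.1 else F.2) a b = assemble h c x a b.
  move=> c2 supp; rewrite assemble_coef xE //.
  have [bE|bE] := eqVneq (b %% 11)%N (expY h (a %% 11) c).
    by rewrite -bE [RHS]/= ![(11 * _)%N]mulnC -!divn_eq.
  by apply/eqP; apply: contraNT bE => /supp ->.
exists x; rewrite [F]surjective_pairing; congr (ev2 (_, _)); apply: ps_ext => a b.
  by apply: (recompose 0%N) => // /F1; rewrite /expY; lia.
by apply: (recompose 1%N) => // /F2; rewrite /expY; lia.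
Qed.

End Decode.
End Monomials.

(** * The invariant ring and its canonical module *)

(** To give coordinates it suffices to parametrise the values of [val]. *)
Lemma coords_of_param (F : fieldType) (A : comNzRingType)
    (iota : {rmorphism pseries2 F -> A}) (E : lmodType A) (R : comNzRingType) (n : nat)
    (val : E -> R) (dec : 'rV[pseries2 F]_n -> R) (io : pseries2 F -> R) :
  injective val -> injective dec ->
  (forall w, exists x, val w = dec x) -> (forall x, exists w, val w = dec x) ->
  (forall b w w', val (iota b *: w + w') = io b * val w + val w') ->
  (forall b x y, dec (b *: x + y) = io b * dec x + dec y) ->
  exists c : E -> 'rV[pseries2 F]_n, free_coords iota c /\ forall w, val w = dec (c w).
Proof.
move=> vinj dinj /choice[c cE] /choice[d dE] vlin dlin; exists c; split=> //; split.
  exists d => [w|x]; first by apply: vinj; rewrite dE -cE.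
  by apply: dinj; rewrite -cE dE.
by move=> b w w'; apply: dinj; rewrite -cE vlin dlin !cE.
Qed.

Section Omega.
Variables (K : fieldType) (zeta ii r lam : K).
Local Notation R := (pseries2 K).

Definition O11_group : set 'M[K]_2 :=
  generated_group [set phi_mx lam; psi_mx zeta; tau_mx ii; eta_mx zeta r].
Local Notation A := (invariant_ring O11_group).
Local Notation semi22 := (semi22 zeta ii r lam).

Lemma semi22M k l f g : semi22 k f -> semi22 l g -> semi22 (k + l) (f * g).
Proof.
move=> [f1 f2] [g1 g2]; split; first exact: semi_invariantM f1 g1.
by rewrite rmorphM /= f2 g2 exprD rmorphM /=; ring.
Qed.

Lemma semi22B k f g : semi22 k f -> semi22 k g -> semi22 k (f - g).
Proof.
move=> [f1 f2] [g1 g2]; split; first exact: semi_invariantB f1 g1.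
by rewrite rmorphB /= f2 g2 mulrBr.
Qed.

Lemma semi22_0 k : semi22 k 0.
Proof. by split; [split|]; rewrite rmorph0 ?mulr0. Qed.

(** Fixing the four generators is enough, because the action is multiplicative. *)
Lemma invariant_semi22 f : (f \in invariant O11_group) <-> semi22 0 f.
Proof.
split=> [/asboolP finv|[[f1 f2 f3] f4]].
  split; [split|]; rewrite ?expr0 ?rmorph1 ?mul1r; apply: finv; apply: gen_incl; rewrite /=; tauto.
apply/asboolP => s; elim=> {s} [s|||].
- move=> [[[->|->]|->]|->].
  + by rewrite f4 expr0 rmorph1 mul1r.
  + by rewrite f1 expr0 mul1r.
  + exact: f2.
  + exact: f3.
- exact: act_one.
- by move=> g h _ gf _ hf; rewrite act_mul gf.
move=> g _ gf; have [gu|gu] := boolP (g \in unitmx); last first.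
  have -> : invmx g = g by rewrite /invmx (negbTE gu).
  exact: gf.
have E : ps_act (invmx g) (ps_act g f) = f by rewrite -act_mul (mulmxV gu) act_one.
by rewrite -[RHS]E gf.
Qed.

Lemma invariant_val_semi22 (a : A) : semi22 0 (invariant_val a).
Proof. by apply/invariant_semi22/invariant_valP. Qed.

(** Since [lam ^ 20] is the inverse of the determinant of [phi], and the other generators have
    determinant 1, these are the semi-invariants for the inverse of the determinant. *)
Definition omega_pred : {pred R} := fun f => `[< semi22 20 f >].

Fact omega_zmod_closed : zmod_closed omega_pred.
Proof.
split=> [|f g /asboolP ff /asboolP gg]; apply/asboolP; first exact: semi22_0.
exact: semi22B.
Qed.

HB.instance Definition _ := GRing.isZmodClosed.Build R omega_pred omega_zmod_closed.

Record omega := Omega { omega_val : R; omega_valP : omega_val \in omega_pred }.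

HB.instance Definition _ := [isSub for omega_val].
HB.instance Definition _ := [Choice of omega by <:].
HB.instance Definition _ := [SubChoice_isSubZmodule of omega by <:].

Lemma omega_semi22 (w : omega) : semi22 20 (omega_val w).
Proof. exact/asboolP/omega_valP. Qed.

Fact omega_scaleP (a : A) (w : omega) : invariant_val a * omega_val w \in omega_pred.
Proof. apply/asboolP; exact: semi22M (invariant_val_semi22 a) (omega_semi22 w). Qed.

Definition omega_scale a w := Omega (omega_scaleP a w).

Lemma omega_val_inj : injective omega_val. Proof. exact: val_inj. Qed.

Fact omega_scaleA a b w : omega_scale a (omega_scale b w) = omega_scale (a * b) w.
Proof. by apply: omega_val_inj; rewrite /= mulrA. Qed.
Fact omega_scale1 : left_id 1 omega_scale.
Proof. by move=> w; apply: omega_val_inj; rewrite /= mul1r. Qed.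
Fact omega_scaleDr : right_distributive omega_scale +%R.
Proof. by move=> a w w'; apply: omega_val_inj; rewrite /= mulrDr. Qed.
Fact omega_scaleDl w : {morph omega_scale^~ w : a b / a + b}.
Proof. by move=> a b; apply: omega_val_inj; rewrite /= mulrDl. Qed.

HB.instance Definition _ := GRing.Zmodule_isLmodule.Build A omega
  omega_scaleA omega_scale1 omega_scaleDr omega_scaleDl.

Lemma omega_valZ (a : A) w : omega_val (a *: w) = invariant_val a * omega_val w.
Proof. by []. Qed.

Definition aug (a : A) : K := invariant_val a 0%N 0%N.

Fact aug_zmod : zmod_morphism aug. Proof. by []. Qed.
Fact aug_monoid : monoid_morphism aug.
Proof. by split=> // a b; apply: ps_coef00M. Qed.
HB.instance Definition _ := GRing.isZmodMorphism.Build A K aug aug_zmod.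
HB.instance Definition _ := GRing.isMonoidMorphism.Build A K aug aug_monoid.

Lemma invariant_val_inj : injective (@invariant_val _ O11_group).
Proof. exact: val_inj. Qed.

Lemma aug_unit (a : A) : aug a != 0 -> exists b : A, a * b = 1.
Proof.
move=> /ps_unit[g ag]; have ginv : g \in invariant O11_group.
  apply/asboolP => s Gs; have /asboolP/(_ s Gs) as_ := invariant_valP a.
  have a0 : invariant_val a != 0.
    by apply/eqP => a0; move/eqP: ag; rewrite a0 mul0r eq_sym oner_eq0.
  by apply: (ps_mulfI a0); rewrite /= -{1}as_ -rmorphM /= ag rmorph1.
by exists (Invariant ginv); apply: invariant_val_inj.
Qed.

Lemma invariant_domain (a b : A) : a * b = 0 -> a = 0 \/ b = 0.
Proof.
move=> /(congr1 (@invariant_val _ _)) /= /ps_mulf_eq0[] E; [left|right];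
  exact: invariant_val_inj.
Qed.

Section Hyps.
Hypothesis zeta8 : 8.-primitive_root zeta.
Hypothesis ii2 : ii ^+ 2 = -1.
Hypothesis r2 : 2%:R * r ^+ 2 = 1.
Hypothesis K3 : 3%:R != 0 :> K.
Hypothesis lam22 : 22.-primitive_root lam.

Lemma semi22_mod k l f : k = l %[mod 22] -> semi22 k f -> semi22 l f.
Proof.
move=> kl [f1 f2]; split=> //; rewrite f2; congr (ps_const _ * _); apply/eqP.
by rewrite (eq_prim_root_expr lam22) kl.
Qed.

Lemma semi22_evX n : semi22 (8 * n) (ev (psX ^+ n)).
Proof.
have -> : ev (psX ^+ n) = ev2 (psX ^+ n, 0) :> R by rewrite /ev2 /= rmorph0 mulr0 addr0.
apply/semi22_ev2 => //; split=> a b /=; last by rewrite eqxx.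
rewrite -[psX ^+ n]mulr1 -(expr0 psY) coef_monom.
by case: andP => [[/eqP -> /eqP ->] _|]; rewrite ?eqxx // muln0 addn0.
Qed.

Lemma semi22_evY n : semi22 (12 * n) (ev (psY ^+ n)).
Proof.
have -> : ev (psY ^+ n) = ev2 (psY ^+ n, 0) :> R by rewrite /ev2 /= rmorph0 mulr0 addr0.
apply/semi22_ev2 => //; split=> a b /=; last by rewrite eqxx.
rewrite -[psY ^+ n]mul1r -(expr0 psX) coef_monom.
by case: andP => [[/eqP -> /eqP ->] _|]; rewrite ?eqxx // muln0 add0n.
Qed.

Fact iota_proof (b : R) : ev (dilate b) \in invariant O11_group.
Proof.
apply/invariant_semi22; have -> : ev (dilate b) = ev2 (dilate b, 0).
  by rewrite /ev2 /= rmorph0 mulr0 addr0.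
apply/semi22_ev2 => //; split=> k l; last by rewrite eqxx.
rewrite dilate_coef; case: ifP => [/andP[k11 l11] _|]; rewrite ?eqxx //; lia.
Qed.

Definition iota_inv (b : R) : A := Invariant (iota_proof b).

Fact iota_zmod : zmod_morphism iota_inv.
Proof. by move=> b b'; apply: invariant_val_inj; rewrite /= !rmorphB. Qed.
Fact iota_monoid : monoid_morphism iota_inv.
Proof.
by split=> [|b b']; apply: invariant_val_inj; rewrite /= ?rmorph1 // !rmorphM.
Qed.
HB.instance Definition _ := GRing.isZmodMorphism.Build R A iota_inv iota_zmod.
HB.instance Definition _ := GRing.isMonoidMorphism.Build R A iota_inv iota_monoid.
Let iota : {rmorphism R -> A} := iota_inv.

Lemma aug_iota b : aug (iota b) = b 0%N 0%N.
Proof. by rewrite -[LHS]/(ev (dilate b) 0%N 0%N) ev_coef0 dvdn0 div0n dilate_coef. Qed.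

Lemma coordsA_exist : exists c : A^o -> 'rV[R]_22,
  free_coords iota c /\ forall a, invariant_val a = decode 0 (c a).
Proof.
apply: (@coords_of_param _ _ iota A^o _ _ (@invariant_val _ _) (decode 0)
  (fun b => ev (dilate b))).
- exact: invariant_val_inj.
- exact: decode_inj.
- by move=> a; apply: (decode_onto zeta8 ii2 r2 K3 lam22 (h := 0)); apply: invariant_val_semi22.
- move=> x; have xinv : decode 0 x \in invariant O11_group.
    by apply/invariant_semi22/(decode_semi zeta8 ii2 r2 K3 lam22 0).
  by exists (Invariant xinv).
- by [].
- exact: decode_linear.
Qed.

Lemma coordsW_exist : exists c : omega -> 'rV[R]_22,
  free_coords iota c /\ forall w, omega_val w = decode 10 (c w).
Proof.
apply: (@coords_of_param _ _ iota omega _ _ omega_val (decode 10)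
  (fun b => ev (dilate b))).
- exact: omega_val_inj.
- exact: decode_inj.
- by move=> w; apply: (decode_onto zeta8 ii2 r2 K3 lam22 (h := 10)); apply: omega_semi22.
- move=> x; have xinv : decode 10 x \in omega_pred.
    by apply/asboolP/(decode_semi zeta8 ii2 r2 K3 lam22 10).
  by exists (Omega xinv).
- by [].
- exact: decode_linear.
Qed.

Section Duality.
Variables (cA : A^o -> 'rV[R]_22) (cW : omega -> 'rV[R]_22).
Hypothesis cAP : free_coords iota cA.
Hypothesis cAE : forall a, invariant_val a = decode 0 (cA a).
Hypothesis cWP : free_coords iota cW.
Hypothesis cWE : forall w, omega_val w = decode 10 (cW w).

(** The coefficient of [W ^ 10 T ^ 20 z], the last basis monomial of [omega]. *)
Definition ell (w : omega) : K := cW w 0 ord_max 0%N 0%N.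

Lemma ellE (w : omega) (F : (R * R)%type) : omega_val w = ev2 F -> ell w = F.2 10%N 10%N.
Proof.
rewrite cWE => /ev2_inj <-; rewrite assemble_coef /= /ell.
by congr (coef2 (cW w 0 _) _ _); apply: val_inj; rewrite /= inordK.
Qed.

Lemma ell_residual : residual iota ell.
Proof.
split=> [x y|b x]; first by rewrite /ell (coordsD cWP) mxE.
by rewrite /ell (coordsZ cWP) mxE ps_coef00M.
Qed.

Let e i : A := basis_vec cA i.

(** The product of the complementary monomials with exponents [a, b, c] and
    [10 - a, 10 - b, 1 - c] is [W ^ 10 T ^ 20 z], and reversing the index passes to the
    complement: index [11 c + a] becomes [11 (1 - c) + 10 - a]. *)
Lemma ell_pairing j w : ell (e (rev_ord j) *: w) = cW w 0 j 0%N 0%N.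
Proof.
have j22 := ltn_ord j.
have iE : (rev_ord j = 21 - j :> nat)%N by rewrite /=; lia.
move: (rev_ord j) iE => i iE.
have ei : invariant_val (e i) = ev (psX ^+ (i %% 11) * psY ^+ expY 0 (i %% 11) (i %/ 11)) *
    (if (i < 11)%N then 1 else formZ K) by rewrite cAE (coords_basis_vec cAP) decode_unit.
have vE : omega_val (e i *: w) = invariant_val (e i) * decode 10 (cW w).
  by rewrite omega_valZ cWE.
have a10 : (i %% 11 <= 10)%N by rewrite -ltnS ltn_mod.
have b10 : (expY 0 (i %% 11) (i %/ 11) <= 10)%N by rewrite -ltnS ltn_mod.
rewrite ei in vE; have [i11|i11] := ltnP i 11.
  rewrite i11 mulr1 /decode ev2_mul in vE.
  rewrite (ellE vE) [snd _]/= coef_monomM a10 b10 assemble_coef.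
  rewrite (_ : _ == _); last by apply/eqP; rewrite /expY; lia.
  congr (coef2 (cW w 0 _) _ _); [|lia|lia].
  by apply: val_inj; rewrite /= inordK; lia.
have {}vE : omega_val (e i *: w) = ev (psX ^+ (i %% 11) * psY ^+ expY 0 (i %% 11) (i %/ 11)) *
    (formZ K * decode 10 (cW w)) by rewrite vE ltnNge i11 -mulrA.
rewrite /decode ev2_mulZ ev2_mul in vE.
rewrite (ellE vE) [snd _]/= coef_monomM a10 b10 assemble_coef.
rewrite (_ : _ == _); last by apply/eqP; rewrite /expY; lia.
congr (coef2 (cW w 0 _) _ _); [|lia|lia].
by apply: val_inj; rewrite /= inordK; lia.
Qed.

Lemma ell_onto (psi : A^o -> K) : residual iota psi ->
  exists h, forall a : A, ell (a *: h) = psi a.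
Proof.
move=> psiP; have [h hE] := coords_surj cWP (\row_j ps_const (psi (e (rev_ord j)))).
exists h => a; have aE : a = \sum_i iota (cA a 0 i) *: (e i : A^o) := basis_vecE cAP a.
rewrite {2}[a]aE (residual_sum _ _ _ psiP).
rewrite {1}[a]aE scaler_suml (residual_sum _ _ _ ell_residual).
apply: eq_bigr => i _; rewrite -scalerA (proj2 ell_residual) (proj2 psiP); congr (_ * _).
by rewrite -{1}(rev_ordK i) ell_pairing hE mxE /= rev_ordK.
Qed.

Lemma ell_faithful w : (forall a, ell (a *: w) = 0) ->
  exists w1 w2, w = iota psX *: w1 + iota psY *: w2.
Proof. by move=> w0; apply: (coords_XY cWP) => j; rewrite -ell_pairing. Qed.

End Duality.

(** The prime of height one in the chain that shows that the dimension is at least 2. *)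
Definition line_ideal : set A := [set a | resY (invariant_val a) = 0].

Lemma line_prime : prime_ideal line_ideal.
Proof.
split.
- split=> [|a b|a b]; rewrite /line_ideal /= ?rmorph0 // ?rmorphD ?rmorphM /=.
    by move=> -> ->; rewrite addr0.
  by move=> ->; rewrite mulr0.
- by rewrite /line_ideal /= rmorph1 => /eqP; rewrite oner_eq0.
- by move=> a b; rewrite /line_ideal /= rmorphM => /ps_mulf_eq0.
Qed.

Lemma krull_dim_invariants : krull_dim A 2.
Proof.
have [cA [cAP _]] := coordsA_exist.
apply: (@krull_dimA _ _ iota aug _ cA cAP aug_iota aug_unit invariant_domain line_ideal).
- exact: line_prime.
- exists (iota psY).
    by rewrite /line_ideal /= dilateY rmorphXn /= evY !rmorphXn /= resY_formT expr0n /= expr0n.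
  move=> /(congr1 (@invariant_val _ _)); rewrite /= dilateY => E.
  have /ev2_eq0/(congr1 fst) : ev2 (psY ^+ 11, 0) = 0 :> R.
    by rewrite /ev2 /= rmorph0 mulr0 addr0 E.
  move=> /(congr1 (fun f : R => f 0%N 11%N)).
  by rewrite [fst _]/= -[psY ^+ 11]mul1r -(expr0 psX) coef_monom => /eqP; rewrite oner_eq0.
- move=> mP; have : aug_ideal aug (iota psX) by rewrite /aug_ideal /= aug_iota.
  move=> /mP; rewrite /line_ideal /= dilateX rmorphXn /= evX rmorphXn /= resY_formW -exprM.
  by move=> /(congr1 (fun f : R => f 88%N 0%N)); rewrite coef_expX => /eqP; rewrite oner_eq0.
Qed.

Lemma mul_omega_proof g : semi22 24 g -> forall w : omega, g * omega_val w \in invariant O11_group.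
Proof.
move=> gs w; apply/invariant_semi22; apply: (@semi22_mod (24 + 20)) => //.
exact: semi22M gs (omega_semi22 w).
Qed.

Lemma mul_omega g : semi22 24 g -> exists phi : {linear omega -> A^o},
  forall w, invariant_val (phi w) = g * omega_val w.
Proof.
move=> gs; pose f (w : omega) : A^o := Invariant (mul_omega_proof gs w).
have flin : linear f.
  by move=> a w w'; apply: invariant_val_inj; rewrite /= mulrDr mulrCA.
exists (HB.pack f (GRing.isLinear.Build _ _ _ _ f flin) : {linear omega -> A^o}).
by [].
Qed.

(** Every monomial of positive degree that occurs in an invariant is divisible by [W ^ 3] or
    by [T ^ 4]; both have degree 2 modulo 22, so that the quotient lies in [omega]. *)
Lemma invariant_split a : aug a = 0 -> exists w1 w2 : omega,
  invariant_val a = formW K ^+ 3 * omega_val w1 + formT K ^+ 4 * omega_val w2.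
Proof.
move=> a0; have [F aE /(semi22_ev2 zeta8 ii2 r2 lam22)[F1 F2]] :=
  semi22P zeta8 ii2 r2 K3 (invariant_val_semi22 a).
have F00 : F.1 0%N 0%N = 0 by rewrite -ev2_coef00 -aE.
pose G (f : R) : R := PSeries2 (fun i j => f (i + 3)%N j).
pose H (f : R) : R := PSeries2 (fun i j => if (i < 3)%N then f i (j + 2)%N else 0).
have splitF (f : R) : (forall i j, f i j != 0 -> (3 <= i)%N || (2 <= j)%N) ->
    f = psX ^+ 3 * G f + psY ^+ 2 * H f.
  move=> supp; apply: ps_ext => i j; rewrite ps_coefD coef_psXnM coef_psYnM.
  have [i3|i3] := leqP 3 i; have [j2|j2] := leqP 2 j.
  - by rewrite /= subnK // [(i < 3)%N]ltnNge i3 addr0.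
  - by rewrite /= subnK // addr0.
  - by rewrite /= subnK // i3 add0r.
  - by rewrite addr0; apply/eqP; apply: contraT => /supp; lia.
have w1P : semi22 20 (ev2 (G F.1, G F.2)).
  by apply/semi22_ev2 => //; split=> i j /=; [move/F1|move/F2]; lia.
have w2P : semi22 20 (ev2 (H F.1, H F.2)).
  by apply/semi22_ev2 => //; split=> i j /=; case: ifP; rewrite ?eqxx // => _;
    [move/F1|move/F2]; lia.
exists (Omega (asboolT w1P)), (Omega (asboolT w2P)).
rewrite aE /= -evX -[formT K ^+ 4]/(formT K ^+ (2 * 2)) exprM -evY -!rmorphXn /=.
rewrite !ev2_mul -raddfD /= [F in LHS]surjective_pairing.
congr (ev2 (_, _)); apply: splitF => i j Fij.
  have := F1 _ _ Fij; case: i j Fij => [|[|[|i]]] // [|[|j]] //= ; rewrite ?F00 ?eqxx //; lia.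
have := F2 _ _ Fij; lia.
Qed.

Theorem nearly_gorenstein_invariants : nearly_gorenstein A.
Proof.
have [cA [cAP cAE]] := coordsA_exist; have [cW [cWP cWE]] := coordsW_exist.
have dimA := krull_dim_invariants.
exists (aug_ideal aug); split.
- exact: (local_ringA cAP aug_unit).
- exists 2%N; split=> //.
  exact: (depthA cAP aug_iota aug_unit).
exists omega; split.
  apply: (canonical_moduleW cAP aug_iota cWP (ell_residual cWP)) => //.
    exact: (ell_onto cAP cAE cWP cWE).
  exact: (ell_faithful cAP cAE cWP cWE).
move=> a a0; have [w1 [w2 aE]] := invariant_split a0.
have [p1 p1E] : exists phi : {linear omega -> A^o},
    forall w, invariant_val (phi w) = formW K ^+ 3 * omega_val w.
  by apply: mul_omega; rewrite -evX -rmorphXn /=; apply: (semi22_evX 3).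
have [p2 p2E] : exists phi : {linear omega -> A^o},
    forall w, invariant_val (phi w) = formT K ^+ 4 * omega_val w.
  apply: mul_omega; rewrite -[formT K ^+ 4]/(formT K ^+ (2 * 2)) exprM -evY -rmorphXn /=.
  exact: (semi22_evY 2).
exists 2%N, (fun i => if i == 0 then p1 else p2), (fun i => if i == 0 then w1 else w2).
rewrite sum_I2 /=; apply: invariant_val_inj.
by rewrite aE -p1E -p2E.
Qed.

End Hyps.
End Omega.

(* The scalar factor of [eta] is moved into its entries. *)
Lemma O11E (RR : realType) (lam zeta : RR[i]) :
  O11 lam zeta = O11_group zeta 'i%C ((Num.sqrt (2 : RR))%:C)%C^-1 lam.
Proof.
rewrite /O11 /O11_group; congr (generated_group [set _; _; _; _]%classic).
by apply/matrixP => i j; rewrite !mxE; case: eqP; case: eqP.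
Qed.

Theorem proposition3p1 (RR : realType) (lam zeta : RR[i])
    (hlam : 22.-primitive_root lam) (hzeta : 8.-primitive_root zeta) :
  nearly_gorenstein (invariant_ring (O11 lam zeta)).
Proof.
rewrite O11E; apply: nearly_gorenstein_invariants => //.
- exact: sqr_i.
- by rewrite exprVn -rmorphXn /= sqr_sqrtr ?ler0n // rmorph_nat divff // pnatr_eq0.
- by rewrite pnatr_eq0.
Qed.
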